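(* Let $K\in\mathcal K^n$. If $s\in\mathbb N_0$ is even, then $$\int_{\mathcal E_1^n}\Phi^{(E)}_{0,0,s}(K\cap E)\,\mu_1^n(dE)=\frac{2\,\omega_{n+s+1}}{\pi\, s!\,\omega_{s+1}^2\,\omega_n}\sum_{k=0}^{s/2}c_k^{(s/2)}\,Q^{\frac s2-k}\,\Phi_{n-1,0,2k}(K),$$ with constants $$c_k^{(m)}=(-1)^k\binom mk\frac{(2k)!\,\omega_{2k+1}}{1-2k}$$ for $m\in\mathbb N_0$ and $k=0,\dots,m$. For odd $s\in\mathbb N_0$ the integral $\int_{\mathcal E_1^n}\Phi^{(E)}_{0,0,s}(K\cap E)\,\mu_1^n(dE)$ is zero.
   Context: $\mathcal K^n$ is the set of convex bodies (compact convex subsets, including $\emptyset$) of $\mathbb R^n$. $\kappa_m$ and $\omega_m$ are the volume and surface area of the unit ball $B^m$ in $\mathbb R^m$, $\omega_m=2\pi^{m/2}/\Gamma(m/2)$. $\mathcal E^n_1$ is the space of affine lines in $\mathbb R^n$ (usual topology and Borel $\sigma$-algebra), and $\mu^n_1$ is the motion invariant measure on it normalized by $\mu_1^n(\{E: E\cap B^n\ne\emptyset\})=\kappa_{n-1}$. For $E\in\mathcal E_1^n$, $\pi(E)$ is the linear subspace parallel to $E$ and $E^\perp=\pi(E)^\perp$. Tensors: $\mathbb T^p$ is the space of symmetric tensors of rank $p$ over $\mathbb R^n$. Products of tensors are symmetric tensor products; $x\in\mathbb R^n$ is identified with the rank-1 tensor $z\mapsto\langle z,x\rangle$, and $x^p$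 is the $p$-fold symmetric tensor product, i.e. $x^p(z_1,\dots,z_p)=\prod_i\langle x,z_i\rangle$. The metric tensor is $Q(x,y)=\langle x,y\rangle$. Tensor-valued integrals are taken coordinate-wise. Support measures: for non-empty $K\in\mathcal K^n$ let $p(K,x)$ be the metric projection of $x$ onto $K$ and $u(K,x)=(x-p(K,x))/\|x-p(K,x)\|$ for $x\notin K$. The measures $\Lambda_0(K,\cdot),\dots,\Lambda_{n-1}(K,\cdot)$ on $\mathbb R^n\times S^{n-1}$ are defined by the local Steiner formula $$\lambda(\{x\in (K+\epsilon B^n)\setminus K:(p(K,x),u(K,x))\in A\})=\sum_{k=0}^{n-1}\epsilon^{n-k}\kappa_{n-k}\Lambda_k(K,A)$$ for all $\epsilon>0$ and Borel $A$, where $\lambda$ is Lebesgue measure; they are zero if $K=\emptyset$. Surface tensors: $\Phi_{n-1,0,s}(K)=\frac{\omega_1}{s!\,\omega_{1+s}}\int_{\mathbb R^n\times S^{n-1}}u^s\,\Lambda_{n-1}(K,d(x,u))\in\mathbb T^s$, and $\Phi_{n-1,0,s}(\emptyset)=0$. Relative tensors: for non-empty $K$ contained in a line $E$, $\Lambda_0^{(E)}(K,\cdot)$ is the image measure of the restriction of $\Lambda_0(K,\cdot)$ to $\mathbb R^n\times(S^{n-1}\setminus E^\perp)$ under $(x,u)\mapsto(x,p_{\pi(E)}(u)/\|p_{\pi(E)}(u)\|)$, where $p_{\pi(E)}$ is orthogonal projection onto $\pi(E)$; and $$\Phi^{(E)}_{0,0,s}(K)=\frac{\omega_1}{s!\,\omega_{1+s}}\int_{E\times(S^{n-1}\cap\pi(E))}u^s\,\Lambda^{(E)}_0(K,d(x,u)),\qquad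 \Phi^{(E)}_{0,0,s}(\emptyset)=0.$$ *)

(* Defs.v *)
From HB Require Import structures.
From mathcomp Require Import all_boot all_order all_algebra all_fingroup.
From mathcomp Require Import all_classical all_reals all_analysis.
Unset Strict Implicit.
Unset Printing Implicit Defensive.
Import Order.TTheory GRing.Theory Num.Theory.
Import numFieldNormedType.Exports.
Local Open Scope classical_set_scope.
Local Open Scope ring_scope.

Notation borel T := (g_sigma_algebraType (@open T)).

Section Euclidean.
Context {R : realType}.

Definition dotp {n} (x y : 'rV[R]_n) : R := \sum_i x ord0 i * y ord0 i.

(* The library norm on ['rV[R]_n] is the sup norm; both induce the same
   topology. *)
Definition enorm {n} (x : 'rV[R]_n) : R := Num.sqrt (dotp x x).

Definition unit_ball (n : nat) : set 'rV[R]_n := [set x | enorm x <= 1].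
Definition unit_sphere (n : nat) : set 'rV[R]_n := [set u | enorm u = 1].
Definition normalize {n} (v : 'rV[R]_n) : 'rV[R]_n := (enorm v)^-1 *: v.

Definition convex_body {n} (K : set 'rV[R]_n) : Prop :=
  compact K /\ convex_set (K : set (convex_lmodType 'rV[R]_n)).

(* Lebesgue measure, by iterated integration (Tonelli). It is only meant to be
   evaluated at Borel sets; at dimension 0 it is the unit mass of the single
   point. *)
Fixpoint lebesgue_rV {n : nat} : set 'rV[R]_n -> \bar R :=
  match n with
  | 0 => fun A => (\1_A (0 : 'rV[R]_0))%:E
  | m.+1 => fun A =>
      (\int[lebesgue_measure]_t
         lebesgue_rV [set y : 'rV[R]_m | A (row_mx (t%:M : 'rV[R]_1) y)])%E
  end.

Definition Gamma (x : R) : R :=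
  \int[lebesgue_measure]_(t in `]0, +oo[) (t `^ (x - 1) * expR (- t)).

Definition kappa (m : nat) : R := fine (lebesgue_rV (unit_ball m)).

Definition omega (m : nat) : R :=
  2 * pi `^ (m%:R / 2) / Gamma (m%:R / 2).

(* Tensors of rank [p] are represented by their evaluation on [p] vectors; all
   tensors below are symmetric and multilinear. *)
Definition tensor (n p : nat) : Type := ('I_p -> 'rV[R]_n) -> R.

Definition cast_tensor {n p q} (e : p = q) (T : tensor n p) : tensor n q :=
  fun z => T (fun i => z (cast_ord e i)).

Definition vpow {n} (x : 'rV[R]_n) (p : nat) : tensor n p :=
  fun z => \prod_i dotp x (z i).

Definition metric_tensor (n : nat) : tensor n 2 :=
  fun z => dotp (z ord0) (z ord_max).

(* The normalization is such that [symprod (vpow x p) (vpow x q)] is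
   [vpow x (p + q)]. *)
Definition symprod {n p q} (a : tensor n p) (b : tensor n q) :
    tensor n (p + q) :=
  fun z => ((p + q)`!%:R)^-1 *
    \sum_(sigma : {perm 'I_(p + q)})
      a (fun i => z (sigma (lshift q i))) * b (fun j => z (sigma (rshift p j))).

Fixpoint sympow {n p} (a : tensor n p) (j : nat) : tensor n (j * p) :=
  match j with
  | 0 => fun _ => 1
  | i.+1 => symprod a (sympow a i)
  end.

(* The metric projection; the minimizer is unique for a nonempty convex body. *)
Definition metric_proj {n} (K : set 'rV[R]_n) (x : 'rV[R]_n) : 'rV[R]_n :=
  get [set p | K p /\ forall y, K y -> enorm (x - p) <= enorm (x - y)].

Definition outer_unit {n} (K : set 'rV[R]_n) (x : 'rV[R]_n) : 'rV[R]_n :=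
  normalize (x - metric_proj K x).

Definition parallel_body {n} (K : set 'rV[R]_n) (eps : R) : set 'rV[R]_n :=
  [set x | exists2 y, K y & exists2 b, unit_ball n b & x = y + eps *: b].

(* Measures on R^n x S^(n-1) are encoded as Borel measures on R^n x R^n. *)
Definition support_space (n : nat) := borel ('rV[R]_n * 'rV[R]_n)%type.

(* [Lambda k K] is the k-th support measure of K, for k < n. Since
   [outer_unit K x] is a unit vector for x outside of K, the Steiner formula
   for A disjoint from R^n x S^(n-1) forces the [Lambda k K] to be concentrated
   on R^n x S^(n-1). *)
Definition is_support_measures {n}
    (Lambda : nat -> set 'rV[R]_n -> {measure set (support_space n) -> \bar R})
    : Prop :=
  (forall K, convex_body K -> K !=set0 ->
     forall eps : R, 0 < eps ->
     forall A : set (support_space n), measurable A ->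
     lebesgue_rV ((parallel_body K eps `\` K) `&`
                  [set x | A (metric_proj K x, outer_unit K x)]) =
     (\sum_(k < n) (eps ^+ (n - k) * kappa (n - k))%:E * Lambda k K A)%E) /\
  (forall (k : nat) (A : set (support_space n)), (k < n)%N -> measurable A ->
     Lambda k set0 A = 0%E).

Definition line_through {n} (x v : 'rV[R]_n) : set 'rV[R]_n :=
  [set y | exists t : R, y = x + t *: v].

Definition affine_lines (n : nat) : set (set 'rV[R]_n) :=
  [set E | exists x v, v != 0 /\ E = line_through x v].

(* The space of affine lines; it is nonempty only in positive dimension. *)
Definition line (n : nat) : Type := set_type (affine_lines n).
HB.instance Definition _ n := Choice.on (line n).

Definition line_set {n} (E : line n) : set 'rV[R]_n := val E.

Lemma affine_lines_nonempty n :
  @line_through n.+1 0 (const_mx 1) \in affine_lines n.+1.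
Proof.
apply/mem_set; exists 0, (const_mx 1); split => //.
by apply/eqP => /rowP /(_ ord0); rewrite !mxE; apply/eqP; exact: oner_neq0.
Qed.

HB.instance Definition _ n :=
  isPointed.Build (line n.+1) (SigSub (affine_lines_nonempty n)).

(* The usual topology on the space of lines is the final one for
   (x, v) |-> x + R v, v <> 0. *)
Definition line_open {n} : set_system (line n) :=
  [set U | open [set xv : 'rV[R]_n * 'rV[R]_n | xv.2 != 0 /\
             exists2 E : line n, U E & line_set E = line_through xv.1 xv.2]].

Lemma line_set_inj {n} : injective (@line_set n).
Proof. exact: val_inj. Qed.

Lemma line_openT n : line_open [set: line n.+1].
Proof.
rewrite /line_open /=.
rewrite (_ : mkset _ = snd @^-1` (~` [set (0 : 'rV[R]_n.+1)])).
  apply: open_comp; first by move=> x _; exact: cvg_snd.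
  rewrite openC; apply: accessible_closed_set1.
  exact/hausdorff_accessible/norm_hausdorff.
apply/seteqP; split => -[x v] /=; first by move=> [/eqP].
move=> vn0; have v0 : v != 0 by apply/eqP.
split => //; have lxv : line_through x v \in affine_lines n.+1.
  by apply/mem_set; exists x, v.
by exists (SigSub lxv).
Qed.

Lemma line_openI n (U V : set (line n)) :
  line_open U -> line_open V -> line_open (U `&` V).
Proof.
move=> oU oV; rewrite /line_open /=.
have := openI oU oV; congr open; apply/seteqP; split => -[x v] /=.
- move=> [[v0 [E UE Ee]] [_ [F VF Fe]]]; split => //; exists E => //.
  by split=> //; suff <- : F = E by []; apply: line_set_inj; rewrite Fe Ee.
- by move=> [v0 [E [UE VE] Ee]]; split; split => //; exists E.
Qed.

Lemma line_open_bigU n (I : Type) (f : I -> set (line n)) :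
  (forall i, line_open (f i)) -> line_open (\bigcup_i f i).
Proof.
move=> of_; rewrite /line_open /=.
have := bigcup_open (fun i (_ : setT i) => of_ i); congr open.
apply/seteqP; split => -[x v] /=.
- by move=> [i _ [v0 [E fE Ee]]]; split => //; exists E => //; exists i.
- by move=> [v0 [E [i _ fE] Ee]]; exists i => //; split => //; exists E.
Qed.

HB.instance Definition _ n := @isOpenTopological.Build (line n.+1)
  (@line_open n.+1) (@line_openT n) (@line_openI n.+1) (@line_open_bigU n.+1).

Definition line_space (n : nat) := borel (line n.+1).

(* Invariance under the rigid motions y |-> y A + b with A a rotation, in
   R^(n+1). *)
Definition is_motion_invariant {n}
    (mu : {measure set (line_space n) -> \bar R}) : Prop :=
  forall (A : 'M[R]_n.+1) (b : 'rV[R]_n.+1), A *m A^T = 1%:M -> \det A = 1 ->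
  forall X : set (line_space n), measurable X ->
  mu [set F : line n.+1 | exists2 E : line n.+1, X E &
        line_set F = [set y *m A + b | y in line_set E]] = mu X.

Definition is_line_measure {n} (mu : {measure set (line_space n) -> \bar R}) :
    Prop :=
  is_motion_invariant mu /\
  mu [set E : line n.+1 | line_set E `&` unit_ball n.+1 !=set0] =
    (kappa n)%:E.

Definition tensor_coef (s : nat) : R := omega 1 / (s`!%:R * omega s.+1).

(* The ambient space is R^(n+1), so this is the top-order tensor Phi_{n,0,s};
   it vanishes at the empty set because Lambda does. *)
Definition surface_tensor {n}
    (Lambda : nat -> set 'rV[R]_n.+1 ->
              {measure set (support_space n.+1) -> \bar R})
    (s : nat) (K : set 'rV[R]_n.+1) : tensor n.+1 s :=
  fun z => tensor_coef s *
    \int[Lambda n K]_(xu in [set: 'rV[R]_n.+1] `*` unit_sphere n.+1)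
       vpow xu.2 s z.

Definition direction {n} (E : set 'rV[R]_n) : set 'rV[R]_n :=
  [set v | exists x y, [/\ E x, E y & v = x - y]].

Definition orth_compl {n} (W : set 'rV[R]_n) : set 'rV[R]_n :=
  [set u | forall w, W w -> dotp u w = 0].

Definition orth_proj {n} (W : set 'rV[R]_n) (u : 'rV[R]_n) : 'rV[R]_n :=
  get [set w | W w /\ orth_compl W (u - w)].

(* The image under (x, u) |-> (x, p(u)/|p(u)|), p the orthogonal projection onto
   the direction of E, of Lambda_0(K, .) restricted to R^n x (S^(n-1) \ E^perp);
   meant for K contained in the line E. *)
Definition relative_measure {n}
    (Lambda : nat -> set 'rV[R]_n -> {measure set (support_space n) -> \bar R})
    (E K : set 'rV[R]_n) : set (support_space n) -> \bar R :=
  pushforward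
    (fun A : set (support_space n) => Lambda 0%N K
       (A `&` ([set: 'rV[R]_n] `*`
               (unit_sphere n `\` orth_compl (direction E)))))
    (fun xu : support_space n =>
       (xu.1, normalize (orth_proj (direction E) xu.2)) : support_space n).

Definition relative_tensor {n}
    (Lambda : nat -> set 'rV[R]_n -> {measure set (support_space n) -> \bar R})
    (E : set 'rV[R]_n) (s : nat) (K : set 'rV[R]_n) : tensor n s :=
  fun z => tensor_coef s *
    fine (\int[relative_measure Lambda E K]_(xu in
            E `*` (unit_sphere n `&` direction E)) (vpow xu.2 s z)%:E)%E.

Definition crofton_coef (m k : nat) : R :=
  (-1) ^+ k * 'C(m, k)%:R *
  ((2 * k)`!%:R * omega (2 * k).+1 / (1 - (2 * k)%:R)).

End Euclidean.

Arguments omega {R} m.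
Arguments kappa {R} m.
Arguments crofton_coef {R} m k.
Arguments metric_tensor {R} n.

Lemma even_rank (s : nat) (k : 'I_(s./2).+1) :
  ~~ odd s -> ((s./2 - k) * 2 + 2 * k)%N = s.
Proof.
move=> evs; rewrite (mulnC 2%N) -mulnDl subnK ?muln2 ?even_halfK//.
by rewrite -ltnS.
Qed.

(* Main.v *)
Require Import Defs.
From HB Require Import structures.
From mathcomp Require Import all_boot all_order all_algebra all_fingroup.
From mathcomp Require Import all_classical all_reals all_analysis.
From mathcomp Require Import measurable_realfun ring lra.
Set Implicit Arguments.
Unset Strict Implicit.
Unset Printing Implicit Defensive.
Import Order.TTheory GRing.Theory Num.Theory.
Import numFieldNormedType.Exports.
Local Open Scope classical_set_scope.
Local Open Scope ring_scope.

(* Let u(K, x) be the outer unit normal of K at x and v the direction of a line E. Along E the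
   distance to K is a convex function of the arc length whose derivative off K is <u(K, x), v>, so
   |<u(K, x), v>| integrates over the part of E in K_eps \ K to 2 eps if E hits K, and to at most
   2 eps in general. Multiplying by phi(v), integrating over the lines, and disintegrating mu by
   translation invariance squeezes an integral over K_eps \ K of a function H(u(K, x)) between
   2 eps times the integrals of phi over the lines hitting K and K_eps; the Steiner formula and
   eps -> 0 yield the Crofton formula int_{E hits K} phi(v_E) mu(dE) = c int H(u) dLambda_n(K).
   For phi(v) = <v, y>^(2m), the function H is computed from the rotation invariance of mu: moving
   u by an infinitesimal rotation gives recursions between the moments |<v, u>| <v, u>^a <v, w>^q
   with w orthogonal to u, and the coefficients 1 / (1 - 2k) come out as finite differences of
   4^p / C(2p, p). The constant is normalized with the unit ball. Polarization passes from powers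
   of one vector to symmetric tensors, and the relative tensor of a segment in E is explicit since
   Lambda_0 gives mass 1/2 to the normals pointing to either side of E. *)

(** * Borel sets and Lebesgue measure *)

Section borel_sets.

(** The line measure is given only by its invariance and one normalization, with no product form
    over directions and positions. A weight that depends on the line alone takes the place of a
    measure on directions: averaging over the translations by points of the unit ball and exchanging
    integrals leaves each line weighted by the length of its chord in that ball. All moments are
    taken against this chord weight, which rotations about the origin preserve. Its total mass is
    never computed, since testing the final formula on the unit ball fixes the one unknown factor. A
    line has a unit direction only up to sign, so invariance is applied to even functions of the
    direction. Derivatives are replaced by inequalities: the distance to K enters through its
    subgradient, and a rotated moment through a first-order expansion with uniform quadratic
    remainder, so that no differentiation under the integral sign occurs. The function |x| is not
    differentiable at 0, but |x| x is, and the recursions therefore start from a monomial with one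
    extra factor x. *)

Lemma borel_open (T : ptopologicalType) (U : set T) :
  open U -> measurable (U : set (borel T)).
Proof. exact: sub_sigma_algebra. Qed.

Lemma borel_closed (T : ptopologicalType) (C : set T) :
  closed C -> measurable (C : set (borel T)).
Proof.
by move=> cC; rewrite -(setCK C); apply: measurableC; apply: borel_open;
  rewrite openC.
Qed.

Lemma measurable_fun_borel d (X : measurableType d) (T : ptopologicalType)
    (f : X -> borel T) :
  (forall U : set T, open U -> measurable (f @^-1` U)) -> measurable_fun setT f.
Proof.
move=> fU; apply: (@measurability _ _ _ (borel T) _ _ (@open T)) => // _ [U oU <-].
by rewrite setTI; exact: fU.
Qed.

Lemma continuous_borel (S T : ptopologicalType) (f : S -> T) :
  continuous f -> measurable_fun [set: borel S] (f : borel S -> borel T).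
Proof.
move=> cf; apply: measurable_fun_borel => U oU; apply: borel_open.
exact: open_comp.
Qed.

Lemma continuous_borelR (R : realType) (S : ptopologicalType) (f : S -> R) :
  continuous f -> measurable_fun [set: borel S] (f : borel S -> R).
Proof.
move=> cf; apply: (@measurability _ _ _ R _ _ (@RGenOInfty.G R)).
  exact: RGenOInfty.measurableE.
move=> _ [_ [a ->] <-]; rewrite setTI; apply: borel_open.
by apply: open_comp => //; exact: open_gt.
Qed.

End borel_sets.

Section row_vectors.
Context {R : realType}.
Local Notation RM := (measurableTypeR R).

(** The Borel sets come from the topology, not from the coordinates. An open set is a countable
    union of cubes with rational centre and radius, and the preimage of a cube is a finite
    intersection of coordinate conditions. *)
Lemma measurable_fun_rV d (X : measurableType d) n
    (f : X -> borel 'rV[R]_n) :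
  (forall i, measurable_fun setT (fun x => f x ord0 i)) -> measurable_fun setT f.
Proof.
move=> mf; apply: measurable_fun_borel => U oU.
pose box (p : 'rV[rat]_n * rat) : set 'rV[R]_n :=
  [set x | forall i, `|x ord0 i - ratr (p.1 ord0 i)| < ratr p.2].
have -> : U = \bigcup_(p in [set p | box p `<=` U]) box p.
  apply/seteqP; split=> [x Ux|x [p /= pU]]; last exact: pU.
  have /nbhs_ballP[e /= e0 xeU] : nbhs x U by rewrite nbhsE; exists U.
  have [r] := rat_in_itvoo (divr_gt0 e0 (ltr0n R 2)).
  rewrite in_itv /= => /andP[r0 re].
  have xq i : exists q : rat, `|x ord0 i - ratr q| < ratr r.
    have /rat_in_itvoo[q] : x ord0 i - ratr r < x ord0 i + ratr r.
      by rewrite ltrD2l gtrN.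
    by rewrite in_itv /= => /andP[q1 q2]; exists q; rewrite ltr_norml; apply/andP; split; lra.
  have [q qP] := choice xq.
  exists (\row_i q i, r) => /=; last by move=> i; rewrite mxE; exact: qP.
  move=> y /= yb; apply: xeU; split=> // i j; rewrite ord1 /ball /=.
  have := yb j; have := qP j; rewrite mxE => xj yj.
  rewrite (_ : x ord0 j - y ord0 j = (x ord0 j - ratr (q j)) -
    (y ord0 j - ratr (q j))); last by ring.
  apply: (le_lt_trans (ler_normB _ _)).
  by move: xj yj re; set a := ratr r; set b := `|_|; set c := `|_| => *; lra.
rewrite preimage_bigcup bigcup_mkcond.
apply: (countable_bigcupT_measurable (countableP _)) => p; case: ifPn => // _.
have -> : f @^-1` box p =
    \bigcap_(i in [set: 'I_n]) [set x | `|f x ord0 i - ratr (p.1 ord0 i)| < ratr p.2].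
  by apply/seteqP; split => x /= xp; [move=> i _; exact: xp|move=> i; exact: xp].
apply: fin_bigcap_measurable => // i _.
rewrite -[X in measurable X]setTI; apply: measurable_fun_ltr => //.
  apply: measurableT_comp; first exact: normr_measurable.
  exact: measurable_funB.
Qed.

Lemma coord_measurable n (i : 'I_n) :
  measurable_fun [set: borel 'rV[R]_n] (fun x : borel 'rV[R]_n => x ord0 i).
Proof. by apply: continuous_borelR; exact: coord_continuous. Qed.

Lemma row_mx_head m (t : R) (y : 'rV[R]_m) (j : 'I_1) :
  row_mx (t%:M : 'rV_1) y ord0 (lshift m j) = t.
Proof. by rewrite row_mxEl (ord1 j) mxE eqxx mulr1n. Qed.

Lemma row_mx_ord0 m (t : R) (y : 'rV[R]_m) :
  (row_mx (t%:M : 'rV_1) y : 'rV_m.+1) ord0 ord0 = t.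
Proof.
by rewrite -[RHS](row_mx_head t y ord0); congr (row_mx _ _ _ _); apply: val_inj.
Qed.

Lemma row_mx_measurable m :
  measurable_fun [set: RM * borel 'rV[R]_m]
    (fun p : RM * borel 'rV[R]_m => row_mx p.1%:M p.2 : borel 'rV[R]_m.+1).
Proof.
apply: (@measurable_fun_rV _ _ m.+1) => i.
case: (@split_ordP 1 m i) => j ->.
  under eq_fun do rewrite row_mx_head.
  exact: (measurable_fst : measurable_fun setT (fst : RM * borel 'rV[R]_m -> RM)).
under eq_fun do rewrite (row_mxEr (_ : 'rV_1) (_ : 'rV_m)).
by apply: (measurableT_comp (coord_measurable j)); exact: measurable_snd.
Qed.

Lemma row_mx_section_measurable m (t : R) :
  measurable_fun [set: borel 'rV[R]_m]
    (fun y : borel 'rV[R]_m => row_mx (t%:M : 'rV_1) y : borel 'rV[R]_m.+1).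
Proof.
exact: (measurableT_comp (@row_mx_measurable m) (@pair1_measurable _ _ RM (borel 'rV[R]_m) t)).
Qed.

Lemma split_row_measurable m :
  measurable_fun [set: borel 'rV[R]_m.+1]
    (fun x : borel 'rV[R]_m.+1 =>
      (x ord0 ord0, rsubmx (x : 'rV_(1 + m))) : RM * borel 'rV[R]_m).
Proof.
apply: measurable_fun_pair => /=; first exact: (@coord_measurable m.+1 ord0).
apply: measurable_fun_rV => i; under eq_fun do rewrite mxE.
exact: coord_measurable.
Qed.

Lemma row_mx_split m (x : 'rV[R]_m.+1) :
  row_mx (x ord0 ord0)%:M (rsubmx (x : 'rV_(1 + m))) = x :> 'rV_(1 + m).
Proof.
rewrite -[RHS](@hsubmxK _ 1 1 m); congr row_mx; apply/rowP => i.
by rewrite !ord1 !mxE eqxx mulr1n; congr (x _ _); apply: val_inj.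
Qed.

Lemma row_mx_addS m (t : R) (y : 'rV[R]_m) (b : 'rV[R]_m.+1) :
  (row_mx (t%:M : 'rV_1) y : 'rV_m.+1) + b =
  row_mx ((t + b ord0 ord0)%:M : 'rV_1) (y + rsubmx (b : 'rV_(1 + m))).
Proof.
by rewrite -[in LHS](row_mx_split b) (@add_row_mx _ 1 1 m) -(raddfD (@scalar_mx R 1)).
Qed.

Lemma ge0_integral_preserved d d' (X : measurableType d) (Y : measurableType d')
    (mu : {measure set X -> \bar R}) (nu : {measure set Y -> \bar R})
    (phi : X -> Y) (f : Y -> \bar R) :
  measurable_fun setT phi ->
  (forall A, measurable A -> mu (phi @^-1` A) = nu A) ->
  measurable_fun setT f -> (forall y, 0 <= f y)%E ->
  (\int[mu]_x f (phi x) = \int[nu]_y f y)%E.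
Proof.
move=> mphi muphi mf f0.
transitivity (\int[pushforward mu phi]_y f y)%E.
  by rewrite ge0_integral_pushforward// preimage_setT.
by apply: eq_measure_integral => //= A mA _; exact: muphi.
Qed.


(** The existential hides the structure of the image measure and keeps only its values, so that
    later proofs rewrite with one equation. *)
Lemma pushforward_measureE d d' (X : measurableType d) (Y : measurableType d')
    (mu : {measure set X -> \bar R}) (phi : X -> Y) :
  measurable_fun setT phi ->
  exists nu : {measure set Y -> \bar R},
    forall A, nu A = mu (phi @^-1` A).
Proof.
move=> mphi.
by exists (measure_function_pushforward__canonical__measure_function_Measure mu mphi).
Qed.

(** An alias of [mu] that carries a proof of sigma-finiteness, so that Tonelli applies to a measure
    whose sigma-finiteness is itself a proved statement. *)
Definition sigma_finite_copy d (X : measurableType d)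
  (mu : {measure set X -> \bar R}) of sigma_finite setT mu : set X -> \bar R := mu.

HB.instance Definition _ d X mu sf :=
  Measure.on (@sigma_finite_copy d X mu sf).
HB.instance Definition _ d X mu sf :=
  Measure_isSigmaFinite.Build _ _ _ (@sigma_finite_copy d X mu sf) sf.

(** [lebesgue_rV] is only a set function. On Borel sets it agrees with the image of a product
    measure under [row_mx], and countable additivity comes from there. *)
Lemma lebesgue_rV_measure n :
  exists m : {sigma_finite_measure set (borel 'rV[R]_n) -> \bar R},
    forall A, measurable A -> m A = lebesgue_rV A.
Proof.
elim: n => [|n [m mE]].
  by exists (@dirac _ (borel 'rV[R]_0) 0 R).
have [M ME] := pushforward_measureE (@lebesgue_measure R \x m)%E (@row_mx_measurable n).
have sf : sigma_finite setT M.
  have /sigma_finiteP[F [TF ndF Foo]] := sigma_finiteT (@lebesgue_measure R).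
  have /sigma_finiteP[G [TG ndG Goo]] := sigma_finiteT m.
  pose g (x : borel 'rV[R]_n.+1) :=
    (x ord0 ord0, rsubmx (x : 'rV_(1 + n))) : RM * borel 'rV[R]_n.
  exists (fun k => g @^-1` (F k `*` G k)).
    rewrite -preimage_bigcup; apply/seteqP; split => // x _ /=.
    have [k _ Fk] : (\bigcup_i F i) (g x).1 by rewrite -TF.
    have [l _ Gl] : (\bigcup_i G i) (g x).2 by rewrite -TG.
    (* Both exhaustions are nondecreasing, so the larger index serves both coordinates. *)
    exists (maxn k l) => //; split.
      by move: Fk; exact/subsetPset/ndF/leq_maxl.
    by move: Gl; exact/subsetPset/ndG/leq_maxr.
  move=> k; have [mF Fk] := Foo k; have [mG Gk] := Goo k; split.
    rewrite -[X in measurable X]setTI; apply: split_row_measurable => //.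
    exact: measurableX.
  rewrite ME; have -> : (fun p : RM * borel 'rV[R]_n =>
      row_mx p.1%:M p.2 : borel 'rV[R]_n.+1) @^-1` (g @^-1` (F k `*` G k)) = F k `*` G k.
    apply/seteqP; split => -[t y]; by rewrite /g /= row_mxKr row_mx_ord0.
  suff : (lebesgue_measure (F k) * m (G k) < +oo)%E.
    by rewrite -(product_measure1E _ _ mF mG).
  by rewrite lte_mul_pinfty// ge0_fin_numE.
exists (sigma_finite_copy sf) => A mA.
rewrite /sigma_finite_copy ME /product_measure1 /=; apply: eq_integral => t _ /=.
have -> : xsection ((fun p : RM * borel 'rV[R]_n => row_mx p.1%:M p.2 : borel 'rV[R]_n.+1) @^-1` A) t =
    [set y | A (row_mx (t%:M : 'rV_1) y)].
  by apply/seteqP; split => y; rewrite /xsection /= inE.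
apply: mE; rewrite -[X in measurable X]setTI.
exact: (measurableT_comp (@row_mx_measurable n) (pair1_measurable t)).
Qed.

Definition leb n : {sigma_finite_measure set (borel 'rV[R]_n) -> \bar R} :=
  projT1 (cid (lebesgue_rV_measure n)).

Lemma lebE n A : measurable A -> leb n A = lebesgue_rV A.
Proof. exact: (projT2 (cid (lebesgue_rV_measure n))). Qed.

Lemma lebSE n (A : set (borel 'rV[R]_n.+1)) : measurable A ->
  leb n.+1 A = (@lebesgue_measure R \x leb n)%E
    ((fun p : RM * borel 'rV[R]_n => row_mx p.1%:M p.2 : borel 'rV[R]_n.+1) @^-1` A).
Proof.
move=> mA; rewrite lebE// /product_measure1 /=; apply: eq_integral => t _ /=.
have -> : xsection ((fun p : RM * borel 'rV[R]_n => row_mx p.1%:M p.2 : borel 'rV[R]_n.+1) @^-1` A) t =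
    [set y | A (row_mx (t%:M : 'rV_1) y)].
  by apply/seteqP; split => y; rewrite /xsection /= inE.
apply/esym/lebE; rewrite -[X in measurable X]setTI.
exact: (measurableT_comp (@row_mx_measurable n) (pair1_measurable t)).
Qed.

Lemma ge0_integral_lebS n (f : borel 'rV[R]_n.+1 -> \bar R) :
  measurable_fun setT f -> (forall x, 0 <= f x)%E ->
  (\int[leb n.+1]_x f x =
   \int[lebesgue_measure]_t \int[leb n]_y f (row_mx (t%:M : 'rV_1) y))%E.
Proof.
move=> mf f0.
rewrite -(@ge0_integral_preserved _ _ _ _ (@lebesgue_measure R \x leb n)%E _ _ f (@row_mx_measurable n) (fun A mA => esym (@lebSE n A mA)))//.
rewrite fubini_tonelli1//.
exact: measurableT_comp mf (@row_mx_measurable n).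
Qed.

Lemma measurable_fun_leb_section n (f : borel 'rV[R]_n.+1 -> \bar R) :
  measurable_fun setT f -> (forall x, 0 <= f x)%E ->
  measurable_fun setT (fun t : RM => \int[leb n]_y f (row_mx (t%:M : 'rV_1) y))%E.
Proof.
move=> mf f0; apply: (@measurable_fun_fubini_tonelli_F _ _ RM (borel 'rV[R]_n) R (leb n)
  (fun p => f (row_mx p.1%:M p.2))) => //=.
exact: measurableT_comp mf (@row_mx_measurable n).
Qed.

Lemma lebesgue_measure_shift (a : R) (A : set RM) : measurable A ->
  lebesgue_measure ((fun t : RM => t + a : RM) @^-1` A) = lebesgue_measure A.
Proof.
move=> mA; have ma : measurable_fun setT (fun t : RM => t + a : RM).
  exact: (measurable_funD (@measurable_id _ RM setT) (measurable_cst a)).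
have [nu nuE] := pushforward_measureE (@lebesgue_measure R) ma.
rewrite -nuE; apply/esym/lebesgue_measure_unique => //= _ [[x y]] _ <-.
rewrite nuE (_ : _ @^-1` _ = `]x - a, y - a]%classic :> set R); last first.
  by apply/seteqP; split => t /=; rewrite !in_itv/= => /andP[? ?]; apply/andP; split; lra.
rewrite [LHS]lebesgue_measure_itv [RHS]lebesgue_measure_itv /= !lte_fin ltrD2r.
by case: ifP => // _; rewrite -!EFinB; congr EFin; ring.
Qed.

(** Multiplying the image measure by c restores the length of every half-open interval, and these
    lengths determine Lebesgue measure. *)
Lemma lebesgue_measure_scale (c : R) (A : set RM) : 0 < c -> measurable A ->
  (c%:E * lebesgue_measure ((fun t : RM => c * t : RM)%R @^-1` A))%E = lebesgue_measure A.
Proof.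
move=> c0 mA; have ma : measurable_fun setT (fun t : RM => c * t : RM).
  exact: (measurable_funM (measurable_cst c) (@measurable_id _ RM setT)).
have [nu nuE] := pushforward_measureE (@lebesgue_measure R) ma.
pose m := mscale (NngNum (ltW c0)) nu.
rewrite -nuE -[LHS]/(m A); apply/esym/lebesgue_measure_unique => //= _ [[x y]] _ <-.
rewrite /m /mscale /= nuE (_ : _ @^-1` _ = `]x / c, y / c]%classic :> set R); last first.
  by apply/seteqP; split => t /=; rewrite !in_itv/= ltr_pdivrMr// ler_pdivlMr// ![_ * c]mulrC.
rewrite [LHS]lebesgue_measure_itv [X in (_ * X)%E]lebesgue_measure_itv /= !lte_fin ltr_pM2r ?invr_gt0//.
case: ifP => _; last by rewrite mule0.
by rewrite -!EFinB -EFinM; congr EFin; field; lra.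
Qed.

Lemma ge0_integral_shift (a : R) (f : RM -> \bar R) :
  measurable_fun setT f -> (forall x, 0 <= f x)%E ->
  (\int[lebesgue_measure]_t f (t + a)%R = \int[lebesgue_measure]_t f t)%E.
Proof.
move=> mf f0; apply: (ge0_integral_preserved (phi := fun t : RM => t + a : RM) _ _ mf f0).
  exact: (measurable_funD (@measurable_id _ RM setT) (measurable_cst a)).
exact: lebesgue_measure_shift.
Qed.

Lemma ge0_integral_opp (f : RM -> \bar R) :
  measurable_fun setT f -> (forall x, 0 <= f x)%E ->
  (\int[lebesgue_measure]_t f (- t)%R = \int[lebesgue_measure]_t f t)%E.
Proof.
move=> mf f0; apply: (ge0_integral_preserved (phi := fun t : RM => - t : RM) _ _ mf f0).
  exact: (measurable_funN (@measurable_id _ RM setT)).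
by move=> A mA; exact: lebesgue_measureN.
Qed.

Lemma ge0_integral_scale (c : R) (f : RM -> \bar R) : 0 < c ->
  measurable_fun setT f -> (forall x, 0 <= f x)%E ->
  (c%:E * \int[lebesgue_measure]_t f (c * t)%R = \int[lebesgue_measure]_t f t)%E.
Proof.
move=> c0 mf f0; have mc : measurable_fun setT (fun t : RM => c * t : RM).
  exact: (measurable_funM (measurable_cst c) (@measurable_id _ RM setT)).
rewrite -(@ge0_integral_mscale _ _ _ _ _ measurableT (NngNum (ltW c0)))//.
  apply: (ge0_integral_preserved (phi := fun t : RM => c * t : RM) mc _ mf f0).
  by move=> A mA; apply: lebesgue_measure_scale.
exact: measurableT_comp mf mc.
Qed.

Lemma ge0_integral_leb_shift n (b : 'rV[R]_n) (f : borel 'rV[R]_n -> \bar R) :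
  measurable_fun setT f -> (forall x, 0 <= f x)%E ->
  (\int[leb n]_x f ((x : 'rV[R]_n) + b)%R = \int[leb n]_x f x)%E.
Proof.
elim: n => [|n IH] in b f * => mf f0.
  by apply: eq_integral => x _; congr f; apply/rowP; case.
have mfb : measurable_fun setT (fun x : borel 'rV[R]_n.+1 => f ((x : 'rV[R]_n.+1) + b)%R).
  apply: measurableT_comp mf _; apply: continuous_borel => x.
  by apply: continuousD => //; exact: cst_continuous.
rewrite (ge0_integral_lebS mfb (fun x => f0 _)) (ge0_integral_lebS mf f0).
rewrite -[RHS](ge0_integral_shift (b ord0 ord0)); last 2 first.
- exact: measurable_fun_leb_section.
- by move=> t; apply: integral_ge0 => y _; exact: f0.
apply: eq_integral => t _.
rewrite -(IH (rsubmx (b : 'rV_(1 + n))) _ (measurableT_comp mf (row_mx_section_measurable _)) (fun y => f0 _)).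
by apply: eq_integral => y _; rewrite row_mx_addS.
Qed.

Lemma ge0_integral_leb_scale n (c : R) (f : borel 'rV[R]_n -> \bar R) : 0 < c ->
  measurable_fun setT f -> (forall x, 0 <= f x)%E ->
  ((c ^+ n)%:E * \int[leb n]_x f (c *: (x : 'rV[R]_n))%R = \int[leb n]_x f x)%E.
Proof.
move=> c0; elim: n => [|n IH] in f * => mf f0.
  by rewrite expr0 mul1e; apply: eq_integral => x _; congr f; apply/rowP; case.
have mfb : measurable_fun setT (fun x : borel 'rV[R]_n.+1 => f (c *: (x : 'rV[R]_n.+1))%R).
  apply: measurableT_comp mf _; apply: continuous_borel => x.
  exact: scaler_continuous.
rewrite (ge0_integral_lebS mfb (fun x => f0 _)) (ge0_integral_lebS mf f0).
rewrite -[RHS](ge0_integral_scale c0); last 2 first.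
- exact: measurable_fun_leb_section.
- by move=> t; apply: integral_ge0 => y _; exact: f0.
rewrite exprS EFinM -muleA; congr (_ * _)%E.
rewrite -ge0_integralZl; last 4 first.
- exact: measurableT.
- exact: (measurable_fun_leb_section mfb (fun x => f0 _)).
- by move=> t _; apply: integral_ge0 => y _; exact: f0.
- by rewrite lee_fin exprn_ge0// ltW.
apply: eq_integral => t _.
rewrite -(IH _ (measurableT_comp mf (row_mx_section_measurable _)) (fun y => f0 _)).
congr (_ * _)%E; apply: eq_integral => y _; congr f.
by rewrite (@scale_row_mx _ 1 1 n) scale_scalar_mx.
Qed.

Lemma ge0_integral_leb_opp n (f : borel 'rV[R]_n -> \bar R) :
  measurable_fun setT f -> (forall x, 0 <= f x)%E ->
  (\int[leb n]_x f (- (x : 'rV[R]_n))%R = \int[leb n]_x f x)%E.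
Proof.
elim: n => [|n IH] in f * => mf f0.
  by apply: eq_integral => x _; congr f; apply/rowP; case.
have mfb : measurable_fun setT (fun x : borel 'rV[R]_n.+1 => f (- (x : 'rV[R]_n.+1))%R).
  apply: measurableT_comp mf _; apply: continuous_borel => x.
  exact: opp_continuous.
rewrite (ge0_integral_lebS mfb (fun x => f0 _)) (ge0_integral_lebS mf f0).
rewrite -[RHS]ge0_integral_opp; last 2 first.
- exact: measurable_fun_leb_section.
- by move=> t; apply: integral_ge0 => y _; exact: f0.
apply: eq_integral => t _.
rewrite -(IH _ (measurableT_comp mf (row_mx_section_measurable _)) (fun y => f0 _)).
by apply: eq_integral => y _; congr f; rewrite (@opp_row_mx _ 1 1 n) -(raddfN (@scalar_mx R 1)).
Qed.

Lemma row_mx_forall n (P : R -> Prop) (t : R) (y : 'rV[R]_n) :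
  (forall i, P ((row_mx (t%:M : 'rV_1) y : 'rV_n.+1) ord0 i)) <->
  P t /\ forall j, P (y ord0 j).
Proof.
split=> [Pty|[Pt Py] i].
  split; first by have := Pty ord0; rewrite row_mx_ord0.
  by move=> j; have := Pty (rshift 1 j); rewrite (@row_mxEr _ 1 1 n).
by case: (@split_ordP 1 n i) => j ->; rewrite ?row_mx_head ?(@row_mxEr _ 1 1 n).
Qed.

Lemma box_measurable n (r : R) :
  measurable [set x : borel 'rV[R]_n | forall i, `|x ord0 i| <= r].
Proof.
have -> : [set x : borel 'rV[R]_n | forall i, `|x ord0 i| <= r] =
    \bigcap_(i in [set: 'I_n]) [set x | `|x ord0 i| <= r].
  by apply/seteqP; split => x /= xr; [move=> i _; exact: xr|move=> i; exact: xr].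
apply: fin_bigcap_measurable => // i _.
rewrite -[X in measurable X]setTI; apply: measurable_fun_ler => //.
by apply: measurableT_comp (@normr_measurable _ _) _; exact: coord_measurable.
Qed.

(** Cubes bracket the unit ball: r = 1 shows that [kappa] is finite, r = 1/(n + 1) that it is
    positive. *)
Lemma leb_box n (r : R) : 0 <= r ->
  leb n [set x | forall i, `|x ord0 i| <= r] = ((r *+ 2) ^+ n)%:E.
Proof.
move=> r0; elim: n => [|n IH].
  rewrite lebE; last exact: box_measurable.
  by rewrite expr0 /lebesgue_rV indicE mem_set //=; case.
pose B m : set (borel 'rV[R]_m) := [set x | forall i, `|x ord0 i| <= r].
have mB m : measurable_fun setT (fun x => (\1_(B m) x)%:E : \bar R).
  by apply/measurable_EFinP; apply: measurable_indic; exact: box_measurable.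
have E m : leb m (B m) = (\int[leb m]_x (\1_(B m) x)%:E)%E.
  by rewrite integral_indic ?setIT//; exact: box_measurable.
rewrite -/(B n.+1) E ge0_integral_lebS; [|exact: mB|by move=> x; rewrite lee_fin].
transitivity (\int[lebesgue_measure]_t ((\1_`[- r, r] t)%:E * ((r *+ 2) ^+ n)%:E) : \bar R)%E.
  apply: eq_integral => t _; rewrite -IH -/(B n) E.
  rewrite -ge0_integralZl; [|exact: measurableT|exact: mB|by []|by rewrite lee_fin].
  apply: eq_integral => y _; rewrite -EFinM !indicE; congr (_%:E).
  rewrite -natrM mulnb; congr (_%:R); congr nat_of_bool.
  apply/idP/andP; rewrite !inE /=.
    by move=> /(row_mx_forall (fun a => `|a| <= r)); rewrite in_itv/= -ler_norml.
  by rewrite in_itv/= -ler_norml => tyr; apply/(row_mx_forall (fun a => `|a| <= r)).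
rewrite ge0_integralZr//; last by rewrite lee_fin exprn_ge0// mulrn_wge0.
  rewrite integral_indic// setIT [X in (X * _)%E]lebesgue_measure_itv /= lte_fin exprS EFinM.
  case: ltP => [_|rr]; first by rewrite -EFinB opprK mulr2n.
  have -> : r = 0 by lra.
  by rewrite mul0rn.
by apply/measurable_EFinP; apply: measurable_indic.
Qed.

Lemma dotp_continuous (T : topologicalType) n (f g : T -> 'rV[R]_n) (x : T) :
  {for x, continuous f} -> {for x, continuous g} ->
  {for x, continuous (fun t => dotp (f t) (g t))}.
Proof.
move=> cf cg; apply: cvg_big => [|i _]; first exact: add_continuous.
have H (h : T -> 'rV[R]_n) : {for x, continuous h} ->
    {for x, continuous ((fun y : 'rV[R]_n => y ord0 i) \o h)}.
  by move=> ch; apply: continuous_comp => //; exact: coord_continuous.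
by apply: cvgM; [exact: (H f)|exact: (H g)].
Qed.

Lemma dotpxx_continuous n : continuous (fun x : 'rV[R]_n => dotp x x).
Proof. by move=> x; apply: dotp_continuous; exact: cvg_id. Qed.

Lemma dotpl_continuous n (u : 'rV[R]_n) : continuous (fun x : 'rV[R]_n => dotp x u).
Proof.
by move=> x; apply: dotp_continuous; [exact: cvg_id|exact: cst_continuous].
Qed.

Lemma row_mx_dotp n (s t : R) (x y : 'rV[R]_n) :
  dotp (row_mx (s%:M : 'rV_1) x : 'rV_n.+1) (row_mx (t%:M : 'rV_1) y) =
  s * t + dotp x y.
Proof.
rewrite /dotp (@big_split_ord _ _ _ 1 n) big_ord1 /= !row_mx_head.
by under [X in _ + X = _]eq_bigr do rewrite !(@row_mxEr _ 1 1 n).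
Qed.

(** The integrand is a product over the coordinates. The same integral computed over balls in
    [kappa_EGamma] links [kappa] to the Gamma function. *)
Lemma gauss_leb n :
  (\int[leb n]_x (expR (- dotp (x : 'rV[R]_n) x))%:E = (Num.sqrt pi ^+ n)%:E)%E.
Proof.
have mg m : measurable_fun [set: borel 'rV[R]_m]
    (fun x : borel 'rV[R]_m => (expR (- dotp (x : 'rV[R]_m) x))%:E).
  apply/measurable_EFinP; apply: measurableT_comp (@measurable_expR R) _.
  by apply: continuous_borelR => x; exact: (@cvgN R R^o _ _ _ _ _ (@dotpxx_continuous m x)).
elim: n => [|n IH].
  under eq_integral do rewrite /dotp big_ord0 oppr0 expR0.
  rewrite integral_cst//= mul1e expr0 lebE// /lebesgue_rV indicE.
  by rewrite in_setT.
rewrite ge0_integral_lebS; [|exact: mg|by move=> x; rewrite lee_fin expR_ge0].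
transitivity (\int[lebesgue_measure]_t ((gauss_fun t)%:E * (Num.sqrt pi ^+ n)%:E) : \bar R)%E.
  apply: eq_integral => t _; rewrite -IH.
  rewrite -ge0_integralZl; [|exact: measurableT|exact: mg| |].
  - apply: eq_integral => y _; rewrite -EFinM; congr (_%:E).
    by rewrite /gauss_fun row_mx_dotp opprD expRD expr2.
  - by move=> x _; rewrite lee_fin expR_ge0.
  - by rewrite lee_fin gauss_fun_ge0.
rewrite ge0_integralZr//.
- by rewrite integralT_gauss exprS EFinM.
- by apply/measurable_EFinP; exact: measurable_gauss_fun.
- by move=> t _; rewrite lee_fin gauss_fun_ge0.
Qed.

End row_vectors.

(** * Inner product and volumes of balls *)

Section inner_product.
Context {R : realType} {n : nat}.
Implicit Types x y z : 'rV[R]_n.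

Lemma dotpC x y : dotp x y = dotp y x.
Proof. by apply: eq_bigr => i _; rewrite mulrC. Qed.

Lemma dotpDl x y z : dotp (x + y) z = dotp x z + dotp y z.
Proof. by rewrite -big_split; apply: eq_bigr => i _; rewrite mxE mulrDl. Qed.

Lemma dotpZl (a : R) x y : dotp (a *: x) y = a * dotp x y.
Proof. by rewrite mulr_sumr; apply: eq_bigr => i _; rewrite mxE mulrA. Qed.

Lemma dotpDr x y z : dotp x (y + z) = dotp x y + dotp x z.
Proof. by rewrite dotpC dotpDl !(dotpC x). Qed.

Lemma dotpZr (a : R) x y : dotp x (a *: y) = a * dotp x y.
Proof. by rewrite dotpC dotpZl dotpC. Qed.

Lemma dotpNl x y : dotp (- x) y = - dotp x y.
Proof. by rewrite -scaleN1r dotpZl mulN1r. Qed.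

Lemma dotpNr x y : dotp x (- y) = - dotp x y.
Proof. by rewrite dotpC dotpNl dotpC. Qed.

Lemma dotpBl x y z : dotp (x - y) z = dotp x z - dotp y z.
Proof. by rewrite dotpDl dotpNl. Qed.

Lemma dotpBr x y z : dotp x (y - z) = dotp x y - dotp x z.
Proof. by rewrite dotpDr dotpNr. Qed.

Lemma dotp0l x : dotp 0 x = 0.
Proof. by rewrite -(scale0r x) dotpZl mul0r. Qed.

Lemma dotp0r x : dotp x 0 = 0.
Proof. by rewrite dotpC dotp0l. Qed.

Lemma dotp_ge0 x : 0 <= dotp x x.
Proof. by apply: sumr_ge0 => i _; rewrite -expr2 sqr_ge0. Qed.

Lemma dotp_eq0 x : (dotp x x == 0) = (x == 0).
Proof.
apply/eqP/eqP => [xx0|->]; last exact: dotp0l.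
apply/rowP => i; rewrite mxE; apply/eqP.
rewrite -sqrf_eq0; apply/eqP/le_anti; rewrite sqr_ge0 andbT -xx0.
rewrite /dotp (bigD1 i)//= -expr2 lerDl.
by apply: sumr_ge0 => j _; rewrite -expr2 sqr_ge0.
Qed.

Lemma enorm_ge0 x : 0 <= enorm x.
Proof. exact: sqrtr_ge0. Qed.

Lemma sqr_enorm x : enorm x ^+ 2 = dotp x x.
Proof. by rewrite sqr_sqrtr// dotp_ge0. Qed.

Lemma enorm_eq0 x : (enorm x == 0) = (x == 0).
Proof. by rewrite -sqrf_eq0 sqr_enorm dotp_eq0. Qed.

Lemma enorm0 : enorm (0 : 'rV[R]_n) = 0.
Proof. by apply/eqP; rewrite enorm_eq0. Qed.

Lemma enormZ (a : R) x : enorm (a *: x) = `|a| * enorm x.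
Proof.
by rewrite /enorm dotpZl dotpZr mulrA -expr2 sqrtrM ?sqr_ge0// sqrtr_sqr.
Qed.

Lemma enormN x : enorm (- x) = enorm x.
Proof. by rewrite -scaleN1r enormZ normrN1 mul1r. Qed.

Lemma enormBC x y : enorm (x - y) = enorm (y - x).
Proof. by rewrite -enormN opprB. Qed.

Lemma enorm_le1 x : (enorm x <= 1) = (dotp x x <= 1).
Proof. by rewrite -sqr_enorm -[in RHS](expr1n _ 2) ler_sqr ?nnegrE ?enorm_ge0. Qed.

Lemma enorm1 x : (enorm x = 1) <-> (dotp x x = 1).
Proof.
split=> [x1|xx1]; first by rewrite -sqr_enorm x1 expr1n.
by rewrite /enorm xx1 sqrtr1.
Qed.

Lemma dotp_sqr_le x y : dotp x y ^+ 2 <= dotp x x * dotp y y.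
Proof.
have [->|y0] := eqVneq y 0; first by rewrite !dotp0r expr0n mulr0.
have yy : 0 < dotp y y by rewrite lt_def dotp_eq0 y0 dotp_ge0.
have := dotp_ge0 (dotp y y *: x - dotp x y *: y).
rewrite dotpBl !dotpBr !dotpZl !dotpZr (dotpC y x).
set a := dotp x x; set b := dotp x y; set c := dotp y y => H.
have {}H : 0 <= c * (a * c - b ^+ 2) by move: H; congr (_ <= _); ring.
by move: H; rewrite pmulr_rge0// subr_ge0.
Qed.

Lemma dotp_le x y : `|dotp x y| <= enorm x * enorm y.
Proof.
rewrite -sqrtrM ?dotp_ge0// -sqrtr_sqr ler_sqrt ?dotp_sqr_le//.
by rewrite mulr_ge0 ?dotp_ge0.
Qed.

Lemma enormD x y : enorm (x + y) <= enorm x + enorm y.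
Proof.
rewrite -ler_sqr ?nnegrE ?enorm_ge0 ?addr_ge0 ?enorm_ge0//.
rewrite sqr_enorm dotpDl !dotpDr (dotpC y x) sqrrD !sqr_enorm.
have := ler_norm (dotp x y); have := dotp_le x y.
set a := dotp x y; set b := enorm x * enorm y; rewrite mulr2n => *; lra.
Qed.

Lemma coord_le_enorm x i : `|x ord0 i| <= enorm x.
Proof.
rewrite -sqrtr_sqr ler_sqrt ?dotp_ge0// /dotp (bigD1 i)//= -expr2 lerDl.
by apply: sumr_ge0 => j _; rewrite -expr2 sqr_ge0.
Qed.

Lemma enorm_continuous : continuous (fun x : 'rV[R]_n => enorm x).
Proof.
move=> x; apply: (continuous_comp (f := fun x : 'rV[R]_n => dotp x x) (g := Num.sqrt)).
  exact: dotpxx_continuous.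
exact: sqrt_continuous.
Qed.

Lemma dotp_mulmx (A : 'M[R]_n) x y : A *m A^T = 1%:M ->
  dotp (x *m A) (y *m A) = dotp x y.
Proof.
have dE u v : dotp u v = (u *m v^T) ord0 ord0.
  by rewrite mxE; apply: eq_bigr => i _; rewrite !mxE.
by move=> AA; rewrite !dE trmx_mul mulmxA -(mulmxA x) AA mulmx1.
Qed.

Lemma dotp_delta x k : dotp x (delta_mx ord0 k) = x ord0 k.
Proof.
rewrite /dotp (bigD1 k)//= !mxE !eqxx mulr1 big1 ?addr0// => j jk.
by rewrite !mxE (negPf jk) andbF mulr0.
Qed.

Lemma closed_unit_ball : closed (@unit_ball R n).
Proof.
rewrite (_ : unit_ball n = (fun x : 'rV[R]_n => enorm x) @^-1` `]-oo, 1]%classic).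
  by apply: preimage_closed; [by move=> x _; exact: enorm_continuous|exact: closed_le].
by apply/seteqP; split => x; rewrite /= in_itv.
Qed.

Lemma unit_ball_measurable : measurable (@unit_ball R n : set (borel 'rV[R]_n)).
Proof. exact: (@borel_closed 'rV[R]_n _ closed_unit_ball). Qed.

End inner_product.

(** * The fundamental theorem of calculus on an open interval *)

Section improper_ftc.
Context {R : realType}.
Local Notation mu := (@lebesgue_measure R).

(** Nothing is assumed of f at the endpoints, as needed for r^(a - 1) at 0 and for the slope of a
    distance where the distance vanishes. Monotone convergence over closed subintervals reduces this
    to the usual theorem, and only the one-sided limits of F enter. *)
Lemma ge0_FTC_oo (f F : R -> R) (a b la lb : R) : a < b ->
  (forall x, a < x < b -> 0 <= f x) ->
  (forall x, a < x < b -> {for x, continuous f}) ->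
  (forall x, a < x < b -> is_derive x 1 F (f x)) ->
  F x @[x --> a^'+] --> la -> F x @[x --> b^'-] --> lb ->
  (\int[mu]_(x in `]a, b[) (f x)%:E = (lb - la)%:E)%E.
Proof.
move=> ab f0 cf dF Fa Fb.
(* The divisor starts at 3 so that 2 e(k) < b - a and every closed subinterval is nondegenerate. *)
pose e (k : nat) : R := (b - a) / k.+3%:R.
have e0 k : 0 < e k by rewrite divr_gt0// subr_gt0.
have e2 k : e k * 2 < b - a.
  rewrite /e -mulrA gtr_pMr ?subr_gt0// mulrC ltr_pdivrMr// mul1r ltr_nat.
  by [].
pose E k : set R := `[a + e k, b - e k]%classic.
have eS k l : (k <= l)%N -> e l <= e k.
  by move=> kl; rewrite ler_pM2l ?subr_gt0// lef_pV2 ?posrE// ler_nat !ltnS.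
have ecvg : e k @[k --> \oo] --> 0.
  rewrite -(mulr0 (b - a)); apply: cvgMr.
  have := @cvg_harmonic R; rewrite -(cvg_shiftn 2).
  by apply: cvg_trans; apply: near_eq_cvg; near=> k; rewrite /harmonic /= addn2.
have Eint k : (\int[mu]_(x in E k) (f x)%:E = (F (b - e k) - F (a + e k))%:E)%E.
  have ak : a + e k < b - e k by have := e2 k; lra.
  rewrite (@continuous_FTC2 _ f F)//.
  - apply: continuous_in_subspaceT => x /set_mem; rewrite /= in_itv/= => /andP[? ?].
    by apply: cf; have ek := e0 k; apply/andP; split; lra.
  - have dc x : a < x < b -> {for x, continuous F}.
      move=> /dF xF; apply/differentiable_continuous/derivable1_diffP.
      exact: ex_derive.
    split.
    + move=> x; rewrite in_itv/= => /andP[? ?]; apply: (@ex_derive _ _ _ _ _ _ _ (dF _ _)).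
      by have ek := e0 k; apply/andP; split; lra.
    + by apply: cvg_at_right_filter; apply: dc; have ek := e0 k; apply/andP; split; lra.
    + by apply: cvg_at_left_filter; apply: dc; have ek := e0 k; apply/andP; split; lra.
  - move=> x; rewrite in_itv/= => /andP[? ?]; rewrite derive1E.
    apply: (@derive_val _ _ _ _ _ _ _ (dF _ _)).
    by have ek := e0 k; apply/andP; split; lra.
have UE : \bigcup_k E k = `]a, b[%classic.
  apply/seteqP; split => x /=.
    move=> [k _]; rewrite /E /= !in_itv/= => /andP[? ?].
    by have ek := e0 k; apply/andP; split; lra.
  rewrite in_itv/= => /andP[ax xb].
  have m0 : 0 < Num.min (x - a) (b - x) by rewrite lt_min !subr_gt0 ax.
  move/cvgrPdist_lt : ecvg => /(_ _ m0)[N _ /(_ N (leqnn N))].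
  rewrite sub0r normrN gtr0_norm// lt_min => /andP[? ?].
  by exists N => //; rewrite /E /= in_itv/=; apply/andP; split; lra.
have mf : measurable_fun (`]a, b[%classic : set (measurableTypeR R)) (EFin \o f).
  apply/measurable_EFinP; apply: open_continuous_measurable_fun; first exact: interval_open.
  by move=> x /set_mem /= xab; apply: cf; move: xab; rewrite in_itv.
have Icvg : (\int[mu]_(x in E k) (f x)%:E @[k --> \oo] -->
    \int[mu]_(x in `]a, b[) (f x)%:E)%E.
  rewrite -UE; apply: ge0_nondecreasing_set_cvg_integral.
  - move=> k l kl; apply/subsetPset => x; rewrite /E /= !in_itv/= => /andP[? ?].
    by have ekl := eS _ _ kl; apply/andP; split; lra.
  - by move=> k; exact: measurable_itv.
  - move=> k; apply: measurable_funS mf; first exact: measurable_itv.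
    by rewrite -UE; exact: bigcup_sup.
  - move=> k x Ex; rewrite lee_fin f0//.
    have : (\bigcup_k E k) x by exists k.
    by rewrite UE /= in_itv.
move: Icvg; under eq_fun do rewrite Eint.
move=> /(cvg_lim (@ereal_hausdorff R)) <-; apply/(cvg_lim (@ereal_hausdorff R)).
apply: cvg_EFin; first by near=> k.
apply: cvgB.
  apply: (cvg_at_leftP _ _ _).1 Fb _ _; split; first by move=> k; rewrite ltrBlDr ltrDl.
  by rewrite -[X in _ --> X]subr0; apply: cvgB => //; exact: cvg_cst.
apply: (cvg_at_rightP _ _ _).1 Fa _ _; split; first by move=> k; rewrite ltrDl.
by rewrite -[X in _ --> X]addr0; apply: cvgD => //; exact: cvg_cst.
Unshelve. all: by end_near. Qed.

End improper_ftc.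

Lemma in_set_itv (R : realType) (i : interval R) (x : R) :
  (x \in [set` i]%classic) = (x \in i).
Proof. by apply/idP/idP => [/set_mem|/mem_set]. Qed.

(** * Volumes of balls, the Gamma function and the constants omega *)

Section constants.
Context {R : realType}.
Local Notation RM := (measurableTypeR R).
Local Notation mu := (@lebesgue_measure R).

Lemma integral_indicT d (T : measurableType d) (m : {measure set T -> \bar R})
    (A : set T) : measurable A -> (\int[m]_x (\1_A x)%:E)%E = m A.
Proof. by move=> mA; rewrite integral_indic// setIT. Qed.

Lemma measurable_EFin_indic d (T : measurableType d) (A : set T) :
  measurable A -> measurable_fun setT (fun x => (\1_A x)%:E : \bar R).
Proof. by move=> mA; apply/measurable_EFinP; exact: measurable_indic. Qed.

Lemma leb_scale n (c : R) (A : set (borel 'rV[R]_n)) : 0 < c -> measurable A ->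
  leb n A = ((c ^+ n)%:E * leb n [set x | A (c *: (x : 'rV[R]_n))])%E.
Proof.
move=> c0 mA.
have mc : measurable_fun setT (fun x : borel 'rV[R]_n => c *: (x : 'rV[R]_n) : borel 'rV[R]_n).
  by apply: (@continuous_borel 'rV[R]_n 'rV[R]_n); exact: scaler_continuous.
have mA' : measurable [set x : borel 'rV[R]_n | A (c *: (x : 'rV[R]_n))].
  by rewrite -[X in measurable X]setTI; exact: mc.
rewrite -(integral_indicT _ mA) -(integral_indicT _ mA'); apply/esym.
exact: (ge0_integral_leb_scale c0 (measurable_EFin_indic mA)).
Qed.

Lemma leb_shift n (b : 'rV[R]_n) (A : set (borel 'rV[R]_n)) : measurable A ->
  leb n [set x | A ((x : 'rV[R]_n) + b)] = leb n A.
Proof.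
move=> mA.
have mc : measurable_fun setT (fun x : borel 'rV[R]_n => (x : 'rV[R]_n) + b : borel 'rV[R]_n).
  apply: (@continuous_borel 'rV[R]_n 'rV[R]_n) => x.
  by apply: continuousD => //; exact: cst_continuous.
have mA' : measurable [set x : borel 'rV[R]_n | A ((x : 'rV[R]_n) + b)].
  by rewrite -[X in measurable X]setTI; exact: mc.
rewrite -(integral_indicT _ mA) -(integral_indicT _ mA').
exact: (ge0_integral_leb_shift b (measurable_EFin_indic mA)).
Qed.

Lemma leb_opp n (A : set (borel 'rV[R]_n)) : measurable A ->
  leb n [set x | A (- (x : 'rV[R]_n))] = leb n A.
Proof.
move=> mA.
have mc : measurable_fun setT (fun x : borel 'rV[R]_n => - (x : 'rV[R]_n) : borel 'rV[R]_n).
  apply: (@continuous_borel 'rV[R]_n 'rV[R]_n) => x; exact: opp_continuous.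
have mA' : measurable [set x : borel 'rV[R]_n | A (- (x : 'rV[R]_n))].
  by rewrite -[X in measurable X]setTI; exact: mc.
rewrite -(integral_indicT _ mA) -(integral_indicT _ mA').
exact: (ge0_integral_leb_opp (measurable_EFin_indic mA)).
Qed.

Lemma leb_unit_ball n : leb n (unit_ball n : set (borel 'rV[R]_n)) = (kappa n)%:E.
Proof.
have mB := @unit_ball_measurable R n.
rewrite /kappa -lebE// fineK// ge0_fin_numE//.
apply: (@le_lt_trans _ _ (leb n [set x | forall i, `|x ord0 i| <= 1])).
  apply: le_measure; rewrite ?inE//; first exact: box_measurable.
  by move=> x xB i; exact: le_trans (coord_le_enorm _ _) xB.
by rewrite leb_box// ltry.
Qed.

Lemma kappa_gt0 n : 0 < kappa n :> R.
Proof.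
rewrite -lte_fin -leb_unit_ball.
apply: (@lt_le_trans _ _ (leb n [set x | forall i, `|x ord0 i| <= n.+1%:R^-1])).
  by rewrite leb_box ?invr_ge0// lte_fin exprn_gt0// pmulrn_lgt0// invr_gt0.
apply: le_measure; rewrite ?inE//; [exact: box_measurable|exact: unit_ball_measurable|].
move=> x /= xn; rewrite /unit_ball /= enorm_le1.
apply: (@le_trans _ _ (\sum_(i < n) n.+1%:R^-1)).
  apply: ler_sum => i _; rewrite -expr2 -real_normK ?num_real// expr2.
  rewrite -[leRHS]mulr1 ler_pM//; apply: (le_trans (xn i)).
  by rewrite invf_le1// ler1n.
by rewrite sumr_const card_ord -[leLHS]mulr_natl ler_pdivrMr// mul1r ler_nat.
Qed.

Lemma leb_ball n (r : R) : 0 < r ->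
  leb n [set x | enorm x <= r] = (r ^+ n * kappa n)%:E.
Proof.
move=> r0; rewrite (leb_scale r0) ?EFinM -?leb_unit_ball; last first.
  rewrite -[X in measurable X]setTI; apply: measurable_fun_ler => //.
  exact: (continuous_borelR (@enorm_continuous R n)).
congr (_ * leb n _)%E; apply/seteqP; split => x; rewrite /unit_ball /= enormZ gtr0_norm//.
  by rewrite ger_pMr.
by rewrite ger_pMr.
Qed.

Lemma kappa1 : kappa 1 = 2 :> R.
Proof.
apply: EFin_inj; rewrite -leb_unit_ball.
have -> : @unit_ball R 1 = [set x | forall i, `|x ord0 i| <= 1].
  by apply/seteqP; split => x; rewrite /unit_ball /= /enorm /dotp big_ord1 -expr2 sqrtr_sqr;
    [move=> H i; rewrite (ord1 i)|move=> /(_ ord0)].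
by rewrite leb_box// expr1.
Qed.

Lemma integral_expR_tail (a : R) :
  (\int[mu]_(t in `[a, +oo[) (expR (- t))%:E = (expR (- a))%:E)%E.
Proof.
have dE (x : R) : is_derive x 1 (fun t => - expR (- t)) (expR (- x)).
  have h : is_derive (- x) 1 (@expR R) (expR (- x)) := is_derive_expR _.
  have := is_deriveN (is_derive1_comp h (is_deriveN (is_derive_id x 1))).
  by rewrite mulrN1 opprK.
have cE : continuous (fun t : R => expR (- t)).
  move=> x; apply: (continuous_comp (f := -%R) (g := expR)); first exact: opp_continuous.
  exact: continuous_expR.
rewrite (@ge0_continuous_FTC2y _ (fun t => expR (- t)) (fun t => - expR (- t)) a 0).
- by rewrite EFinN oppeK add0e.
- by move=> x _; exact: expR_ge0.
- exact: continuous_subspaceT.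
- by rewrite -oppr0; apply: cvgN; exact: cvgr_expR.
- by move=> x _; apply: ex_derive.
- by apply: cvg_at_right_filter; apply: cvgN; exact: cE.
- by move=> x _; rewrite derive1E; apply: derive_val.
Qed.

Lemma powR_continuous_gt0 (b x : R) : 0 < x -> {for x, continuous (fun r => r `^ b)}.
Proof.
move=> x0; apply: differentiable_continuous; apply/derivable1_diffP.
by apply: derivable_powR; rewrite in_itv/= x0.
Qed.

Lemma integral_powR (a t : R) : 0 < a -> 0 < t ->
  (\int[mu]_(r in `]0%R, t[) (a * r `^ (a - 1))%:E = (t `^ a)%:E)%E.
Proof.
move=> a0 t0; rewrite -[in RHS](subr0 (t `^ a)).
apply: (@ge0_FTC_oo _ _ (fun r => r `^ a)) => //.
- by move=> x /andP[x0 _]; rewrite mulr_ge0 ?powR_ge0// ltW.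
- move=> x /andP[x0 _]; by apply: cvgM; [exact: cvg_cst|exact: powR_continuous_gt0].
- by move=> x /andP[x0 _]; apply: is_derive1_powR.
- exact: powR_cvg0.
- by apply: cvg_at_left_filter; exact: powR_continuous_gt0.
Qed.

Lemma integral_indicM d (T : measurableType d) (m : {measure set T -> \bar R})
    (D : set T) (f : T -> \bar R) :
  (\int[m]_(x in D) f x = \int[m]_x ((\1_D x)%:E * f x))%E.
Proof.
rewrite integral_mkcond; apply: eq_integral => x _; rewrite patchE indicE.
by case: ifP; rewrite ?mul1e ?mul0e.
Qed.

(** The Gamma integral in [\bar R]: Tonelli gives its identities before finiteness is known, and
    [EGamma_fin] then allows the passage to the real [Gamma]. *)
Definition EGamma (a : R) : \bar R :=
  (\int[mu]_(t in `]0%R, +oo[) (t `^ (a - 1) * expR (- t))%:E)%E.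

Lemma EGamma_ge0 a : (0 <= EGamma a)%E.
Proof.
by apply: integral_ge0 => t _; rewrite lee_fin mulr_ge0 ?powR_ge0 ?expR_ge0.
Qed.

Lemma measurable_expRN : measurable_fun setT (fun t : RM => expR (- t)).
Proof.
apply: measurableT_comp (@measurable_expR R) _.
exact: (measurable_funN (@measurable_id _ RM setT)).
Qed.

(** Tonelli replaces integration by parts: t^a is the integral of a r^(a - 1) over 0 < r <= t, and
    after the exchange the integral of e^(-t) over t >= r is e^(-r). *)
Lemma EGammaS (a : R) : 0 < a -> EGamma (a + 1) = (a%:E * EGamma a)%E.
Proof.
move=> a0.
pose F (p : RM * RM) : \bar R :=
  ((\1_(`]0, +oo[%classic : set R) p.1 * (a * p.1 `^ (a - 1)))%:E * (expR (- p.2))%:E *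
   ((p.1 <= p.2)%R)%:R%:E)%E.
have m1 : measurable_fun setT (fun p : RM * RM => p.1 : R) := measurable_fst.
have m2 : measurable_fun setT (fun p : RM * RM => p.2 : R) := measurable_snd.
have F0 p : (0 <= F p)%E.
  by rewrite /F -!EFinM lee_fin !mulr_ge0 ?powR_ge0 ?expR_ge0// ltW.
have mF : measurable_fun setT F.
  rewrite /F; under eq_fun do rewrite -!EFinM.
  apply/measurable_EFinP; apply: measurable_funM; [apply: measurable_funM|].
  - apply: measurable_funM.
      exact: (measurableT_comp (measurable_indic (measurable_itv _)) m1).
    apply: measurable_funM; first exact: measurable_cst.
    by apply: (measurableT_comp (f := fun r : R => r `^ (a - 1))) => //; exact: measurable_powR.
  - exact: (measurableT_comp measurable_expRN m2).
  - apply: (measurableT_comp (f := fun b : bool => b%:R : R)) => //.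
    exact: measurable_fun_ler.
have := @fubini_tonelli _ _ _ _ _ (@lebesgue_measure R) (@lebesgue_measure R) F mF F0.
have -> : (\int[mu]_r \int[mu]_t F (r, t) = a%:E * EGamma a)%E.
  rewrite /EGamma [X in (_ * X)%E]integral_indicM -ge0_integralZl//; last 3 first.
  - apply: emeasurable_funM; first exact: (@measurable_EFin_indic _ RM _ (measurable_itv _)).
    apply/measurable_EFinP; by apply: measurable_funM; [exact: measurable_powR|exact: measurable_expRN].
  - by move=> t _; rewrite -EFinM lee_fin !mulr_ge0 ?powR_ge0 ?expR_ge0.
  - by rewrite lee_fin ltW.
  apply: eq_integral => r _; rewrite /F /=.
  under eq_integral do rewrite -muleA.
  rewrite ge0_integralZl; last 4 first.
  - exact: measurableT.
  - apply: emeasurable_funM; apply/measurable_EFinP; first exact: measurable_expRN.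
    apply: (measurableT_comp (f := fun b : bool => b%:R : R)) => //.
    by apply: measurable_fun_ler => //; exact: (@measurable_id _ RM setT).
  - by move=> t _; rewrite -EFinM lee_fin !mulr_ge0 ?powR_ge0 ?expR_ge0.
  - by rewrite lee_fin !mulr_ge0 ?powR_ge0 ?expR_ge0// ltW.
  have -> : (\int[mu]_x ((expR (- x))%:E * ((r <= x)%R)%:R%:E) = (expR (- r))%:E)%E.
    rewrite -integral_expR_tail [RHS]integral_indicM; apply: eq_integral => t _.
    by rewrite muleC indicE in_set_itv in_itv/= andbT.
  by rewrite -!EFinM; congr EFin; ring.
move=> ->; rewrite /EGamma [LHS]integral_indicM; apply: eq_integral => t _; rewrite /F /=.
have [t0|t0] := ltP 0 t; last first.
  rewrite indicE memNset ?mul0e; last by rewrite /= in_itv/= andbT; apply/negP; rewrite -leNgt.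
  rewrite integral0_eq// => r _; rewrite indicE.
  have [rt|_] := leP r t; last by rewrite mule0.
  rewrite memNset ?mul0r ?mul0e// /= in_itv/= andbT; apply/negP; rewrite -leNgt.
  exact: le_trans t0.
rewrite addrK indicE mem_set ?mul1e; last by rewrite /= in_itv/= t0.
transitivity (\int[mu]_(r in `]0%R, t]) ((a * r `^ (a - 1))%:E * (expR (- t))%:E))%E.
  rewrite -integral_itv_bndo_bndc.
    rewrite ge0_integralZr ?integral_powR ?EFinM//.
    - apply: measurable_funTS; apply/measurable_EFinP; exact: measurable_funM.
    - by move=> r _; rewrite lee_fin mulr_ge0 ?powR_ge0 ?ltW.
  apply: measurable_funTS; under eq_fun do rewrite -EFinM.
  apply/measurable_EFinP; apply: measurable_funM => //.
  by apply: measurable_funM => //; exact: measurable_powR.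
rewrite [LHS]integral_indicM; apply: eq_integral => r _.
rewrite !indicE !in_set_itv !in_itv/= andbT -!EFinM; congr EFin.
by case: (0 < r); case: (r <= t); rewrite /=; ring.
Qed.

(** The Gaussian integral by layers: e^(-|x|^2) is the integral of e^(-t) over t >= |x|^2, and after
    the exchange the inner integral is the volume of the ball of radius sqrt t. *)
Lemma kappa_EGamma n :
  ((kappa n)%:E * EGamma (n%:R / 2 + 1) = (Num.sqrt pi ^+ n)%:E)%E.
Proof.
pose F (p : borel 'rV[R]_n * RM) : \bar R :=
  ((expR (- p.2))%:E * ((dotp (p.1 : 'rV[R]_n) p.1 <= p.2)%R)%:R%:E)%E.
have m1 : measurable_fun setT (fun p : borel 'rV[R]_n * RM => dotp (p.1 : 'rV[R]_n) p.1).
  exact: (measurableT_comp (continuous_borelR (@dotpxx_continuous R n)) measurable_fst).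
have m2 : measurable_fun setT (fun p : borel 'rV[R]_n * RM => p.2 : R) := measurable_snd.
have F0 p : (0 <= F p)%E by rewrite /F -!EFinM lee_fin !mulr_ge0 ?expR_ge0.
have mF : measurable_fun setT F.
  rewrite /F; under eq_fun do rewrite -!EFinM.
  apply/measurable_EFinP; apply: measurable_funM.
    exact: (measurableT_comp measurable_expRN m2).
  apply: (measurableT_comp (f := fun b : bool => b%:R : R)) => //.
  exact: measurable_fun_ler.
rewrite -gauss_leb.
transitivity (\int[leb n]_x \int[mu]_t F (x, t))%E; last first.
  apply: eq_integral => x _.
  rewrite -integral_expR_tail [RHS]integral_indicM; apply: eq_integral => t _.
  by rewrite /F muleC indicE in_set_itv in_itv/= andbT.
rewrite (@fubini_tonelli _ _ _ _ _ (leb n) (@lebesgue_measure R) F mF F0) /EGamma -ge0_integralZl//; last 3 first.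
- apply: measurable_funTS; apply/measurable_EFinP; by apply: measurable_funM; [exact: measurable_powR|exact: measurable_expRN].
- by move=> t _; rewrite lee_fin mulr_ge0 ?powR_ge0 ?expR_ge0.
- by rewrite lee_fin ltW// kappa_gt0.
have split0 (f : RM -> \bar R) : measurable_fun setT f -> (forall t, 0 <= f t)%E ->
    (forall t : R, (t < 0)%R -> f t = 0)%E ->
    (\int[mu]_t f t = \int[mu]_(t in `]0%R, +oo[) f t)%E.
  move=> mf f0 fN; rewrite -(setUv `]-oo, 0%R]%classic) ge0_integral_setU//=; last 3 first.
  - exact: measurableC.
  - by rewrite setUv.
  - exact/disj_setPCl.
  have -> : (\int[mu]_(t in `]-oo, 0%R]) f t = 0)%E.
    rewrite -integral_itv_bndo_bndc; last exact: measurable_funTS.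
    by rewrite integral0_eq// => t /=; rewrite in_itv/=; exact: fN.
  by rewrite setCitvl add0e.
rewrite [RHS]split0; last 3 first.
- exact: measurable_fun_fubini_tonelli_G.
- by move=> t; apply: integral_ge0.
- move=> t t0; rewrite integral0_eq// => x _; rewrite /F /=.
  by rewrite leNgt (lt_le_trans t0 (dotp_ge0 _)) mule0.
apply: eq_integral => t; rewrite in_set_itv in_itv/= andbT => t0.
rewrite /F /= ge0_integralZl; last 4 first.
- exact: measurableT.
- apply/measurable_EFinP; apply: (measurableT_comp (f := fun b : bool => b%:R : R)) => //.
  apply: measurable_fun_ler => //.
  exact: (continuous_borelR (@dotpxx_continuous R n)).
- by [].
- by rewrite lee_fin expR_ge0.
have -> : (\int[leb n]_x ((dotp (x : 'rV[R]_n) x <= t)%R)%:R%:E =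
    leb n [set x | (enorm (x : 'rV[R]_n) <= Num.sqrt t)%R])%E.
  rewrite -integral_indicT; last first.
    rewrite -[X in measurable X]setTI; apply: measurable_fun_ler => //.
    exact: (continuous_borelR (@enorm_continuous R n)).
  apply: eq_integral => x _; rewrite indicE; congr (_%:R%:E); congr nat_of_bool.
  by apply/idP/idP; rewrite inE /= /enorm (ler_sqrt _ (ltW t0)).
rewrite leb_ball ?sqrtr_gt0// addrK -!EFinM; congr EFin.
rewrite -powR12_sqrt ?ltW// -powR_mulrn ?powR_ge0// -powRrM (mulrC _ n%:R); ring.
Qed.

(** The product with the positive number [kappa] in [kappa_EGamma] is finite. *)
Lemma EGamma_fin n : EGamma (n.+1%:R / 2) \is a fin_num.
Proof.
have n0 : 0 < n.+1%:R / 2 :> R by rewrite divr_gt0.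
have := kappa_EGamma n.+1; rewrite EGammaS// muleA -EFinM.
case: (EGamma _) (EGamma_ge0 (n.+1%:R / 2)) => //= _.
by rewrite gt0_muley// lte_fin mulr_gt0// kappa_gt0.
Qed.

Lemma Gamma_half n :
  kappa n.+1 * (n.+1%:R / 2) * Gamma (n.+1%:R / 2) = Num.sqrt pi ^+ n.+1 :> R.
Proof.
have n0 : 0 < n.+1%:R / 2 :> R by rewrite divr_gt0.
have := kappa_EGamma n.+1; rewrite EGammaS// -(fineK (EGamma_fin n)) muleA -!EFinM.
by move=> h; exact: (EFin_inj h).
Qed.

Lemma sqrt_pi_powR n : Num.sqrt pi ^+ n = pi `^ (n%:R / 2) :> R.
Proof.
by rewrite -powR12_sqrt ?pi_ge0// -powR_mulrn ?powR_ge0// -powRrM mulrC.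
Qed.

Lemma omega_kappa n : omega n.+1 = n.+1%:R * kappa n.+1 :> R.
Proof.
have := Gamma_half n; have := kappa_gt0 n.+1.
rewrite /omega -sqrt_pi_powR => k0 <-.
have : Gamma (n.+1%:R / 2) != 0 :> R.
  apply/eqP => G0; have := Gamma_half n; rewrite G0 mulr0 => /esym/eqP.
  by rewrite expf_eq0 sqrtr_eq0 leNgt pi_gt0.
by move=> G0; field.
Qed.

Lemma omega_gt0 n : 0 < omega n.+1 :> R.
Proof. by rewrite omega_kappa mulr_gt0// kappa_gt0. Qed.

(** Obtained from Gamma(n/2 + 1) instead of Gamma(n/2), so that n = 0 is included; [kappa_level]
    starts from it in every dimension. *)
Lemma kappa_omega n : omega n.+2 = 2 * pi * kappa n :> R.
Proof.
have k0 := kappa_gt0 n.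
have e : n.+2%:R / 2 = n%:R / 2 + 1 :> R by rewrite -addn2 natrD; field.
have : (EGamma (n%:R / 2 + 1)) \is a fin_num by rewrite -e EGamma_fin.
have := kappa_EGamma n.
rewrite /omega -sqrt_pi_powR e !exprS mulrA -expr2 sqr_sqrtr ?pi_ge0//.
move=> + fE; rewrite -(fineK fE) -EFinM => h.
have {h} : kappa n * Gamma (n%:R / 2 + 1) = Num.sqrt pi ^+ n :> R := EFin_inj h.
move=> kE; rewrite -kE.
have : Gamma (n%:R / 2 + 1) != 0 :> R.
  apply/eqP => G0; move: kE; rewrite G0 mulr0 => /esym/eqP.
  by rewrite expf_eq0 sqrtr_eq0 leNgt pi_gt0 andbF.
by move=> G0; field.
Qed.

Lemma omegaSS n : omega n.+3 = 2 * pi / n.+1%:R * omega n.+1 :> R.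
Proof. by rewrite kappa_omega omega_kappa; field. Qed.

Lemma omega1 : omega 1 = 2 :> R.
Proof. by rewrite omega_kappa kappa1 mul1r. Qed.

End constants.

(** * The space of lines *)

Section lines.
Context {R : realType} {n : nat}.
Local Notation V := 'rV[R]_n.+1.
Local Notation LS := (@line_space R n).
Local Notation RM := (measurableTypeR R).
Implicit Types (x v b : V) (E : @line R n.+1).

Lemma line_through_reparam x v (t c : R) : c != 0 ->
  line_through (x + t *: v) (c *: v) = line_through x v.
Proof.
move=> c0; apply/seteqP; split=> y [r ->].
  by exists (t + r * c); rewrite scalerDl scalerA addrA.
by exists ((r - t) / c); apply/rowP => i; rewrite !mxE; field.
Qed.

Lemma line_through_eq x v x' v' : v != 0 -> v' != 0 ->
  line_through x v = line_through x' v' ->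
  exists t c : R, [/\ c != 0, x' = x + t *: v & v' = c *: v].
Proof.
move=> v0 v'0 e.
have [t xE] : line_through x v x' by rewrite e; exists 0; rewrite scale0r addr0.
have [r vE] : line_through x v (x' + v') by rewrite e; exists 1; rewrite scale1r.
exists t, (r - t : R); have v'E : v' = (r - t) *: v.
  by apply/rowP => i; have := congr1 (fun w : V => w ord0 i) vE; rewrite xE !mxE; lra.
split => //; apply: contraNneq v'0 => c0; by rewrite v'E c0 scale0r.
Qed.

Definition mkline x v (v0 : v != 0) : @line R n.+1 :=
  SigSub (mem_set (ex_intro _ x (ex_intro _ v (conj v0 erefl)))).

Lemma line_set_mkline x v (v0 : v != 0) : line_set (mkline x v0) = line_through x v.
Proof. by []. Qed.

Lemma line_rep E : exists p : V * V, p.2 != 0 /\ line_set E = line_through p.1 p.2.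
Proof.
by have /set_mem [x [v [v0 e]]] := valP E; exists (x, v).
Qed.

(** An arbitrary choice without any measurability. Only quantities that do not depend on the
    representative are derived from it. *)
Definition rep E : V * V := projT1 (cid (line_rep E)).

Lemma rep_neq0 E : (rep E).2 != 0.
Proof. by have [] := projT2 (cid (line_rep E)). Qed.

Lemma line_set_rep E : line_set E = line_through (rep E).1 (rep E).2.
Proof. by have [] := projT2 (cid (line_rep E)). Qed.

Lemma open_dir_neq0 : open [set p : V * V | p.2 != 0].
Proof.
rewrite (_ : mkset _ = snd @^-1` (~` [set (0 : V)])).
  apply: open_comp; first by move=> x _; exact: cvg_snd.
  rewrite openC; apply: accessible_closed_set1.
  exact/hausdorff_accessible/norm_hausdorff.
by apply/seteqP; split => -[x v] /=; [move=> /eqP|move=> /eqP].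
Qed.

(** In the final topology openness is tested on the pairs (x, v) with v nonzero. [W] may be
    arbitrary at v = 0, since an open condition already excludes these pairs. *)
Lemma open_lineP (U : set (@line R n.+1)) (W : set (V * V)) :
  (forall E x v, v != 0 -> line_set E = line_through x v -> U E <-> W (x, v)) ->
  (forall p : V * V, p.2 != 0 -> W p -> nbhs p W) -> open U.
Proof.
move=> UW oW; rewrite /open /= /line_open /= openE => -[x v] /= [v0 [E UE Ee]].
have Wxv : W (x, v) by apply/(UW E).
have vn0 : \forall q \near (x, v), q.2 != 0.
  by apply: open_nbhs_nbhs; split => //; exact: open_dir_neq0.
apply: filterS2 vn0 (oW (x, v) v0 Wxv) => -[y w] /= w0 Wyw; split => //.
by exists (mkline y w0) => //; apply/(UW _ y w).
Qed.

Lemma line_measurable_fun (f : @line R n.+1 -> R) (phi : V * V -> R) :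
  (forall E x v, v != 0 -> line_set E = line_through x v -> f E = phi (x, v)) ->
  (forall p : V * V, p.2 != 0 -> {for p, continuous phi}) ->
  measurable_fun [set: line_space n] (f : line_space n -> R).
Proof.
move=> fphi cphi; apply: (@measurability _ _ _ R _ _ (@RGenOInfty.G R)).
  exact: RGenOInfty.measurableE.
move=> _ [_ [a ->] <-]; rewrite setTI; apply: borel_open.
apply: (@open_lineP _ (phi @^-1` `]a, +oo[%classic)).
  by move=> E x v v0 Ee; rewrite /preimage /= (fphi E x v).
move=> p p0 ap; apply: (cphi p p0); by apply: open_nbhs_nbhs; split.
Qed.

(** The matrix of the orthogonal projection onto the direction of E. It determines the direction up
    to sign and, unlike a direction vector, depends continuously on the line. *)
Definition prj E : 'M[R]_n.+1 :=
  \matrix_(i, j) ((rep E).2 ord0 i * (rep E).2 ord0 j / dotp (rep E).2 (rep E).2).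

Definition foot E : V :=
  (rep E).1 - (dotp (rep E).1 (rep E).2 / dotp (rep E).2 (rep E).2) *: (rep E).2.

Lemma dotp_neq0 v : v != 0 -> dotp v v != 0.
Proof. by rewrite dotp_eq0. Qed.

Lemma prjE E x v i j : v != 0 -> line_set E = line_through x v ->
  prj E i j = v ord0 i * v ord0 j / dotp v v.
Proof.
move=> v0; rewrite line_set_rep => e; rewrite mxE.
have [t [c [c0 _ ->]]] := line_through_eq v0 (rep_neq0 E) (esym e).
rewrite dotpZl dotpZr !mxE; have := dotp_neq0 v0 => ?.
by field; apply/andP.
Qed.

Lemma footE E x v : v != 0 -> line_set E = line_through x v ->
  foot E = x - (dotp x v / dotp v v) *: v.
Proof.
move=> v0; rewrite line_set_rep /foot => e.
have [t [c [c0 -> ->]]] := line_through_eq v0 (rep_neq0 E) (esym e).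
rewrite dotpDl !dotpZl !dotpZr scalerA; have v2 := dotp_neq0 v0.
have -> : (c * dotp x v + t * (c * dotp v v)) / (c * (c * dotp v v)) * c =
    dotp x v / dotp v v + t by field; apply/andP.
by rewrite scalerDl opprD addrACA [t *: v - _]addrC addrA addrNK.
Qed.

Lemma coord_continuous_at (T : topologicalType) (f : T -> V) (p : T) i :
  {for p, continuous f} -> {for p, continuous (fun q => f q ord0 i)}.
Proof.
move=> cf; apply: (continuous_comp (g := fun y : V => y ord0 i) cf).
exact: coord_continuous.
Qed.

Lemma fst_cont (p : V * V) : {for p, continuous fst}.
Proof. exact: cvg_fst. Qed.

Lemma snd_cont (p : V * V) : {for p, continuous snd}.
Proof. exact: cvg_snd. Qed.

Lemma prj_measurable i j :
  measurable_fun [set: line_space n] (fun E : line_space n => prj E i j).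
Proof.
apply: (@line_measurable_fun _ (fun p => p.2 ord0 i * p.2 ord0 j / dotp p.2 p.2)).
  by move=> E x v v0 e; exact: (prjE i j v0 e).
move=> p p0; apply: cvgM.
  by apply: cvgM; apply: (coord_continuous_at (@snd_cont p)).
apply: cvgV; first exact: dotp_neq0.
exact: (dotp_continuous (@snd_cont p) (@snd_cont p)).
Qed.

Lemma foot_measurable :
  measurable_fun [set: line_space n] (foot : line_space n -> borel V).
Proof.
apply: measurable_fun_rV => i.
apply: (@line_measurable_fun _ (fun p =>
   p.1 ord0 i - dotp p.1 p.2 / dotp p.2 p.2 * p.2 ord0 i)).
  by move=> E x v v0 e; rewrite (footE v0 e) !mxE.
move=> p p0; apply: cvgB; first exact: (coord_continuous_at (@fst_cont p)).
apply: cvgM; last exact: (coord_continuous_at (@snd_cont p)).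
apply: cvgM; first exact: (dotp_continuous (@fst_cont p) (@snd_cont p)).
apply: cvgV; first exact: dotp_neq0.
exact: (dotp_continuous (@snd_cont p) (@snd_cont p)).
Qed.

(* A unit direction is only determined up to sign; this picks one measurably. *)
Fixpoint pickdir (s : seq 'I_n.+1) (P : 'M[R]_n.+1) : V :=
  if s is i :: s' then
    if P i i == 0 then pickdir s' P else (P i i `^ (- 2^-1)) *: row i P
  else 0.

Definition udir E : V := pickdir (enum 'I_n.+1) (prj E).

Lemma udir_measurable :
  measurable_fun [set: line_space n] (udir : line_space n -> borel V).
Proof.
apply: measurable_fun_rV => j; rewrite /udir.
elim: (enum _) => [|i s IH] /=.
  by under eq_fun do rewrite mxE; exact: measurable_cst.
rewrite [X in measurable_fun _ X](_ : _ = fun E : line_space n =>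
  if prj E i i == 0 then pickdir s (prj E) ord0 j
  else prj E i i `^ (- 2^-1) * prj E i j); last first.
  by apply/funext => E; case: ifP => // _; rewrite !mxE.
apply: measurable_fun_ifT => //.
- by apply: measurable_fun_eqr => //; exact: prj_measurable.
- apply: measurable_funM; last exact: prj_measurable.
  apply: (measurableT_comp (f := fun r : R => r `^ (- 2^-1))); first exact: measurable_powR.
  exact: prj_measurable.
Qed.

(** For a unit vector v the i-th row of the projection is v_i v and its i-th diagonal entry is
    v_i^2, so the normalized row is v up to the sign of v_i. *)
Lemma udir_cases E x v : dotp v v = 1 -> line_set E = line_through x v ->
  udir E = v \/ udir E = - v.
Proof.
move=> v1 e.
have v0 : v != 0 by rewrite -dotp_eq0 v1 oner_eq0.
have P i j : prj E i j = v ord0 i * v ord0 j by rewrite (prjE _ _ v0 e) v1 divr1.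
have : has (fun i => v ord0 i != 0) (enum 'I_n.+1).
  apply: contraNT v0 => /hasPn h; apply/eqP/rowP => i; rewrite mxE.
  by apply/eqP; rewrite -[_ == _]negbK h ?mem_enum.
rewrite /udir; elim: (enum _) => //= i s IH; rewrite P mulf_eq0 orbb.
case: eqP => [vi /IH//|/eqP vi _].
have -> : row i (prj E) = v ord0 i *: v by apply/rowP => j; rewrite !mxE -P mxE.
rewrite scalerA -expr2 powRN powR12_sqrt ?sqr_ge0// sqrtr_sqr; case: (ltrgt0P (v ord0 i)) vi => // vi _.
  by rewrite mulVf ?scale1r ?gt_eqF//; left.
by rewrite invrN mulNr mulVf ?lt_eqF// scaleN1r; right.
Qed.

Lemma unit_rep E : exists v, dotp v v = 1 /\ exists x, line_set E = line_through x v.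
Proof.
have [[x v] /= [v0 e]] := line_rep E.
exists ((enorm v)^-1 *: v); have ev : enorm v != 0 by rewrite enorm_eq0.
split; last first.
  exists x; rewrite e -(@line_through_reparam x v 0 (enorm v)^-1) ?invr_eq0//.
  by rewrite scale0r addr0.
by rewrite dotpZl dotpZr -sqr_enorm; field.
Qed.

Lemma udir_unit E : dotp (udir E) (udir E) = 1.
Proof.
have [v [v1 [x e]]] := unit_rep E.
by have [->|->] := udir_cases v1 e => //; rewrite dotpNl dotpNr opprK.
Qed.

Lemma line_set_udir E : line_set E = line_through (foot E) (udir E).
Proof.
have [v [v1 [x e]]] := unit_rep E.
have v0 : v != 0 by rewrite -dotp_eq0 v1 oner_eq0.
rewrite (footE v0 e) v1 divr1 -scaleNr.
have [->|->] := udir_cases v1 e; rewrite e.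
  by rewrite -[in RHS](scale1r v) scalerA mulr1 line_through_reparam ?oner_eq0.
by rewrite -[in RHS](scaleN1r v) line_through_reparam ?oppr_eq0 ?oner_eq0.
Qed.

Lemma udir_neq0 E : udir E != 0.
Proof. by rewrite -dotp_eq0 udir_unit oner_eq0. Qed.

Definition line_integral (g : V -> \bar R) E : \bar R :=
  (\int[lebesgue_measure]_t g (foot E + t *: udir E)%R)%E.

Lemma line_param_measurable x v :
  measurable_fun [set: RM] (fun t : RM => x + t *: v : borel V).
Proof.
apply: measurable_fun_rV => i; under eq_fun do rewrite !mxE.
apply: measurable_funD; first exact: measurable_cst.
by apply: measurable_funM; [exact: (@measurable_id _ RM setT)|exact: measurable_cst].
Qed.

(** Two parametrizations of a line by unit directions differ by a shift and a sign, and both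
    preserve Lebesgue measure. *)
Lemma line_integralE (g : borel V -> \bar R) E x v :
  measurable_fun setT g -> (forall y, 0 <= g y)%E ->
  dotp v v = 1 -> line_set E = line_through x v ->
  line_integral g E = (\int[lebesgue_measure]_t g (x + t *: v)%R)%E.
Proof.
move=> mg g0 v1 e; rewrite /line_integral.
have v0 : v != 0 by rewrite -dotp_eq0 v1 oner_eq0.
rewrite (footE v0 e) v1 divr1.
have mgl w : measurable_fun [set: RM] (fun t : RM => g (x + t *: w)).
  exact: measurableT_comp mg (@line_param_measurable x w).
have shift (w : V) (a : R) : (\int[lebesgue_measure]_t g (x + t *: w)%R =
    \int[lebesgue_measure]_t g (x - a *: w + t *: w)%R)%E.
  rewrite -(ge0_integral_shift (- a) (mgl w))//; apply: eq_integral => t _.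
  by rewrite scalerDl scaleNr addrAC addrA.
have [->|->] := udir_cases v1 e; first by rewrite -shift.
rewrite -[RHS](ge0_integral_opp (mgl v))// [RHS](_ : _ = \int[lebesgue_measure]_t g (x + t *: - v)%R)%E; last first.
  by apply: eq_integral => t _; rewrite scalerN scaleNr.
rewrite [RHS](shift (- v) (- dotp x v)).
by apply: eq_integral => t _; congr (g (_ + _)); rewrite scaleNr scalerN !opprK.
Qed.

Lemma motion_line (A : 'M[R]_n.+1) b E : A *m A^T = 1%:M ->
  exists F : @line R n.+1, line_set F = [set y *m A + b | y in line_set E].
Proof.
move=> AA; have [[x v] /= [v0 e]] := line_rep E.
have vA : v *m A != 0 by rewrite -dotp_eq0 dotp_mulmx// dotp_eq0.
exists (mkline (x *m A + b) vA); rewrite line_set_mkline e.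
apply/seteqP; split => y /=.
  by move=> [t ->]; exists (x + t *: v); [exists t|rewrite mulmxDl -scalemxAl addrAC].
by move=> [_ [t ->] <-]; exists t; rewrite mulmxDl -scalemxAl addrAC.
Qed.

Definition motion (A : 'M[R]_n.+1) b (AA : A *m A^T = 1%:M) E : @line R n.+1 :=
  projT1 (cid (motion_line b E AA)).

Lemma line_set_motion A b (AA : A *m A^T = 1%:M) E :
  line_set (motion b AA E) = [set y *m A + b | y in line_set E].
Proof. exact: (projT2 (cid (motion_line b E AA))). Qed.

Lemma motion_rep A b (AA : A *m A^T = 1%:M) E x v :
  line_set E = line_through x v ->
  line_set (motion b AA E) = line_through (x *m A + b) (v *m A).
Proof.
move=> e; rewrite line_set_motion e; apply/seteqP; split => y /=.
  by move=> [_ [t ->] <-]; exists t; rewrite mulmxDl -scalemxAl addrAC.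
by move=> [t ->]; exists (x + t *: v); [exists t|rewrite mulmxDl -scalemxAl addrAC].
Qed.

Lemma rV_continuous (T : topologicalType) (f : T -> V) (p : T) :
  (forall i, {for p, continuous (fun q => f q ord0 i)}) -> {for p, continuous f}.
Proof.
move=> cf; apply/cvgrPdist_lt => e e0.
have : \forall q \near p, forall i, `|f p ord0 i - f q ord0 i| < e.
  apply: filter_forall => i; have /cvgrPdist_lt := cf i; exact.
apply: filterS => q fq; rewrite (_ : `|_| = mx_norm (f p - f q))//.
rewrite mx_normrE bigmax_lt// => -[i j] _ /=; rewrite ord1 !mxE; exact: fq.
Qed.

Lemma mulmx_continuous (A : 'M[R]_n.+1) x : {for x, continuous (fun x : V => x *m A)}.
Proof.
apply: rV_continuous => i.
have e : (fun q : V => (q *m A) ord0 i) = fun q => dotp q (col i A)^T.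
  by apply/funext => q; rewrite mxE; apply: eq_bigr => j _; rewrite !mxE.
by rewrite e; exact: dotpl_continuous.
Qed.

Lemma pair_continuous (T : topologicalType) (f g : T -> V) (p : T) :
  {for p, continuous f} -> {for p, continuous g} ->
  {for p, continuous (fun q => (f q, g q))}.
Proof. by move=> cf cg; exact: (cvg_pair cf cg). Qed.

Lemma motion_measurable A b (AA : A *m A^T = 1%:M) :
  measurable_fun [set: line_space n] (motion b AA : line_space n -> line_space n).
Proof.
apply: measurable_fun_borel => U oU; apply: borel_open.
pose h (p : V * V) := (p.1 *m A + b, p.2 *m A).
apply: (@open_lineP _ (fun p => exists2 E, U E & line_set E = line_through (h p).1 (h p).2)).
  move=> E x v v0 e; split => [UE|[F UF Fe]].
    by exists (motion b AA E) => //; exact: motion_rep.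
  rewrite /preimage /=; suff -> : motion b AA E = F by [].
  by apply: line_set_inj; rewrite Fe; exact: motion_rep.
move=> p p0 [F UF Fe].
have hp : (h p).2 != 0 by rewrite -dotp_eq0 dotp_mulmx// dotp_eq0.
have ch : {for p, continuous h}.
  apply: pair_continuous.
    apply: continuousD; last exact: cst_continuous.
    exact: (continuous_comp (@fst_cont p) (@mulmx_continuous A _)).
  exact: (continuous_comp (@snd_cont p) (@mulmx_continuous A _)).
move: oU; rewrite /open /= /line_open /= openE => oU.
have := oU (h p) (conj hp (ex_intro2 _ _ F UF Fe)).
move=> /ch; rewrite nbhs_filterE => H.
by apply: (@filterS _ (nbhs p) _ _ _ _ H) => q [].
Qed.

(** Invariance is assumed for images. The motion is bijective on lines, so X is the image of its
    preimage. *)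
Lemma motion_preserves (mu : {measure set (line_space n) -> \bar R}) A b
    (AA : A *m A^T = 1%:M) : is_motion_invariant mu -> \det A = 1 ->
  forall X : set (line_space n), measurable X -> mu (motion b AA @^-1` X : set (line_space n)) = mu X.
Proof.
move=> inv detA X mX.
have mX' : measurable (motion b AA @^-1` X : set (line_space n)).
  by rewrite -[X in measurable X]setTI; exact: motion_measurable.
rewrite -(inv A b AA detA _ mX'); congr (mu _).
have AA' : A^T *m A^T^T = 1%:M by rewrite trmxK; exact: mulmx1C.
apply/seteqP; split => F /=.
  move=> [E XE Fe]; have <- : motion b AA E = F => //.
  by apply: line_set_inj; rewrite Fe line_set_motion.
(* The inverse motion is y -> (y - b) A^T. *)
move=> XF; pose E := motion (- (b *m A^T)) AA' F.
have EF : motion b AA E = F.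
  apply: line_set_inj; rewrite line_set_motion line_set_motion.
  have k (y : V) : (y *m A^T - b *m A^T) *m A + b = y.
    by rewrite -mulmxBl -mulmxA (mulmx1C AA) mulmx1 addrNK.
  apply/seteqP; split => y /=; first by move=> [_ [w Fw <-] <-]; rewrite k.
  by move=> Fy; exists (y *m A^T - b *m A^T); [exists y|].
by exists E; rewrite ?EF// -line_set_motion EF.
Qed.

Lemma measurable_rVD d (X : measurableType d) (f g : X -> borel V) :
  measurable_fun setT f -> measurable_fun setT g ->
  measurable_fun setT (fun x : X => (f x : V) + (g x : V) : borel V).
Proof.
move=> mf mg; apply: measurable_fun_rV => i; under eq_fun do rewrite mxE.
by apply: measurable_funD; apply: (measurableT_comp (coord_measurable i)).
Qed.

Lemma measurable_rVZ d (X : measurableType d) (a : X -> R) (f : X -> borel V) :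
  measurable_fun setT a -> measurable_fun setT f ->
  measurable_fun setT (fun x : X => a x *: (f x : V) : borel V).
Proof.
move=> ma mf; apply: measurable_fun_rV => i; under eq_fun do rewrite mxE.
by apply: measurable_funM => //; apply: (measurableT_comp (coord_measurable i)).
Qed.

Lemma measurable_rVN d (X : measurableType d) (f : X -> borel V) :
  measurable_fun setT f -> measurable_fun setT (fun x : X => - (f x : V) : borel V).
Proof.
move=> mf; apply: measurable_fun_rV => i; under eq_fun do rewrite mxE.
by apply: measurable_funN; apply: (measurableT_comp (coord_measurable i)).
Qed.

Lemma line_point_measurable :
  measurable_fun [set: LS * RM]
    (fun p : LS * RM => foot p.1 + p.2 *: udir p.1 : borel V).
Proof.
have mfst : measurable_fun [set: LS * RM] (fst : LS * RM -> LS) := measurable_fst.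
have msnd : measurable_fun [set: LS * RM] (snd : LS * RM -> RM) := measurable_snd.
apply: measurable_rVD; first exact: (measurableT_comp foot_measurable mfst).
by apply: measurable_rVZ => //; exact: (measurableT_comp udir_measurable mfst).
Qed.

Lemma measurable_EFin_line_integral (g : borel V -> \bar R) :
  measurable_fun setT g -> (forall y, 0 <= g y)%E ->
  measurable_fun [set: LS] (line_integral g : LS -> \bar R).
Proof.
move=> mg g0; apply: (@measurable_fun_fubini_tonelli_F _ _ LS RM R (@lebesgue_measure R)
  (fun p => g (foot p.1 + p.2 *: udir p.1)))  => //=.
exact: measurableT_comp mg line_point_measurable.
Qed.

(* [y] lies on the line through [x] with direction [v] iff this vanishes: the equality case of Cauchy-Schwarz. *)
Definition residual (y : V) (p : V * V) : R :=
  dotp (y - p.1) (y - p.1) * dotp p.2 p.2 - dotp (y - p.1) p.2 ^+ 2.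

Lemma residual_eq0 y (p : V * V) : p.2 != 0 ->
  residual y p = 0 <-> line_through p.1 p.2 y.
Proof.
case: p => x v /= v0; have v2 := dotp_neq0 v0; split=> [|[t ->]]; last first.
  by rewrite /residual /= [x + _]addrC addrK !(dotpZl, dotpZr); ring.
rewrite /residual /= => r0; exists (dotp (y - x) v / dotp v v).
apply/eqP; rewrite -subr_eq0 -dotp_eq0 opprD addrA !(dotpBl, dotpBr) !(dotpZl, dotpZr).
move: r0; rewrite !(dotpBl, dotpBr) (dotpC v y) (dotpC v x) (dotpC x y).
set a := dotp y y; set b := dotp y x; set c := dotp x x; set d := dotp y v; set e := dotp x v.
move=> r0; apply/eqP; by rewrite -[RHS](mul0r (dotp v v)^-1) -r0; field.
Qed.

Definition hits (C : set V) : set LS := [set E | line_set E `&` C !=set0].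

(** Missing C is an open condition: [residual] is continuous and nonzero on C, and by compactness it
    stays nonzero on all of C for nearby lines. *)
Lemma hits_measurable (C : set V) : compact C -> measurable (hits C).
Proof.
move=> cC; rewrite -(setCK (hits C)); apply: measurableC; apply: borel_open.
apply: (@open_lineP _ (fun p => forall y, C y -> residual y p != 0)).
  move=> E x v v0 e; split.
    move=> nh y Cy; apply/eqP => /(residual_eq0 _ (p := (x, v)) v0) xvy.
    by apply: nh; exists y; rewrite e.
  move=> H [y [Ey Cy]]; move: (H y Cy); rewrite (_ : residual _ _ = 0) ?eqxx//.
  by apply/(residual_eq0 _ (p := (x, v)) v0); rewrite -e.
move=> p p0 H; move/compact_near_coveringP : cC.
move=> /(_ (V * V)%type (nbhs p) (fun q y => residual y q != 0) _); apply=> y Cy.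
pose rho (yq : V * (V * V)) := residual yq.1 yq.2.
have c1 : {for (y, p), continuous (fun yq : V * (V * V) => yq.1 - yq.2.1)}.
  apply: continuousB; first exact: cvg_fst.
  by apply: (continuous_comp (f := snd) (g := fst)); [exact: cvg_snd|exact: cvg_fst].
have c2 : {for (y, p), continuous (fun yq : V * (V * V) => yq.2.2)}.
  by apply: (continuous_comp (f := snd) (g := snd)); exact: cvg_snd.
have crho : {for (y, p), continuous rho}.
  have c12 := dotp_continuous c1 c2.
  apply: cvgB; last exact: (cvgM c12 c12).
  by apply: cvgM; [exact: (dotp_continuous c1 c1)|exact: (dotp_continuous c2 c2)].
apply: (crho [set r | r != 0]); apply: open_nbhs_nbhs; split; last exact: H.
rewrite (_ : mkset _ = ~` [set 0]); first by rewrite openC; exact: closed_eq.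
by apply/seteqP; split => r /= /eqP.
Qed.

Lemma norm_le_enorm x : `|x| <= enorm x.
Proof.
rewrite (_ : `|x| = mx_norm x)// mx_normrE; apply: bigmax_le; first exact: enorm_ge0.
by move=> [i j] _ /=; rewrite ord1; exact: coord_le_enorm.
Qed.

Definition cball b (r : R) : set V := [set y | enorm (y - b) <= r].

Lemma closed_ball_compact b (r : R) : compact (cball b r).
Proof.
apply: bounded_closed_compact.
  exists (r + enorm b); split; first exact: num_real.
  move=> M rM y /= yb; apply: (le_trans (norm_le_enorm y)); apply: ltW.
  apply: le_lt_trans rM; rewrite -[in leLHS](subrK b y).
  by apply: (le_trans (enormD _ _)); rewrite lerD2r.
rewrite (_ : cball b r = (fun y => enorm (y - b)) @^-1` `]-oo, r]%classic).
  apply: preimage_closed; last exact: closed_le.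
  move=> y _; apply: (continuous_comp (f := fun y : V => y - b)).
    by apply: continuousB => //; exact: cst_continuous.
  exact: enorm_continuous.
by apply/seteqP; split => x; rewrite /cball /= in_itv.
Qed.

Lemma unit_ball_compact : compact (@unit_ball R n.+1).
Proof.
rewrite (_ : unit_ball _ = cball 0 1); first exact: closed_ball_compact.
by apply/seteqP; split => x; rewrite /unit_ball /cball /= subr0.
Qed.

(** * Integration with respect to the line measure *)

Section measure.
Variable mu : {measure set LS -> \bar R}.
Hypothesis Hmu : is_line_measure mu.

Lemma mulmx1_tr : (1%:M : 'M[R]_n.+1) *m 1%:M^T = 1%:M.
Proof. by rewrite trmx1 mulmx1. Qed.

Lemma hits_ball_lty b : (mu (hits (cball b 1)) < +oo)%E.
Proof.
have -> : hits (cball b 1) =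
    motion (- b) mulmx1_tr @^-1` hits (unit_ball n.+1).
  apply/seteqP; split => E /= -[y [Ey yb]].
    exists (y - b); split => //; rewrite line_set_motion.
    by exists y => //; rewrite mulmx1.
  move: Ey; rewrite line_set_motion => -[w Ew yw]; exists w; split => //.
  by move: yb; rewrite -yw mulmx1.
rewrite motion_preserves ?det1//; last 2 first.
- exact: Hmu.1.
- exact: (hits_measurable unit_ball_compact).
by rewrite /hits Hmu.2 ltry.
Qed.

(** Finitely many unit balls cover a compact set, and each is a translate of the ball that
    normalizes [mu]. *)
Lemma hits_lty (C : set V) : compact C -> (mu (hits C) < +oo)%E.
Proof.
move=> cC; have := cC; rewrite compact_cover.
move=> /(_ V C (fun b => [set y | enorm (y - b) < 1])) [b _| y Cy|D _ CD].
- apply: (@open_comp _ _ (fun y : V => enorm (y - b)) `]-oo, 1[%classic).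
    move=> y _; apply: (continuous_comp (f := fun y : V => y - b)).
      by apply: continuousB => //; exact: cst_continuous.
    exact: enorm_continuous.
  exact: open_lt.
- by exists y => //=; rewrite subrr enorm0.
pose Hb b : set (line_space n) := hits (cball b 1).
have mHb b : measurable (Hb b) by exact: (hits_measurable (@closed_ball_compact _ _)).
have mHU (s : seq V) : measurable (\big[setU/set0]_(b <- s) Hb b : set (line_space n)).
  exact: bigsetU_measurable.
have HC : hits C `<=` \big[setU/set0]_(b <- finmap.enum_fset D) Hb b.
  move=> E [y [Ey Cy]]; have [b /= bD yb] := CD _ Cy.
  rewrite -bigcup_seq; exists b => //; exists y; split => //=.
  exact: ltW.
apply: (@le_lt_trans _ _ (mu (\big[setU/set0]_(b <- finmap.enum_fset D) Hb b))).
  by apply: le_measure; rewrite ?inE//; exact: hits_measurable.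
elim: (finmap.enum_fset D) => [|b s IH]; first by rewrite big_nil measure0.
rewrite big_cons.
apply: (@le_lt_trans _ _ (mu (Hb b) + mu (\big[setU/set0]_(b <- s) Hb b))%E).
  exact: measureU2.
by apply: lte_add_pinfty => //; exact: hits_ball_lty.
Qed.

Lemma mu_sigma_finite : sigma_finite setT mu.
Proof.
exists (fun k : nat => hits (cball 0 k%:R)).
  apply/seteqP; split => // E _.
  pose m := Num.truncn (enorm (foot E)); exists m.+1 => //.
  exists (foot E); rewrite line_set_udir; split.
    by exists 0; rewrite scale0r addr0.
  by rewrite /cball /= subr0 ltW// truncnS_gt.
move=> k; split; first exact: (hits_measurable (@closed_ball_compact _ _)).
exact: (hits_lty (@closed_ball_compact _ _)).
Qed.

Lemma ge0_integral_motion A b (AA : A *m A^T = 1%:M) (f : LS -> \bar R) :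
  \det A = 1 -> measurable_fun setT f -> (forall E, 0 <= f E)%E ->
  (\int[mu]_E f (motion b AA E) = \int[mu]_E f E)%E.
Proof.
move=> detA mf f0; apply: ge0_integral_preserved => //.
  exact: motion_measurable.
by apply: motion_preserves => //; exact: Hmu.1.
Qed.

Lemma tonelli3 (m : {sigma_finite_measure set LS -> \bar R})
    (F : (borel V * LS) * RM -> \bar R) :
  measurable_fun setT F -> (forall p, 0 <= F p)%E ->
  (\int[leb n.+1]_y \int[m]_E \int[lebesgue_measure]_t F ((y, E), t) =
   \int[m]_E \int[lebesgue_measure]_t \int[leb n.+1]_y F ((y, E), t))%E.
Proof.
move=> mF F0.
have mG : measurable_fun setT (fun p => \int[lebesgue_measure]_t F (p, t))%E.
  exact: measurable_fun_fubini_tonelli_F.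
have G0 p : (0 <= \int[lebesgue_measure]_t F (p, t))%E by apply: integral_ge0.
rewrite (@fubini_tonelli _ _ _ _ _ (leb n.+1) m _ mG G0); apply: eq_integral => E _.
pose H (q : borel V * RM) := F ((q.1, E), q.2).
rewrite (@fubini_tonelli _ _ _ _ _ (leb n.+1) (@lebesgue_measure R) H)//; last by move=> q; exact: F0.
apply: measurableT_comp mF _; apply: measurable_fun_pair; last exact: measurable_snd.
by apply: measurable_fun_pair; [exact: measurable_fst|exact: measurable_cst].
Qed.

(** The length that the unit ball cuts from E. Integrable and invariant under rotations, it serves
    as a weight on directions. *)
Definition chord E : \bar R := line_integral (fun x => (\1_(@unit_ball R n.+1) x)%:E) E.

(** Averages over the translations by the points y of the unit ball and exchanges integrals. In the
    end y runs over the whole space independently of the line, and the ball survives only in the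
    chord weight. Evenness of g in the direction is asked because [udir] is pinned down only up to
    sign. *)
Lemma disintegration (g : borel V * borel V -> \bar R) :
  measurable_fun setT g -> (forall p, 0 <= g p)%E ->
  (forall x v, g (x, - v)%R = g (x, v)) ->
  ((kappa n.+1)%:E * \int[mu]_E line_integral (fun x => g (x, udir E)) E =
   \int[leb n.+1]_y \int[mu]_E (chord E * g (y, udir E)))%E.
Proof.
move=> mg g0 gN.
pose m : {sigma_finite_measure set LS -> \bar R} := sigma_finite_copy mu_sigma_finite.
pose B := @unit_ball R n.+1.
have mB : measurable (B : set (borel V)) := unit_ball_measurable.
have mgl v : measurable_fun setT (fun x : borel V => g (x, v)).
  by apply: measurableT_comp mg _; exact: pair2_measurable.
have mBl : measurable_fun setT (fun x : borel V => (\1_B x)%:E : \bar R).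
  exact: measurable_EFin_indic.
have gu E x v w : dotp v v = 1 -> line_set E = line_through x v -> g (w, udir E) = g (w, v).
  by move=> v1 e; have [->|->] := udir_cases v1 e.
pose F (p : (borel V * LS) * RM) : \bar R := ((\1_B p.1.1)%:E *
  g (p.1.1 + (foot p.1.2 + p.2 *: udir p.1.2), udir p.1.2)%R)%E.
pose F2 (p : (borel V * LS) * RM) : \bar R :=
  ((\1_B (p.1.1 - (foot p.1.2 + p.2 *: udir p.1.2))%R)%:E * g (p.1.1, udir p.1.2))%E.
have F0 p : (0 <= F p)%E by apply: mule_ge0 => //; rewrite lee_fin.
have F20 p : (0 <= F2 p)%E by apply: mule_ge0 => //; rewrite lee_fin.
have m11 : measurable_fun setT (fun p : (borel V * LS) * RM => p.1.1 : borel V).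
  exact: (measurableT_comp measurable_fst measurable_fst).
have m12 : measurable_fun setT (fun p : (borel V * LS) * RM => p.1.2 : LS).
  exact: (measurableT_comp measurable_snd measurable_fst).
have mpt : measurable_fun setT (fun p : (borel V * LS) * RM =>
    foot p.1.2 + p.2 *: udir p.1.2 : borel V).
  apply: (measurableT_comp line_point_measurable (g := fun p => (p.1.2, p.2))).
  by apply: measurable_fun_pair => //; exact: measurable_snd.
have mdir : measurable_fun setT (fun p : (borel V * LS) * RM => udir p.1.2 : borel V).
  exact: (measurableT_comp udir_measurable m12).
have mF : measurable_fun setT F.
  apply: emeasurable_funM; first exact: (measurableT_comp mBl m11).
  apply: (measurableT_comp mg); apply: measurable_fun_pair => //.
  exact: measurable_rVD.
have mF2 : measurable_fun setT F2.
  apply: emeasurable_funM; last by apply: (measurableT_comp mg); exact: measurable_fun_pair.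
  apply: (measurableT_comp mBl); apply: measurable_rVD => //.
  exact: measurable_rVN.
(* Every translate of the lines gives the same integral; averaging over y in the ball produces the
   factor [kappa]. *)
transitivity (\int[leb n.+1]_y \int[m]_E \int[lebesgue_measure]_t F ((y, E), t))%E.
  rewrite -leb_unit_ball -integral_indicT// -ge0_integralZr//; last first.
    by apply: integral_ge0 => E _; exact: integral_ge0.
  apply: eq_integral => y _; rewrite /F /=.
  pose Phi E := line_integral (fun x => g (x, udir E)) E.
  have Phi0 E : (0 <= Phi E)%E by apply: integral_ge0 => t _; exact: g0.
  have mPhi : measurable_fun [set: LS] (Phi : LS -> \bar R).
    apply: (@measurable_fun_fubini_tonelli_F _ _ LS RM R (@lebesgue_measure R)
        (fun p => g (foot p.1 + p.2 *: udir p.1, udir p.1)%R)) => //=.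
    apply: (measurableT_comp mg); apply: measurable_fun_pair.
      exact: line_point_measurable.
    by apply: (measurableT_comp udir_measurable); exact: measurable_fst.
  have inner E : (\int[lebesgue_measure]_t
      ((\1_B y)%:E * g (y + (foot E + t *: udir E), udir E)%R) =
      (\1_B y)%:E * Phi (motion y mulmx1_tr E))%E.
    have e := line_set_udir E; have := motion_rep y mulmx1_tr e; rewrite !mulmx1 => e'.
    rewrite ge0_integralZl; [|exact: measurableT| |by []|by rewrite lee_fin].
      congr (_ * _)%E.
      rewrite /Phi (line_integralE (mgl _) (fun x => g0 _) (udir_unit E) e').
      apply: eq_integral => t _; rewrite (gu _ _ _ _ (udir_unit E) e').
      by rewrite addrA [y + _]addrC.
    apply: (measurableT_comp (mgl (udir E))); apply: measurable_rVD; first exact: measurable_cst.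
    exact: line_param_measurable.
  under [RHS]eq_integral do rewrite inner.
  rewrite -(ge0_integral_motion y mulmx1_tr (@det1 _ _) mPhi Phi0).
  rewrite ge0_integralZl; [by []|exact: measurableT| |by []|by rewrite lee_fin].
  exact: measurableT_comp mPhi (motion_measurable _ _).
rewrite (tonelli3 m mF F0).
(* For a fixed line and parameter, shifting y by the point of the line moves that point out of g and
   into the indicator of the ball. *)
transitivity (\int[m]_E \int[lebesgue_measure]_t \int[leb n.+1]_y F2 ((y, E), t))%E.
  apply: eq_integral => E _; apply: eq_integral => t _.
  rewrite -(@ge0_integral_leb_shift _ _ (foot E + t *: udir E) (fun y => F2 ((y, E), t))).
  - by apply: eq_integral => y _; rewrite /F2 /F /= addrK.
  - apply: (measurableT_comp mF2 (g := fun y => ((y, E), t))).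
    apply: measurable_fun_pair; last exact: measurable_cst.
    by apply: measurable_fun_pair; [exact: measurable_id|exact: measurable_cst].
  - by move=> y; exact: (F20 ((y, E), t)).
rewrite -(tonelli3 m mF2 F20); apply: eq_integral => y _; rewrite /F2 /=.
pose Psi E := (chord E * g (y, udir E))%E.
have mPsi : measurable_fun [set: LS] (Psi : LS -> \bar R).
  apply: emeasurable_funM; first exact: measurable_EFin_line_integral.
  apply: (measurableT_comp mg); apply: measurable_fun_pair; first exact: measurable_cst.
  exact: udir_measurable.
have Psi0 E : (0 <= Psi E)%E.
  by apply: mule_ge0 => //; apply: integral_ge0 => t _; rewrite lee_fin.
(* Translating the line by - y recentres the ball at the origin; the ball is symmetric, so the
   integral over t becomes the chord. *)
rewrite -[RHS](ge0_integral_motion (- y) mulmx1_tr (@det1 _ _) mPsi Psi0).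
apply: eq_integral => E _.
have e := line_set_udir E; have := motion_rep (- y) mulmx1_tr e; rewrite !mulmx1 => e'.
have B0 (x : borel V) : (0 <= (\1_B x)%:E :> \bar R)%E by rewrite lee_fin.
rewrite /Psi /chord (line_integralE mBl B0 (udir_unit E) e').
rewrite ge0_integralZr; [|exact: measurableT| |by []|exact: g0]; last first.
  apply: (measurableT_comp mBl); apply: measurable_rVD; first exact: measurable_cst.
  by apply: measurable_rVN; exact: line_param_measurable.
rewrite (gu _ _ _ _ (udir_unit E) e'); congr (_ * _)%E; apply: eq_integral => t _.
rewrite !indicE; congr (_%:R%:E); congr nat_of_bool; apply/idP/idP; rewrite !inE /B /unit_ball /=;
  by rewrite enormBC addrAC.
Qed.

Lemma measurable_EFin_ball :
  measurable_fun setT (fun x : borel V => (\1_(@unit_ball R n.+1) x)%:E : \bar R).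
Proof. exact: (measurable_EFin_indic (@unit_ball_measurable R n.+1)). Qed.

Lemma chord_ge0 E : (0 <= chord E)%E.
Proof. by apply: integral_ge0 => t _; rewrite lee_fin. Qed.

Lemma chord_measurable : measurable_fun [set: LS] (chord : LS -> \bar R).
Proof.
apply: measurable_EFin_line_integral; first exact: measurable_EFin_ball.
by move=> x; rewrite lee_fin.
Qed.

Lemma chord_motion A (AA : A *m A^T = 1%:M) E : chord (motion 0 AA E) = chord E.
Proof.
have e := line_set_udir E; have := motion_rep 0 AA e; rewrite addr0 => e'.
rewrite /chord (line_integralE _ _ _ e').
- apply: eq_integral => t _; rewrite !indicE; congr (_%:R%:E); congr nat_of_bool.
  by apply/idP/idP; rewrite !inE /unit_ball /= !enorm_le1 scalemxAl -mulmxDl dotp_mulmx.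
- exact: measurable_EFin_ball.
- by move=> x; rewrite lee_fin.
- by rewrite dotp_mulmx// udir_unit.
Qed.

(** A point of the ball has component at most 1 along the unit direction, which confines t to an
    interval of length 2. *)
Lemma chord_le E : (chord E <= 2%:E * (\1_(hits (unit_ball n.+1)) E)%:E)%E.
Proof.
rewrite indicE; case: (boolP (E \in _)) => [_|/negP nE]; last first.
  rewrite mule0 /chord /line_integral integral0_eq// => t _.
  rewrite indicE memNset// => tB; apply: nE; rewrite inE.
  by exists (foot E + t *: udir E); split => //; rewrite line_set_udir; exists t.
rewrite mule1; pose a := - dotp (foot E) (udir E).
apply: (@le_trans _ _ (\int[lebesgue_measure]_t (\1_(`[a - 1, a + 1]%classic : set R) t)%:E)%E).
  apply: ge0_le_integral => //.
  - apply: (measurableT_comp measurable_EFin_ball).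
    exact: line_param_measurable.
  - exact: (@measurable_EFin_indic _ _ RM _ (measurable_itv _)).
  - move=> t _; rewrite lee_fin !indicE ler_nat; case: (boolP (foot E + t *: udir E \in _)) => // tB.
    rewrite mem_set//= in_itv/= -ler_distlC.
    move: tB; rewrite inE /unit_ball /= => tB; apply: le_trans tB.
    have := dotp_le (foot E + t *: udir E) (udir E).
    have u1 : enorm (udir E) = 1 by apply/enorm1; exact: udir_unit.
    by rewrite u1 mulr1 dotpDl dotpZl udir_unit mulr1 /a distrC opprK addrC.
rewrite integral_indicT; last exact: measurable_itv.
rewrite [X in (X <= _)%E]lebesgue_measure_itv /=.
by case: ifP => _; [rewrite -EFinD lee_fin; lra|rewrite lee_fin].
Qed.

Lemma integral_chord_lty : (\int[mu]_E chord E < +oo)%E.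
Proof.
have mH := hits_measurable unit_ball_compact.
apply: (@le_lt_trans _ _ (\int[mu]_E (2%:E * (\1_(hits (unit_ball n.+1)) E)%:E))%E).
  apply: ge0_le_integral => //.
  - by move=> E _; exact: chord_ge0.
  - exact: chord_measurable.
  - by apply: emeasurable_funM => //; exact: measurable_EFin_indic.
  - by move=> E _; exact: chord_le.
rewrite ge0_integralZl//; last exact: measurable_EFin_indic.
rewrite integral_indicT// lte_mul_pinfty//.
exact: (hits_lty unit_ball_compact).
Qed.

End measure.

End lines.

(** * Metric projection *)

Section continuity.
Context {R : realType} {n : nat} (T : topologicalType).

Lemma scale_continuous_at (a : T -> R) (f : T -> 'rV[R]_n.+1) (x : T) :
  {for x, continuous a} -> {for x, continuous f} ->
  {for x, continuous (fun y => a y *: f y)}.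
Proof.
move=> ca cf; apply: rV_continuous => i.
under [X in {for _, continuous X}]eq_fun do rewrite mxE.
by apply: cvgM => //; exact: coord_continuous_at.
Qed.

Lemma inv_continuous_at (a : T -> R) (x : T) : a x != 0 ->
  {for x, continuous a} -> {for x, continuous (fun y => (a y)^-1)}.
Proof. by move=> a0 ca; exact: cvgV. Qed.

Lemma continuous_of_bound (f g : T -> R) (x : T) : g x = 0 ->
  (forall y, `|f x - f y| <= g y) -> {for x, continuous g} -> {for x, continuous f}.
Proof.
move=> g0 fg /cvgrPdist_lt cg; apply/cvgrPdist_lt => e e0.
have := cg e e0; apply: filterS => y; rewrite g0 sub0r normrN => ge.
exact: le_lt_trans (fg y) (le_lt_trans (ler_norm _) ge).
Qed.

End continuity.

Section subgradient.
Context {R : realType}.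

(** The difference quotient lies between w(t) and w(t + h), so continuity of the chosen subgradient
    is enough for differentiability. *)
Lemma subgradient_derive (D w : R -> R) (t : R) :
  {for t, continuous D} -> {for t, continuous w} ->
  (forall s t, 0 < D t -> D t + (s - t) * w t <= D s) ->
  0 < D t -> is_derive t 1 D (w t).
Proof.
move=> cD cw0 sub D0.
have Dnear : \forall s \near t, 0 < D s.
  have /cvgrPdist_lt /(_ _ D0) := cD.
  apply: filterS => s; rewrite ltr_norml => /andP[_].
  by rewrite ltrBlDr ltrDl.
have cv : h^-1 *: (D (h + t) - D t) @[h --> 0^'] --> w t.
  apply/cvgrPdist_le => e e0.
  have /cvgrPdist_le /(_ e e0) cw := cw0.
  have H : \forall h \near (0 : R)^', 0 < D (h + t) /\ `|w t - w (h + t)| <= e.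
    have ct : (fun h : R => h + t) @ (0 : R)^' --> t.
      rewrite -[X in _ --> X]add0r; apply: cvgD; last exact: cvg_cst.
      exact: nbhs_dnbhs.
    exact: (ct _ (@filterI _ _ _ _ _ Dnear cw)).
  have H0 : \forall h \near (0 : R)^', h != 0 := @nbhs_dnbhs_neq R 0.
  move: H0; apply: filter_app; move: H; apply: filterS => h [Dh wh] h0.
  (* The subgradient inequality is used at both ends of the step, each tested at the other end. *)
  have s1 := sub (h + t) t D0.
  have s2 := sub t (h + t) Dh.
  rewrite addrK in s1; rewrite (_ : t - (h + t) = - h) in s2; last by ring.
  apply: le_trans wh; rewrite /GRing.scale /=.
  set q := h^-1 * _; have qE : D (h + t) - D t = h * q by rewrite /q mulrA divff// mul1r.
  have [hp|hn|h00] := ltgtP 0 h; last by rewrite -h00 eqxx in h0.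
  - have q1 : w t <= q by rewrite -(ler_pM2l hp) -qE; lra.
    have q2 : q <= w (h + t) by rewrite -(ler_pM2l hp) -qE; lra.
    by rewrite !ler0_norm; lra.
  - have q1 : q <= w t by rewrite -(ler_nM2l hn) -qE; lra.
    have q2 : w (h + t) <= q by rewrite -(ler_nM2l hn) -qE; lra.
    by rewrite !ger0_norm; lra.
have e1 : (fun h : R => h^-1 *: ((D \o shift t) (h *: 1) - D t)) =
          (fun h : R => h^-1 *: (D (h + t) - D t)).
  by apply/funext => h /=; rewrite [h%:A]mulr1.
split; first by apply/cvg_ex; exists (w t); rewrite e1.
by rewrite /derive e1; apply/cvg_lim.
Qed.

End subgradient.

Section metric_projection.
Context {R : realType} {n : nat} (K : set 'rV[R]_n.+1).
Hypotheses (cK : convex_body K) (K0 : K !=set0).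
Local Notation V := 'rV[R]_n.+1.
Local Notation RM := (measurableTypeR R).
Local Notation p := (metric_proj K).
Local Notation u := (outer_unit K).
Implicit Types x y v : V.

Lemma convex_segment x y (t : R) : 0 <= t <= 1 -> K x -> K y -> K (x + t *: (y - x)).
Proof.
move=> /andP[t0 t1] Kx Ky.
have h0 : 0 <= 1 - t by lra.
have h1 : 1 - t <= 1 by lra.
have := cK.2 x y (Itv01 h0 h1) (mem_set Kx) (mem_set Ky) => /set_mem.
move=> H; rewrite (_ : x + _ = (1 - t) *: x + (1 - (1 - t)) *: y); first exact: H.
by apply/rowP => i; rewrite !mxE; ring.
Qed.

Lemma metric_proj_spec x : K (p x) /\ forall y, K y -> enorm (x - p x) <= enorm (x - y).
Proof.
have [q Kq qmin] : exists2 q, q \in K & forall y, y \in K -> enorm (x - q) <= enorm (x - y).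
  apply: EVT_min_rV => //; first exact: cK.1.
  apply: continuous_subspaceT => y; apply: (continuous_comp (f := fun y : V => x - y)).
    by apply: continuousB => //; exact: cst_continuous.
  exact: enorm_continuous.
apply: (@getPex _ [set q | K q /\ forall y, K y -> enorm (x - q) <= enorm (x - y)]).
by exists q; split => [|y Ky]; [exact: set_mem|apply/qmin/mem_set].
Qed.

Lemma metric_proj_in x : K (p x). Proof. by have [] := metric_proj_spec x. Qed.

(** Minimality is tested along the segment from p x to y, where the term of first order decides the
    sign. *)
Lemma metric_proj_var x y : K y -> dotp (x - p x) (y - p x) <= 0.
Proof.
move=> Ky; have [Kp pmin] := metric_proj_spec x.
rewrite leNgt; apply/negP => d0.
pose d := dotp (x - p x) (y - p x); pose e := dotp (y - p x) (y - p x).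
have key (t : R) : 0 <= t <= 1 -> 2 * t * d <= t ^+ 2 * e.
  move=> t01; have := pmin _ (convex_segment t01 Kp Ky).
  rewrite -ler_sqr ?nnegrE ?enorm_ge0// !sqr_enorm opprD addrA.
  rewrite /d /e; move: (x - p x) (y - p x) => a b.
  by rewrite dotpBl !dotpBr !dotpZl !dotpZr (dotpC b a); lra.
have e0 : 0 < e.
  rewrite lt_def dotp_ge0 andbT; apply/eqP => e0; have := key 1.
  by rewrite e0 mulr0 ler01 lexx => /(_ isT); move: d0; rewrite -/d; lra.
(* For this t one has t e <= d, whereas [key] gives 2 d <= t e; with d > 0 this is a
   contradiction. *)
have t01 : 0 <= Num.min 1 (d / e) <= 1.
  by apply/andP; split; [rewrite le_min ler01 divr_ge0 ?ltW|rewrite ge_min lexx].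
have := key _ t01; set t := Num.min _ _ => h.
have t0 : 0 < t by rewrite lt_min ltr01 divr_gt0.
have : t * e <= d by rewrite -ler_pdivlMr// /t ge_min lexx orbT.
have {}h : 2 * d <= t * e by rewrite -(ler_pM2l t0); move: h; lra.
move: d0; rewrite -/d; lra.
Qed.

Lemma metric_proj_uniq x q : K q -> (forall y, K y -> dotp (x - q) (y - q) <= 0) -> p x = q.
Proof.
move=> Kq qv; have h1 := qv _ (metric_proj_in x); have h2 := metric_proj_var x Kq.
apply/eqP; rewrite -subr_eq0 -dotp_eq0; apply/eqP/le_anti; rewrite dotp_ge0 andbT.
have -> : dotp (p x - q) (p x - q) = dotp (x - q) (p x - q) + dotp (x - p x) (q - p x).
  rewrite -(opprB (p x) q) dotpNr -dotpBl; congr dotp.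
  by apply/rowP => i; rewrite !mxE; ring.
lra.
Qed.

Lemma metric_proj_id x : K x -> p x = x.
Proof.
by move=> Kx; apply: metric_proj_uniq => // y _; rewrite subrr dotp0l.
Qed.

(** The variational inequalities, each tested at the other projection, give <x - y, p x - p y> >= |p
    x - p y|^2, and Cauchy-Schwarz concludes. *)
Lemma metric_proj_lip x y : enorm (p x - p y) <= enorm (x - y).
Proof.
have h1 := metric_proj_var x (metric_proj_in y).
have h2 := metric_proj_var y (metric_proj_in x).
have [->|pp] := eqVneq (enorm (p x - p y)) 0; first exact: enorm_ge0.
have p0 : 0 < enorm (p x - p y) by rewrite lt_def pp enorm_ge0.
rewrite -(ler_pM2r p0) -expr2 sqr_enorm.
apply: le_trans (dotp_le _ _); apply: le_trans (ler_norm _).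
have -> : x - y = (x - p x) - (y - p y) + (p x - p y).
  by apply/rowP => i; rewrite !mxE; ring.
rewrite (dotpDl (x - p x - (y - p y))) (dotpBl (x - p x)) lerDr.
have h1' : 0 <= dotp (x - p x) (p x - p y) by rewrite -(opprB (p y)) dotpNr oppr_ge0.
by rewrite subr_ge0 (le_trans h2).
Qed.

Lemma metric_proj_continuous x : {for x, continuous p}.
Proof.
apply: rV_continuous => i; apply: (@continuous_of_bound _ _ _ (fun y : V => enorm (x - y))).
- by rewrite subrr enorm0.
- move=> y; rewrite (_ : _ - _ = (p x - p y) ord0 i); last by rewrite !mxE.
  exact: le_trans (coord_le_enorm _ _) (metric_proj_lip x y).
- apply: (continuous_comp (f := fun y : V => x - y)); last exact: enorm_continuous.
  by apply: continuousB => //; exact: cst_continuous.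
Qed.

Definition pdist x : R := enorm (x - p x).
Local Notation d := pdist.

Lemma pdist_ge0 x : 0 <= d x. Proof. exact: enorm_ge0. Qed.

Lemma pdist_eq0 x : d x = 0 <-> K x.
Proof.
split => [/eqP|Kx]; last by rewrite /pdist metric_proj_id// subrr enorm0.
by rewrite enorm_eq0 subr_eq0 => /eqP ->; exact: metric_proj_in.
Qed.

Lemma pdist_continuous : continuous d.
Proof.
move=> x; apply: (continuous_comp (f := fun y : V => y - p y)); last exact: enorm_continuous.
by apply: continuousB => //; exact: metric_proj_continuous.
Qed.

Lemma outer_unitE x : u x = (d x)^-1 *: (x - p x). Proof. by []. Qed.

Lemma outer_unit_unit x : 0 < d x -> dotp (u x) (u x) = 1.
Proof.
move=> d0; rewrite outer_unitE dotpZl dotpZr -sqr_enorm -/(d x).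
by field; rewrite gt_eqF.
Qed.

Lemma outer_unit_continuous x : 0 < d x -> {for x, continuous u}.
Proof.
move=> d0; apply: scale_continuous_at.
  by apply: inv_continuous_at; [rewrite gt_eqF|exact: pdist_continuous].
by apply: continuousB => //; exact: metric_proj_continuous.
Qed.

(** The hyperplane through p x orthogonal to u x supports K, so the distance to K is at least the
    signed distance to that hyperplane, which is affine in y. *)
Lemma pdist_subgradient x y : 0 < d x -> d x + dotp (y - x) (u x) <= d y.
Proof.
move=> d0; have u1 : enorm (u x) = 1 by apply/enorm1; exact: outer_unit_unit.
have := dotp_le (y - p y) (u x); rewrite u1 mulr1; apply: le_trans.
apply: le_trans (ler_norm _).
have -> : y - p y = (y - x) + (x - p x) - (p y - p x).
  by apply/rowP => i; rewrite !mxE; ring.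
rewrite (dotpBl (y - x + (x - p x))) (dotpDl (y - x)) [d x + _]addrC -addrA lerD2l.
have -> : dotp (x - p x) (u x) = d x.
  by rewrite outer_unitE dotpZr -sqr_enorm -/(d x); field; rewrite gt_eqF.
rewrite lerDl oppr_ge0 outer_unitE dotpZr dotpC pmulr_rle0 ?invr_gt0//.
exact/metric_proj_var/metric_proj_in.
Qed.

Lemma parallel_bodyE (eps : R) : 0 < eps -> parallel_body K eps = [set x | d x <= eps].
Proof.
move=> e0; apply/seteqP; split => x /=.
  move=> [y Ky [b b1 ->]]; have [_ /(_ _ Ky)] := metric_proj_spec (y + eps *: b).
  rewrite [y + _]addrC addrK enormZ gtr0_norm// => /le_trans; apply.
  by rewrite ger_pMr.
move=> dx; exists (p x); first exact: metric_proj_in.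
exists (eps^-1 *: (x - p x)); last by rewrite scalerA divff ?gt_eqF// scale1r addrC subrK.
by rewrite /unit_ball /= enormZ gtr0_norm ?invr_gt0// mulrC ler_pdivrMr// mul1r.
Qed.

Definition shell (eps : R) : set V := [set x | 0 < d x <= eps].

Lemma shellE (eps : R) : 0 < eps -> parallel_body K eps `\` K = shell eps.
Proof.
move=> e0; rewrite parallel_bodyE//; apply/seteqP; split => x /=.
  move=> [de nK]; rewrite /shell /= de andbT lt_def pdist_ge0 andbT.
  by apply/eqP => /pdist_eq0.
by move=> /andP[d0 ->]; split => // /pdist_eq0 d0'; rewrite d0' ltxx in d0.
Qed.

Section along_a_line.
Variables (x v : V).
Hypothesis v1 : dotp v v = 1.
Local Notation D t := (d (x + t *: v)).
Local Notation w t := (dotp (u (x + t *: v)) v).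

Lemma line_continuous (t : R) : {for t, continuous (fun t : R => x + t *: v)}.
Proof.
apply: rV_continuous => i; under [X in {for _, continuous X}]eq_fun do rewrite !mxE.
by apply: cvgD; [exact: cvg_cst|apply: cvgM; [exact: cvg_id|exact: cvg_cst]].
Qed.

Lemma line_dist_continuous (t : R) : {for t, continuous (fun t : R => D t)}.
Proof.
exact: (continuous_comp (line_continuous (t := t)) (@pdist_continuous (x + t *: v))).
Qed.

Lemma slope_continuous (t : R) : 0 < D t -> {for t, continuous (fun t : R => w t)}.
Proof.
move=> D0; apply: dotp_continuous; last exact: cst_continuous.
exact: (continuous_comp (line_continuous (t := t)) (outer_unit_continuous D0)).
Qed.

Lemma line_dist_subgradient (s t : R) : 0 < D t -> D t + (s - t) * w t <= D s.
Proof.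
move=> D0; apply: le_trans (pdist_subgradient (x + s *: v) D0).
rewrite lerD2l (_ : x + s *: v - _ = (s - t) *: v); last by apply/rowP => i; rewrite !mxE; ring.
by rewrite dotpZl dotpC.
Qed.

End along_a_line.

End metric_projection.

(** * The distance to a convex body along a line *)

Section slope.
Context {R : realType}.
Local Notation RM := (measurableTypeR R).
Local Notation mu := (@lebesgue_measure R).
Variables (D w : R -> R) (eps M : R).
Hypotheses (D0 : forall t, 0 <= D t) (cD : continuous D)
  (cw : forall t, 0 < D t -> {for t, continuous w})
  (sub : forall s t, 0 < D t -> D t + (s - t) * w t <= D s)
  (mw : measurable_fun [set: RM] (w : RM -> RM))
  (growth : forall t, `|t| <= D t + M) (eps0 : 0 < eps).

(** One half of the shell along the line, an interval by [rising_between]. The half on which the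
    distance decreases is the same set for the reversed line. *)
Definition rising : set R := [set t | 0 < D t <= eps /\ 0 < w t].

Lemma slope_nondecreasing s t : s <= t -> 0 < D s -> 0 < D t -> w s <= w t.
Proof.
move=> st Ds Dt; have [e|nst] := eqVneq s t; first by rewrite e.
have s1 := sub t Ds; have s2 := sub s Dt.
have ts : 0 < t - s by rewrite subr_gt0 lt_neqAle nst st.
by rewrite -(ler_pM2l ts); lra.
Qed.

Lemma rising_after s t : s <= t -> 0 < D s -> 0 < w s -> 0 < D t /\ 0 < w t.
Proof.
move=> st Ds ws; have s1 := sub t Ds.
have p1 : 0 <= (t - s) * w s by rewrite mulr_ge0 ?subr_ge0// ltW.
have Dt : 0 < D t by lra.
by split => //; apply: lt_le_trans ws _; exact: slope_nondecreasing.
Qed.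

Lemma rising_between r s t : r <= s <= t -> 0 < D r -> 0 < w r -> D t <= eps -> rising s.
Proof.
move=> /andP[rs st] Dr wr Dt; have [Ds ws] := rising_after rs Dr wr.
split => //; rewrite Ds /=; apply: le_trans Dt.
have s1 := sub t Ds.
have p1 : 0 <= (t - s) * w s by rewrite mulr_ge0 ?subr_ge0// ltW.
lra.
Qed.

Lemma rising_measurable : measurable (rising : set RM).
Proof.
have mD : measurable_fun [set: RM] (D : RM -> RM) by apply: continuous_measurable_fun.
rewrite (_ : rising = (D @^-1` `]0, eps]) `&` (w @^-1` `]0, +oo[)); last first.
  apply/seteqP; split => t /=; rewrite /rising /= !in_itv /=; first by move=> [-> ->].
  by rewrite andbT => -[-> ->].
apply: measurableI; rewrite -[X in measurable X]setTI; [exact: mD|exact: mw].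
Qed.

Lemma rising_integrand_measurable :
  measurable_fun [set: RM] (fun t => (w t * \1_rising t)%:E : \bar R).
Proof.
apply/measurable_EFinP; apply: measurable_funM => //.
by apply: measurable_indic; exact: rising_measurable.
Qed.

Lemma rising_integrand_ge0 t : (0 <= (w t * \1_rising t)%:E)%E.
Proof.
rewrite lee_fin indicE; have [/set_mem[_ w0]|_] := boolP (t \in rising).
  by rewrite mulr1 ltW.
by rewrite mulr0.
Qed.

Lemma integral_slope (a b : R) : a < b -> (forall t, a < t < b -> rising t) ->
  (\int[mu]_(t in `]a, b[) (w t * \1_rising t)%:E = (D b - D a)%:E)%E.
Proof.
move=> ab abr.
transitivity (\int[mu]_(t in `]a, b[) (w t)%:E)%E; last apply: (@ge0_FTC_oo _ w D a b (D a) (D b) ab).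
- apply: eq_integral => t; rewrite in_set_itv in_itv /= => tab.
  by rewrite indicE mem_set ?mulr1//; exact: abr.
- by move=> t /abr[_ /ltW].
- by move=> t /abr[/andP[Dt _] _]; exact: cw.
- by move=> t /abr[/andP[Dt _] _]; exact: (subgradient_derive (@cD t) (cw Dt) sub Dt).
- exact/cvg_at_right_filter/cD.
- exact/cvg_at_left_filter/cD.
Qed.

(** The set is an interval with ends a and b, and the integral over it is D b - D a, where D a >= 0
    and D b <= eps. *)
Lemma integral_rising_le : (\int[mu]_t (w t * \1_rising t)%:E <= eps%:E)%E.
Proof.
have [r0|/set0P[t0 t0r]] := eqVneq rising set0.
  rewrite integral0_eq ?lee_fin ?ltW// => t _.
  by rewrite r0 indic0 mulr0.
have rb t : rising t -> `|t| <= eps + M.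
  by move=> [/andP[_ h] _]; apply: le_trans (growth t) _; rewrite lerD2r.
have hi : has_inf rising.
  split; first by exists t0.
  by exists (- (eps + M)) => t /rb; rewrite ler_norml => /andP[].
have hs : has_sup rising.
  split; first by exists t0.
  by exists (eps + M) => t /rb; rewrite ler_norml => /andP[].
set a := inf rising; set b := sup rising.
have aS t : rising t -> a <= t <= b.
  by move=> rt; rewrite ge_inf ?sup_upper_bound//; [exact: hi.2].
have Sab t : a < t < b -> rising t.
  move=> /andP[/(inf_lt hi.1)[r [/andP[Dr _] wr] rt] /(sup_gt hs.1)[s [/andP[_ Ds] _] ts]].
  by apply: (@rising_between r t s) => //; rewrite !ltW.
(* The supremum need not be attained, so the bound passes to b by continuity. *)
have Db : D b <= eps.
  rewrite leNgt; apply/negP => Db; have /cvgrPdist_lt cb := @cD b.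
  have e0 : 0 < D b - eps by rewrite subr_gt0.
  have [e /= e1 H] := cb _ e0.
  have [t rt bt] := sup_adherent e1 hs.
  have := H t; rewrite /= => /(_ _); apply/not_implyP; split.
    have /andP[_ tb] := aS _ rt; rewrite ger0_norm ?subr_ge0//; rewrite -/b in bt; lra.
  have [/andP[_ Dt] _] := rt; apply/negP; rewrite -leNgt.
  by apply: le_trans (ler_norm _); rewrite lerD2l lerN2.
have mf := rising_integrand_measurable.
have -> : (\int[mu]_t (w t * \1_rising t)%:E = \int[mu]_(t in `[a, b]) (w t * \1_rising t)%:E)%E.
  rewrite [RHS]integral_mkcond; apply: eq_integral => t _; rewrite patchE.
  case: ifPn => // /negP nab; rewrite indicE memNset ?mulr0// => rt; apply: nab.
  by rewrite in_set_itv in_itv /= aS.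
rewrite integral_itv_bndoo; last exact: measurable_funS mf.
have [ab|ba] := ltP a b.
  rewrite integral_slope// lee_fin; have := D0 a; lra.
by rewrite set_itv_ge ?integral_set0 ?lee_fin ?ltW// bnd_simp -leNgt.
Qed.

(** An interval on which D grows from eta to eps contributes eps - eta. Starting at eta > 0 stays
    away from the zeros of D, where w carries no information. *)
Lemma integral_rising_ge (t0 : R) : D t0 = 0 ->
  (eps%:E <= \int[mu]_t (w t * \1_rising t)%:E)%E.
Proof.
move=> Dt0; apply/lee_subgt0Pr => eta eta0.
have [ee|ee] := leP eps eta.
  rewrite (@le_trans _ _ 0%E)//; first by rewrite -EFinB lee_fin; lra.
  by apply: integral_ge0 => t _; exact: rising_integrand_ge0.
have cDw x y : {within `[x, y], continuous D} by exact: continuous_subspaceT.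
(* Large enough for [growth] to give D T >= eps, and to the right of t0. *)
pose T := `|t0| + eps + `|M|.
have t0T : t0 <= T.
  by rewrite /T -addrA; apply: le_trans (ler_norm t0) _; rewrite lerDl addr_ge0// ltW.
have DT : eps <= D T.
  have h1 := growth T; have h2 := ler_norm T; have h3 := ler_norm M; have h4 := normr_ge0 t0.
  by move: h2; rewrite {1}/T; lra.
have [b bT Db] : exists2 b, b \in `[t0, T] & D b = eps.
  by apply: IVT => //; rewrite Dt0 ge_min le_max DT (ltW eps0) orbT.
have tb : t0 <= b by move: bT; rewrite in_itv /= => /andP[].
have [a aT Da] : exists2 a, a \in `[t0, b] & D a = eta.
  apply: IVT => //; rewrite Dt0 Db ge_min le_max (ltW eta0) (ltW ee) orbT//.
move: aT; rewrite in_itv /= => /andP[ta ab].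
(* The subgradient at a, tested at the zero t0 on its left, forces a positive slope. *)
have wa : 0 < w a.
  have Da0 : 0 < D a by rewrite Da.
  have s1 := sub t0 Da0; rewrite Dt0 in s1.
  have ta' : 0 < a - t0.
    by rewrite subr_gt0 lt_neqAle ta andbT; apply/eqP => e; rewrite -e Dt0 ltxx in Da0.
  rewrite ltNge; apply/negP => wa; have : (a - t0) * w a <= 0 by rewrite pmulr_rle0.
  lra.
have ab' : a < b.
  rewrite lt_neqAle ab andbT; apply/eqP => e.
  by move: ee; rewrite -Da -Db e ltxx.
have abr t : a < t < b -> rising t.
  move=> /andP[at_ tb']; apply: (@rising_between a t b); rewrite ?Da ?Db//.
  by rewrite !ltW.
have := integral_slope ab' abr; rewrite Db Da EFinB => <-.
apply: ge0_subset_integral => //; first exact: rising_integrand_measurable.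
by move=> t _; exact: rising_integrand_ge0.
Qed.

End slope.

Section slope_abs.
Context {R : realType}.
Local Notation RM := (measurableTypeR R).
Local Notation mu := (@lebesgue_measure R).
Variables (D w : R -> R) (eps M : R).
Hypotheses (D0 : forall t, 0 <= D t) (cD : continuous D)
  (cw : forall t, 0 < D t -> {for t, continuous w})
  (sub : forall s t, 0 < D t -> D t + (s - t) * w t <= D s)
  (mw : measurable_fun [set: RM] (w : RM -> RM))
  (growth : forall t, `|t| <= D t + M) (eps0 : 0 < eps).
Let D' t := D (- t).
Let w' t := - w (- t).

Let D0' t : 0 <= D' t. Proof. exact: D0. Qed.
Let cD' : continuous D'.
Proof. by move=> t; apply: (continuous_comp (f := -%R)); [exact: opp_continuous|exact: cD]. Qed.
Let cw' t : 0 < D' t -> {for t, continuous w'}.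
Proof.
move=> Dt; apply: continuousN; apply: (continuous_comp (f := -%R)); first exact: opp_continuous.
exact: cw.
Qed.
Let sub' s t : 0 < D' t -> D' t + (s - t) * w' t <= D' s.
Proof. by move=> /(sub (- s)); rewrite /w' /D'; set a := w _; lra. Qed.
Let mw' : measurable_fun [set: RM] (w' : RM -> RM).
Proof.
apply: measurable_funN; apply: (measurableT_comp mw).
exact: (measurable_funN (@measurable_id _ RM setT)).
Qed.
Let growth' t : `|t| <= D' t + M. Proof. by rewrite -normrN. Qed.

(** Points of the shell with w = 0 belong to neither half, but the integrand vanishes there. *)
Lemma abs_slopeE : (\int[mu]_t (`|w t| * \1_[set t | 0 < D t <= eps] t)%:E =
  \int[mu]_t (w t * \1_(rising D w eps) t)%:E +
  \int[mu]_t (w' t * \1_(rising D' w' eps) t)%:E)%E.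
Proof.
have m1 := rising_integrand_measurable eps cD mw.
have m2 := rising_integrand_measurable eps cD' mw'.
rewrite -[X in (_ = _ + X)%E](ge0_integral_opp m2); last exact: rising_integrand_ge0.
rewrite -ge0_integralD//; [|by move=> t _; exact: rising_integrand_ge0..|]; last first.
  apply: (measurableT_comp m2); exact: (measurable_funN (@measurable_id _ RM setT)).
apply: eq_integral => t _; rewrite -EFinD; congr EFin; rewrite !indicE /w' opprK.
have r1 : (t \in rising D w eps) = (0 < D t <= eps) && (0 < w t).
  by apply/idP/idP => [/set_mem[-> ->]//|/andP[? ?]]; exact/mem_set.
have r2 : (- t \in rising D' w' eps) = (0 < D t <= eps) && (w t < 0).
  apply/idP/idP => [/set_mem[]|/andP[? ?]].
    by rewrite /D' /w' opprK oppr_gt0 => -> ->.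
  by apply/mem_set; split; rewrite /D' /w' opprK ?oppr_gt0.
have r3 : (t \in [set t | 0 < D t <= eps]) = (0 < D t <= eps).
  by apply/idP/idP => [/set_mem|/mem_set].
rewrite r1 r2 r3; case: (0 < D t <= eps); rewrite /= ?mulr0 ?addr0// mulr1.
have [wp|wn|<-] := ltgtP 0 (w t); last by rewrite normr0 !mul0r oppr0 mul0r addr0.
  by rewrite gtr0_norm// mulr1 mulr0 addr0.
by rewrite ltr0_norm// mulr1 mulr0 add0r.
Qed.

Lemma integral_abs_slope_le :
  (\int[mu]_t (`|w t| * \1_[set t | 0 < D t <= eps] t)%:E <= (2 * eps)%:E)%E.
Proof.
rewrite abs_slopeE mulr_natl mulr2n EFinD; apply: leeD.
  exact: (integral_rising_le D0 cD cw sub mw growth eps0).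
exact: (integral_rising_le D0' cD' cw' sub' mw' growth' eps0).
Qed.

Lemma integral_abs_slope_ge (t0 : R) : D t0 = 0 ->
  ((2 * eps)%:E <= \int[mu]_t (`|w t| * \1_[set t | 0 < D t <= eps] t)%:E)%E.
Proof.
move=> Dt0; rewrite abs_slopeE mulr_natl mulr2n EFinD; apply: leeD.
  exact: (integral_rising_ge cD cw sub mw growth eps0 Dt0).
apply: (integral_rising_ge cD' cw' sub' mw' growth' eps0 (t0 := - t0)).
by rewrite /D' opprK.
Qed.

End slope_abs.

(** * The Crofton formula *)

Lemma measurable_dotp {R : realType} n d (X : measurableType d) (f g : X -> borel 'rV[R]_n) :
  measurable_fun setT f -> measurable_fun setT g ->
  measurable_fun setT (fun x => dotp (f x : 'rV[R]_n) (g x : 'rV[R]_n)).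
Proof.
move=> mf mg; rewrite /dotp; apply: measurable_sum => i.
apply: measurable_funM; first exact: (measurableT_comp (coord_measurable i) mf).
exact: (measurableT_comp (coord_measurable i) mg).
Qed.

Lemma compact_enorm_bound {R : realType} n (K : set 'rV[R]_n.+1) : compact K ->
  exists B, forall y, K y -> enorm y <= B.
Proof.
move=> cK; have [->|/set0P K0] := eqVneq K set0; first by exists 0.
have cn : {within K, continuous (@enorm R n.+1)}.
  by apply: continuous_subspaceT => y; exact: enorm_continuous.
have [c _ H] := EVT_max_rV K0 cK cn.
by exists (enorm c) => y Ky; apply/H/mem_set.
Qed.

Section crofton.
Context {R : realType} {n : nat} (K : set 'rV[R]_n.+1).
Hypotheses (cK : convex_body K) (K0 : K !=set0).
Local Notation V := 'rV[R]_n.+1.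
Local Notation RM := (measurableTypeR R).
Local Notation LS := (@line_space R n).
Local Notation p := (metric_proj K).
Local Notation u := (outer_unit K).
Local Notation d := (pdist K).

Lemma pdist_measurable : measurable_fun [set: borel V] (d : borel V -> R).
Proof. by apply: continuous_borelR; exact: pdist_continuous. Qed.

Lemma metric_proj_measurable : measurable_fun [set: borel V] (p : borel V -> borel V).
Proof. by apply: continuous_borel => x; exact: metric_proj_continuous. Qed.

Lemma outer_unit_measurable : measurable_fun [set: borel V] (u : borel V -> borel V).
Proof.
(* A real power is a measurable function, and x^(-1) agrees with the inverse for x >= 0, including
   the value 0 at 0, which is taken on K. *)
have -> : (u : borel V -> borel V) = fun x : borel V => d x `^ (-1) *: (x - p x).
  by apply/funext => x; rewrite powR_inv1 ?pdist_ge0.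
apply: measurable_rVZ; first exact: (measurableT_comp (measurable_powR (-1)) pdist_measurable).
apply: measurable_rVD; first exact: measurable_id.
by apply: measurable_rVN; exact: metric_proj_measurable.
Qed.

Lemma shell_measurable eps : measurable (shell K eps : set (borel V)).
Proof.
rewrite (_ : shell K eps = d @^-1` `]0, eps]); last first.
  by apply/seteqP; split => x /=; rewrite in_itv.
by rewrite -[X in measurable X]setTI; apply: pdist_measurable.
Qed.

(** K is bounded, so the distance grows like |t| up to a constant. This confines the part of the
    line near K to a bounded interval. *)
Lemma pdist_growth x v : dotp v v = 1 -> exists M, forall t, `|t| <= d (x + t *: v) + M.
Proof.
move=> v1; have [B HB] := compact_enorm_bound cK.1; exists (B + enorm x) => t.
have -> : `|t| = enorm (t *: v) by rewrite enormZ (_ : enorm v = 1) ?mulr1//; exact/enorm1.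
set y := x + t *: v; have -> : t *: v = (y - p y) + (p y - x).
  by apply/rowP => i; rewrite /y !mxE; ring.
apply: le_trans (enormD _ _) _; rewrite lerD2l; apply: le_trans (enormD _ _) _.
rewrite enormN lerD2r; apply: HB; exact: (metric_proj_in cK K0).
Qed.

Definition shell_slope eps (v : V) (x : V) : R := `|dotp (u x) v| * \1_(shell K eps) x.

Lemma shell_slope_ge0 eps v x : 0 <= shell_slope eps v x.
Proof. by rewrite mulr_ge0. Qed.

Section line.
Variables (eps : R) (x v : V).
Hypotheses (eps0 : 0 < eps) (v1 : dotp v v = 1).
Let D (t : R) := d (x + t *: v).
Let w (t : R) := dotp (u (x + t *: v)) v.
Let D0 t : 0 <= D t. Proof. exact: pdist_ge0. Qed.
Let cD : continuous D. Proof. by move=> t; exact: line_dist_continuous. Qed.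
Let cw t : 0 < D t -> {for t, continuous w}. Proof. exact: slope_continuous. Qed.
Let sub s t : 0 < D t -> D t + (s - t) * w t <= D s.
Proof. exact: line_dist_subgradient. Qed.
Let mw : measurable_fun [set: RM] (w : RM -> RM).
Proof.
apply: measurable_dotp; last exact: measurable_cst.
exact: (measurableT_comp outer_unit_measurable (@line_param_measurable _ _ x v)).
Qed.

Let slopeE t : (shell_slope eps v (x + t *: v))%:E = (`|w t| * \1_[set t | 0 < D t <= eps] t)%:E.
Proof.
congr EFin; congr (_ * _); rewrite !indicE; congr (_%:R); congr nat_of_bool.
Qed.

Lemma shell_slope_le : (\int[lebesgue_measure]_t (shell_slope eps v (x + t *: v))%:E <= (2 * eps)%:E)%E.
Proof.
have [M growth] := pdist_growth x v1; under eq_integral do rewrite slopeE.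
exact: (integral_abs_slope_le D0 cD cw sub mw growth eps0).
Qed.

Lemma shell_slope_ge : line_through x v `&` K !=set0 ->
  ((2 * eps)%:E <= \int[lebesgue_measure]_t (shell_slope eps v (x + t *: v))%:E)%E.
Proof.
move=> [_ [[t0 ->] Kt0]]; have [M growth] := pdist_growth x v1.
under eq_integral do rewrite slopeE.
apply: (integral_abs_slope_ge cD cw sub mw growth eps0 (t0 := t0)).
exact/pdist_eq0.
Qed.

Lemma shell_slope_eq0 : ~ (line_through x v `&` parallel_body K eps !=set0) ->
  (\int[lebesgue_measure]_t (shell_slope eps v (x + t *: v))%:E = 0)%E.
Proof.
move=> nh; apply: integral0_eq => t _; rewrite /shell_slope indicE memNset ?mulr0//.
move=> /andP[_ h]; apply: nh; exists (x + t *: v); split; first by exists t.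
by rewrite parallel_bodyE.
Qed.
End line.

Lemma shell_slope_measurable eps v :
  measurable_fun [set: borel V] (shell_slope eps v : borel V -> R).
Proof.
apply: measurable_funM; last by apply: measurable_indic; exact: shell_measurable.
apply: (measurableT_comp (@normr_measurable R setT)).
by apply: measurable_dotp; [exact: outer_unit_measurable|exact: measurable_cst].
Qed.

Lemma line_integral_shell_ge eps E : 0 < eps ->
  ((2 * eps)%:E * (\1_(hits K) E)%:E <= line_integral (fun x => (shell_slope eps (udir E) x)%:E) E)%E.
Proof.
move=> eps0; rewrite indicE; case: (boolP (E \in hits K)) => [/set_mem hE|_]; last first.
  by rewrite mule0 integral_ge0// => t _; rewrite lee_fin shell_slope_ge0.
rewrite mule1; apply: shell_slope_ge => //; first exact: udir_unit.
by rewrite -line_set_udir.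
Qed.

Lemma line_integral_shell_le eps E : 0 < eps ->
  (line_integral (fun x => (shell_slope eps (udir E) x)%:E) E <=
   (2 * eps)%:E * (\1_(hits (parallel_body K eps)) E)%:E)%E.
Proof.
move=> eps0; rewrite indicE; case: (boolP (E \in _)) => [_|nE].
  by rewrite mule1; apply: shell_slope_le => //; exact: udir_unit.
rewrite mule0 /line_integral shell_slope_eq0// => hE; move/negP: nE; apply.
by apply/mem_set; rewrite /hits /= line_set_udir.
Qed.

End crofton.

Section shell_inequality.
Context {R : realType} {n : nat} (K : set 'rV[R]_n.+1).
Hypotheses (cK : convex_body K) (K0 : K !=set0).
Variables (mu : {measure set (@line_space R n) -> \bar R}) (Hmu : is_line_measure mu).
Local Notation V := 'rV[R]_n.+1.
Local Notation LS := (@line_space R n).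
Local Notation RM := (measurableTypeR R).
Variable phi : borel V -> R.
Hypotheses (mphi : measurable_fun setT phi) (phi0 : forall v, 0 <= phi v)
  (phiN : forall v, phi (- v) = phi v).

(** A cosine transform: the function H of the overview, as an integral over lines with the chord
    weight. [cosineE] makes it real. *)
Definition cosine (w : V) : \bar R :=
  (\int[mu]_E (chord E * (`|dotp w (udir E)| * phi (udir E))%:E))%E.

Lemma cosine_ge0 w : (0 <= cosine w)%E.
Proof. by apply: integral_ge0 => E _; rewrite mule_ge0 ?chord_ge0// lee_fin mulr_ge0. Qed.

Lemma cosine_integrand_measurable : measurable_fun [set: borel V * LS]
  (fun q : borel V * LS => chord q.2 * (`|dotp (q.1 : V) (udir q.2)| * phi (udir q.2))%:E)%E.
Proof.
have m2 : measurable_fun [set: borel V * LS] (fun q : borel V * LS => udir q.2 : borel V).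
  exact: (measurableT_comp udir_measurable measurable_snd).
apply: emeasurable_funM; first exact: (measurableT_comp chord_measurable measurable_snd).
apply/measurable_EFinP; apply: measurable_funM; last exact: (measurableT_comp mphi m2).
apply: (measurableT_comp (@normr_measurable R setT)).
by apply: measurable_dotp => //; exact: measurable_fst.
Qed.

Lemma cosine_measurable : measurable_fun [set: borel V] (cosine : borel V -> \bar R).
Proof.
pose m : {sigma_finite_measure set LS -> \bar R} := sigma_finite_copy (mu_sigma_finite Hmu).
apply: (@measurable_fun_fubini_tonelli_F _ _ (borel V) LS R m _ cosine_integrand_measurable).
by move=> q; rewrite mule_ge0 ?chord_ge0// lee_fin mulr_ge0.
Qed.

(** [disintegration] for phi(v) |<u(x), v>| on the shell: with x fixed, the integral over the lines
    depends on x only through the normal u(x). *)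
Lemma shell_disintegration eps :
  ((kappa n.+1)%:E * \int[mu]_E ((phi (udir E))%:E *
     line_integral (fun x => (shell_slope K eps (udir E) x)%:E) E) =
   \int[leb n.+1]_(y in shell K eps) cosine (outer_unit K y))%E.
Proof.
pose g (q : borel V * borel V) : \bar R := (phi q.2 * shell_slope K eps q.2 q.1)%:E.
have g0 q : (0 <= g q)%E by rewrite lee_fin mulr_ge0// shell_slope_ge0.
have mg : measurable_fun setT g.
  apply/measurable_EFinP; apply: measurable_funM; first exact: (measurableT_comp mphi measurable_snd).
  apply: measurable_funM.
    apply: (measurableT_comp (@normr_measurable R setT)).
    apply: measurable_dotp; last exact: measurable_snd.
    exact: (measurableT_comp (outer_unit_measurable cK K0) measurable_fst).
  have mI := measurable_indic (R := R) (shell_measurable cK K0 eps).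
  exact: (measurableT_comp (mI setT) measurable_fst).
have gN x v : g (x, - v) = g (x, v) by rewrite /g /= phiN /shell_slope dotpNr normrN.
transitivity ((kappa n.+1)%:E * \int[mu]_E line_integral (fun x => g (x, udir E)) E)%E.
  congr (_ * _)%E; apply: eq_integral => E _; rewrite /line_integral -ge0_integralZl//.
  - apply/measurable_EFinP.
    exact: (measurableT_comp (shell_slope_measurable cK K0 eps (udir E)) (@line_param_measurable _ _ _ _)).
  - by move=> t _; rewrite lee_fin shell_slope_ge0.
  - by rewrite lee_fin.
apply: etrans (disintegration Hmu mg g0 gN) _.
rewrite [RHS]integral_mkcond; apply: eq_integral => y _; rewrite patchE.
rewrite /g /shell_slope /=; case: (boolP (y \in _)) => ys; rewrite indicE ?ys ?(negPf ys).
  by apply: eq_integral => E _; rewrite mulr1 mulrC.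
by apply: integral0_eq => E _; rewrite !mulr0 mule0.
Qed.

Definition hit_integral (C : set V) : \bar R :=
  (\int[mu]_E ((phi (udir E))%:E * (\1_(hits C) E)%:E))%E.

Lemma parallel_body_compact eps : 0 < eps -> compact (parallel_body K eps).
Proof.
move=> eps0; have [B HB] := compact_enorm_bound cK.1.
rewrite parallel_bodyE//.
apply: (@subclosed_compact _ _ (cball 0 (B + eps))).
- rewrite (_ : [set x | _] = pdist K @^-1` [set r | r <= eps])//.
  by apply: preimage_closed; [move=> x _; exact: pdist_continuous|exact: closed_le].
- exact: closed_ball_compact.
- move=> x /= dx; rewrite /cball /= subr0.
  have -> : x = metric_proj K x + (x - metric_proj K x) by rewrite addrC subrK.
  apply: le_trans (enormD _ _) _; apply: lerD => //; apply: HB.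
  exact: (metric_proj_in cK K0).
Qed.

Lemma shell_hits_le eps : 0 < eps ->
  ((2 * eps * kappa n.+1)%:E * hit_integral K <=
   \int[leb n.+1]_(y in shell K eps) cosine (outer_unit K y) <=
   (2 * eps * kappa n.+1)%:E * hit_integral (parallel_body K eps))%E.
Proof.
move=> eps0; have mK := hits_measurable cK.1.
have mP := hits_measurable (parallel_body_compact eps0).
have mphiu : measurable_fun [set: LS] (fun E : LS => (phi (udir E))%:E).
  by apply/measurable_EFinP; exact: (measurableT_comp mphi udir_measurable).
have mh (C : set V) : measurable (hits C) ->
    measurable_fun [set: LS] (fun E : LS => (phi (udir E))%:E * (\1_(hits C) E)%:E)%E.
  by move=> mC; apply: emeasurable_funM => //; exact: measurable_EFin_indic.
have mL : measurable_fun [set: LS] (fun E : LS => (phi (udir E))%:E *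
     line_integral (fun x => (shell_slope K eps (udir E) x)%:E) E)%E.
  apply: emeasurable_funM => //.
  apply: (@measurable_fun_fubini_tonelli_F _ _ LS RM R (@lebesgue_measure R)
    (fun q => (shell_slope K eps (udir q.1) (foot q.1 + q.2 *: udir q.1))%:E)) => [|q].
    apply/measurable_EFinP; apply: measurable_funM.
      apply: (measurableT_comp (@normr_measurable R setT)); apply: measurable_dotp.
        exact: (measurableT_comp (outer_unit_measurable cK K0) (@line_point_measurable R n)).
      exact: (measurableT_comp udir_measurable measurable_fst).
    have mI := measurable_indic (R := R) (shell_measurable cK K0 eps).
    exact: (measurableT_comp (mI setT) (@line_point_measurable R n)).
  by rewrite lee_fin shell_slope_ge0.
have k0 : (0 <= (kappa n.+1)%:E :> \bar R)%E by rewrite lee_fin ltW// kappa_gt0.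
have e0 : (0 <= (2 * eps)%:E :> \bar R)%E by rewrite lee_fin mulr_ge0// ltW.
have E2 C : measurable (hits C) -> ((2 * eps * kappa n.+1)%:E * hit_integral C =
    (kappa n.+1)%:E * \int[mu]_E ((phi (udir E))%:E * ((2 * eps)%:E * (\1_(hits C) E)%:E)))%E.
  move=> mC; rewrite mulrC EFinM -muleA; congr (_ * _)%E.
  rewrite -ge0_integralZl//; [|exact: mh|by move=> E _; rewrite mule_ge0// lee_fin].
  by apply: eq_integral => E _; rewrite muleCA.
rewrite -shell_disintegration !E2//; apply/andP; split; apply: lee_wpmul2l => //;
  apply: ge0_le_integral => //.
- by move=> E _; rewrite !mule_ge0// lee_fin.
- apply: emeasurable_funM => //; apply: emeasurable_funM => //; exact: measurable_EFin_indic.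
- by move=> E _; apply: lee_wpmul2l; [rewrite lee_fin|exact: line_integral_shell_ge].
- move=> E _; rewrite mule_ge0 ?lee_fin// integral_ge0// => t _.
  by rewrite lee_fin shell_slope_ge0.
- apply: emeasurable_funM => //; apply: emeasurable_funM => //; exact: measurable_EFin_indic.
- by move=> E _; apply: lee_wpmul2l; [rewrite lee_fin|exact: line_integral_shell_le].
Qed.

End shell_inequality.

Lemma ge0_integral_preserved_on (R : realType) d d' (X : measurableType d) (Y : measurableType d')
    (mu : {measure set X -> \bar R}) (nu : {measure set Y -> \bar R}) (S : set X)
    (phi : X -> Y) (f : Y -> \bar R) :
  measurable S -> measurable_fun setT phi ->
  (forall A, measurable A -> mu (S `&` phi @^-1` A) = nu A) ->
  measurable_fun setT f -> (forall y, 0 <= f y)%E ->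
  (\int[mu]_(x in S) f (phi x) = \int[nu]_y f y)%E.
Proof.
move=> mS mphi H mf f0.
have mfphi : measurable_fun setT (fun x => f (phi x)) by exact: measurableT_comp mf mphi.
pose m : {measure set X -> \bar R} := mrestr mu mS.
rewrite -(@ge0_integral_preserved _ _ _ _ _ m nu phi f mphi _ mf f0); last first.
  by move=> A mA; rewrite /m /= /mrestr setIC H.
rewrite -(setUv S) ge0_integral_setU//=; first last.
- by rewrite disj_set2E setICr.
- exact: measurable_funS mfphi.
- exact: measurableC.
rewrite [X in (_ + X)%E](_ : _ = 0%E) ?adde0; last first.
  rewrite (eq_measure_integral mzero) ?integral_measure_zero// => A mA AS.
  by rewrite /m /= /mrestr (_ : A `&` S = set0) ?measure0//; apply/seteqP; split => // x [/AS].
apply: eq_measure_integral => A mA AS.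
by rewrite /m /= /mrestr (setIidl AS).
Qed.

(** * From the Steiner formula to the top support measure *)

Section Steiner.
Context {R : realType} {n : nat}.
Local Notation V := 'rV[R]_n.+1.
Variables (Lambda : nat -> set V -> {measure set (@support_space R n.+1) -> \bar R}).
Hypothesis HLambda : is_support_measures Lambda.
Local Notation d := n.+1.

Definition steiner_coef (eps : R) (k : nat) : R := eps ^+ (d - k) * kappa (d - k).

Lemma steiner_coef_ge0 eps k : 0 <= eps -> (0 <= steiner_coef eps k).
Proof. by move=> e0; rewrite mulr_ge0 ?exprn_ge0// ltW// kappa_gt0. Qed.

Lemma snd_borel_measurable : measurable_fun [set: @support_space R d] (snd : @support_space R d -> borel V).
Proof. apply: measurable_fun_borel => U oU; apply: sub_sigma_algebra.
by apply: open_comp => // -[x v] _; exact: cvg_snd. Qed.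

(** Carries the Steiner formula from sets to functions of the normal: the image of Lebesgue measure
    on the shell under [outer_unit] is a combination of the images of the support measures under
    [snd]. *)
Lemma steiner_normals (K : set V) (eps : R) (H : borel V -> \bar R) :
  convex_body K -> K !=set0 -> 0 < eps ->
  measurable_fun setT H -> (forall w, 0 <= H w)%E ->
  (\int[leb d]_(y in shell K eps) H (outer_unit K y) =
   \sum_(k < d) (steiner_coef eps k)%:E * \int[Lambda k K]_xu H xu.2)%E.
Proof.
move=> cK K0 eps0 mH H0.
have /choice[nu nuE] : forall k, exists nu : {measure set (borel V) -> \bar R},
    forall A, nu A = Lambda k K (snd @^-1` A).
  by move=> k; exact: (pushforward_measureE (Lambda k K) snd_borel_measurable).
pose c k : {nonneg R} := NngNum (steiner_coef_ge0 k (ltW eps0)).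
pose m : {measure set (borel V) -> \bar R} := msum (fun k => mscale (c k) (nu k)) d.
transitivity (\int[m]_w H w)%E.
  apply: (ge0_integral_preserved_on (shell_measurable cK K0 eps) (outer_unit_measurable cK K0)) => //.
  move=> A mA; have mA2 : measurable (snd @^-1` A : set (@support_space R d)).
    by rewrite -[X in measurable X]setTI; exact: snd_borel_measurable.
  have := HLambda.1 K cK K0 eps eps0 _ mA2; rewrite shellE// => E.
  apply: etrans (lebE _) _.
    apply: measurableI; first exact: shell_measurable.
    by rewrite -[X in measurable X]setTI; exact: outer_unit_measurable.
  apply: etrans E _; apply: eq_bigr => k _; rewrite -/(steiner_coef eps k).
  congr (_ * _)%E; exact/esym/nuE.
rewrite ge0_integral_measure_sum//; apply: eq_bigr => k _.
rewrite ge0_integral_mscale//; congr (_ * _)%E.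
apply/esym; apply: (ge0_integral_preserved snd_borel_measurable _ mH H0) => A mA.
exact/esym/nuE.
Qed.

End Steiner.

Section crofton_cosine.
Context {R : realType} {n : nat}.
Local Notation V := 'rV[R]_n.+1.
Local Notation LS := (@line_space R n).
Local Notation d := n.+1.
Local Notation SC := (@steiner_coef R n).
Variables (Lambda : nat -> set V -> {measure set (@support_space R n.+1) -> \bar R}).
Hypothesis HLambda : is_support_measures Lambda.
Variables (mu : {measure set LS -> \bar R}) (Hmu : is_line_measure mu).
Variables (phi : borel V -> R) (C : R).
Hypotheses (mphi : measurable_fun setT phi) (phi0 : forall v, 0 <= phi v)
  (phiN : forall v, phi (- v) = phi v) (phiC : forall v, dotp (v : V) v = 1 -> phi v <= C).
Variable K : set V.
Hypotheses (cK : convex_body K) (K0 : K !=set0).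
Local Notation hit := (hit_integral mu phi).
Local Notation cosine := (cosine mu phi).

Let mphiu : measurable_fun [set: LS] (fun E : LS => (phi (udir E))%:E).
Proof. by apply/measurable_EFinP; exact: (measurableT_comp mphi udir_measurable). Qed.

Let mh (D : set V) : compact D ->
  measurable_fun [set: LS] (fun E : LS => (phi (udir E))%:E * (\1_(hits D) E)%:E)%E.
Proof.
by move=> cD; apply: emeasurable_funM => //; apply: measurable_EFin_indic; exact: hits_measurable.
Qed.

Let hit_ge0 (D : set V) : (0 <= hit D)%E.
Proof. by apply: integral_ge0 => E _; rewrite mule_ge0// lee_fin. Qed.

Let hit_lty (D : set V) : compact D -> (hit D < +oo)%E.
Proof.
move=> cD; have mD := hits_measurable cD.
apply: (@le_lt_trans _ _ (\int[mu]_E (C%:E * (\1_(hits D) E)%:E))%E).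
  apply: ge0_le_integral => //.
  - by move=> E _; rewrite mule_ge0// lee_fin.
  - exact: mh.
  - apply: emeasurable_funM; [exact: measurable_cst|exact: measurable_EFin_indic].
  - by move=> E _; rewrite lee_wpmul2r ?lee_fin// phiC// udir_unit.
have C0 : 0 <= C.
  have u1 := udir_unit (point : LS); exact: le_trans (phi0 _) (phiC u1).
rewrite ge0_integralZl//; last exact: measurable_EFin_indic.
rewrite integral_indicT//; apply: lte_mul_pinfty; rewrite ?lee_fin//.
exact: hits_lty.
Qed.

Let Kk (k : nat) := parallel_body K k.+1%:R^-1.

Let k0 (k : nat) : 0 < k.+1%:R^-1 :> R. Proof. by rewrite invr_gt0. Qed.

Let cKk k : compact (Kk k). Proof. exact: parallel_body_compact. Qed.

Let KkK k : K `<=` Kk k.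
Proof. by move=> y Ky; rewrite /Kk parallel_bodyE//= ((pdist_eq0 cK K0 y).2 Ky) ltW. Qed.

Let Kk0 k : Kk k `<=` Kk 0.
Proof.
rewrite /Kk !parallel_bodyE// => y /= h; apply: le_trans h _.
by rewrite invr1 invf_le1// ler1n.
Qed.

Let Kk_anti j k : (j <= k)%N -> Kk k `<=` Kk j.
Proof.
rewrite /Kk !parallel_bodyE// => jk y /= h; apply: le_trans h _.
by rewrite lef_pV2 ?posrE// ler_nat.
Qed.

(** By [growth] the points near K stay in a compact interval of parameters, on which the distance
    attains its minimum; that minimum is at most every 1/(k + 1). *)
Let hits_lim E : (forall k, hits (Kk k) E) -> hits K E.
Proof.
move=> hk; set x := foot E; set v := udir E; have v1 : dotp v v = 1 by exact: udir_unit.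
have [M growth] := pdist_growth cK K0 x v1.
have pt k : exists t, `|t| <= `|M| + 1 /\ pdist K (x + t *: v) <= k.+1%:R^-1.
  have [y [Ey Ky]] := hk k; move: Ey; rewrite line_set_udir => -[t e]; exists t.
  have h1 : pdist K (x + t *: v) <= k.+1%:R^-1 by rewrite -e; move: Ky; rewrite /Kk parallel_bodyE.
  have h2 : pdist K (x + t *: v) <= 1.
    by rewrite -e; move: (Kk0 Ky); rewrite /Kk parallel_bodyE// invr1.
  split; last exact: h1.
  by apply: le_trans (growth t) _; have := ler_norm M; lra.
have cD : {within `[- (`|M| + 1), `|M| + 1], continuous (fun t : R => pdist K (x + t *: v))}.
  by apply: continuous_subspaceT => t; exact: line_dist_continuous.
have [|c cI cmin] := EVT_min _ cD; first by have := normr_ge0 M; lra.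
have c0 : pdist K (x + c *: v) <= 0.
  apply/ler_addgt0Pl => e e0; rewrite addr0.
  have [k ke] : exists k : nat, k.+1%:R^-1 <= e :> R.
    exists (Num.truncn e^-1); rewrite -[leRHS]invrK lef_pV2 ?posrE ?invr_gt0//.
    exact/ltW/truncnS_gt.
  have [t [t1 t2]] := pt k; apply: le_trans ke; apply: le_trans t2.
  by apply: cmin; rewrite in_itv /= -ler_norml.
exists (x + c *: v); split; first by rewrite line_set_udir; exists c.
by apply/pdist_eq0 => //; apply/le_anti; rewrite c0 pdist_ge0.
Qed.

Let hit_cvg : hit (Kk k) @[k --> \oo] --> hit K.
Proof.
pose f k E : \bar R := ((phi (udir E))%:E * (\1_(hits (Kk k)) E)%:E)%E.
apply: (@dominated_cvg _ LS R mu setT _ f _ (f 0%N)) => //.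
- by move=> k; exact: mh.
- move=> E _; rewrite /f; have [hE|nE] := pselect (hits K E).
    rewrite [X in _ --> X](_ : _ = f 0%N E); last first.
      rewrite /f !indicE !mem_set// /hits /=; have [y [Ey Ky]] := hE; exists y; split => //.
      exact: KkK.
    apply: cvg_near_cst; apply: nearW => k; rewrite /f !indicE !mem_set//.
      by have [y [Ey Ky]] := hE; exists y; split => //; exact: KkK.
    by have [y [Ey Ky]] := hE; exists y; split => //; exact: KkK.
  have [k0' nk] : exists k, ~ hits (Kk k) E.
    by apply/existsNP => h; apply: nE; exact: hits_lim.
  apply: cvg_near_cst; exists k0' => // k /= kk.
  rewrite !indicE !memNset// => -[y [Ey Ky]]; apply: nk; exists y; split => //.
  exact: (Kk_anti kk).
- apply/integrableP; split; first exact: mh.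
  rewrite (_ : (\int[mu]_x _)%E = hit (Kk 0)); first exact: hit_lty.
  by apply: eq_integral => E _; rewrite gee0_abs// mule_ge0// lee_fin.
- move=> k E _; rewrite gee0_abs; last by rewrite mule_ge0// lee_fin.
  apply: lee_wpmul2l; rewrite ?lee_fin// !indicE ler_nat.
  case: (boolP (E \in hits (Kk k))) => // /set_mem[y [Ey Ky]].
  suff -> : E \in hits (Kk 0) by [].
  by apply/mem_set; exists y; split => //; exact: (Kk0 Ky).
Qed.

Let h (k : nat) : \bar R := (\int[Lambda k K]_xu cosine xu.2)%E.

Let h_ge0 k : (0 <= h k)%E.
Proof. by apply: integral_ge0 => xu _; exact: cosine_ge0. Qed.

Let shell_sum eps : 0 < eps ->
  ((2 * eps * kappa d)%:E * hit K <= \sum_(k < d) (SC eps k)%:E * h k <=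
   (2 * eps * kappa d)%:E * hit (parallel_body K eps))%E.
Proof.
move=> eps0; have := shell_hits_le cK K0 Hmu mphi phi0 phiN eps0.
rewrite (steiner_normals HLambda cK K0 eps0 (cosine_measurable Hmu mphi phi0))//.
by move=> w; exact: cosine_ge0.
Qed.

Let steiner_coef_gt0 eps k : 0 < eps -> 0 < SC eps k.
Proof. by move=> e0; rewrite mulr_gt0 ?exprn_gt0 ?kappa_gt0. Qed.

(** Each term of the Steiner sum at eps = 1 is bounded by the finite hit integral of a parallel
    body, and its coefficient is positive. *)
Let h_fin k : (k < d)%N -> h k \is a fin_num.
Proof.
move=> kd; rewrite ge0_fin_numE//.
have /andP[_ h1] := shell_sum ltr01.
have : (\sum_(k < d) (SC 1 k)%:E * h k < +oo)%E.
  apply: le_lt_trans h1 _; rewrite lte_mul_pinfty// ?lee_fin ?hit_lty//.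
    by rewrite !mulr_ge0// ltW// kappa_gt0.
  exact: parallel_body_compact.
rewrite (bigD1 (Ordinal kd))//= => h2.
have {h2} : ((SC 1 k)%:E * h k < +oo)%E.
  apply: le_lt_trans h2; rewrite leeDl// sume_ge0// => i _.
  by rewrite mule_ge0// lee_fin ltW// steiner_coef_gt0.
rewrite !ltey; apply: contra => /eqP ->.
by rewrite gt0_muley// lte_fin steiner_coef_gt0.
Qed.

(** Since kappa_1 = 2, the summand k = n of the Steiner sum is 2 eps h(n), which matches the factor
    2 eps of the bounds. The other summands are of higher order and disappear after division by
    eps. *)
Theorem crofton_cosine : ((kappa d)%:E * hit K = h n)%E.
Proof.
have hE k : (k < d)%N -> h k = (fine (h k))%:E by move=> kd; rewrite fineK// h_fin.
have hitE D : compact D -> hit D = (fine (hit D))%:E.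
  by move=> cD; rewrite fineK// ge0_fin_numE// hit_lty.
pose S eps : R := \sum_(k < n) SC eps k * fine (h k).
have sumE eps : (\sum_(k < d) (SC eps k)%:E * h k = (S eps + 2 * eps * fine (h n))%:E)%E.
  rewrite big_ord_recr /= EFinD; congr (_ + _)%E.
    rewrite -sumEFin; apply: eq_bigr => k _; rewrite [in LHS]hE// ltnS.
    exact/ltnW.
  rewrite [in LHS]hE// -EFinM; congr (EFin (_ * _)).
  by rewrite /steiner_coef subSn// subnn kappa1 expr1 mulrC.
have S0 eps : 0 < eps -> 0 <= S eps.
  move=> e0; apply: sumr_ge0 => k _; rewrite mulr_ge0//; first exact/ltW/steiner_coef_gt0.
  exact: fine_ge0.
(* For k < n the exponent d - k is at least 2. *)
have Sle eps : 0 < eps -> eps <= 1 -> S eps <= eps ^+ 2 * S 1.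
  move=> e0 e1; rewrite /S mulr_sumr; apply: ler_sum => k _.
  rewrite mulrA; apply: ler_wpM2r; first exact: fine_ge0.
  rewrite /steiner_coef expr1n mul1r; apply: ler_wpM2r; first exact/ltW/kappa_gt0.
  apply: ler_wiXn2l; [exact/ltW|exact: e1|].
  by rewrite subSn ?ltnS ?subn_gt0// ltnW.
have kd : 0 < kappa d :> R by exact: kappa_gt0.
rewrite hE// [in LHS](hitE _ cK.1) -EFinM; congr EFin; apply/le_anti/andP; split.
  apply/ler_addgt0Pr => e e0.
  (* Then eps S(1) <= e, so the higher-order terms amount to at most eps e; adding 1 keeps the
     denominator positive. *)
  pose eps := Num.min 1 (e / (S 1 + 1)).
  have S1 : 0 < S 1 + 1 by rewrite ltr_wpDl// S0.
  have eps0 : 0 < eps by rewrite lt_min ltr01 divr_gt0.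
  have eps1 : eps <= 1 by rewrite ge_min lexx.
  have eps2 : eps * (S 1 + 1) <= e by rewrite -ler_pdivlMr// ge_min lexx orbT.
  have /andP[+ _] := shell_sum eps0; rewrite sumE (hitE _ cK.1) -EFinM lee_fin => H.
  have H2 := Sle _ eps0 eps1.
  rewrite -(ler_pM2l eps0); move: H H2 (S0 1 ltr01).
  set a := fine _; set b := fine _; set s := S 1; set s' := S eps => H H2 s0.
  have H3 : eps * (eps * (s + 1)) <= eps * e by rewrite ler_pM2l.
  have p1 : 0 < eps * e by rewrite mulr_gt0.
  have p2 : 0 <= eps ^+ 2 by exact: sqr_ge0.
  rewrite /=; clearbody a b s s' eps; lra.
rewrite -lee_fin EFinM -(hitE _ cK.1).
(* In this direction the higher-order terms are dropped by sign, and the hit integrals of the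
   parallel bodies converge to that of K. *)
apply: (@cvge_ge nat \oo _ R (fun k => (kappa d)%:E * hit (Kk k))%E); last first.
  by apply: cvgeZl => //; exact: hit_cvg.
apply: nearW => k; have /andP[_] := shell_sum (k0 k).
rewrite sumE (hitE _ (@cKk k)) -!EFinM !lee_fin => H.
rewrite -(ler_pM2l (k0 k)); move: H (S0 _ (k0 k)); rewrite -/(Kk k).
set e := k.+1%:R^-1; set a := fine _; set b := fine _; set s := S e.
by move=> H s0; clearbody a b s e; lra.
Qed.

End crofton_cosine.

(** * Moments of the direction distribution *)

Section admissible.
Context {R : realType} {n : nat}.
Local Notation V := 'rV[R]_n.+1.

(** What makes the integral against the chord weight finite. Directions are unit vectors, so a bound
    on the sphere suffices and polynomials qualify. *)
Definition admissible (f : borel V -> R) : Prop :=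
  measurable_fun setT f /\ exists C, forall v, dotp (v : V) v = 1 -> `|f v| <= C.

Lemma admissible_cst c : admissible (fun=> c).
Proof. by split; [exact: measurable_cst|exists `|c|]. Qed.

Lemma admissible_dotp (w : V) : admissible (fun v => dotp (v : V) w).
Proof.
split; first by apply: measurable_dotp; [exact: measurable_id|exact: measurable_cst].
exists (enorm w) => v v1; apply: le_trans (dotp_le _ _) _.
by rewrite ((enorm1 v).2 v1) mul1r.
Qed.

Lemma admissibleD f g : admissible f -> admissible g -> admissible (fun v => f v + g v).
Proof.
move=> [mf [C HC]] [mg [D HD]]; split; first exact: measurable_funD.
by exists (C + D) => v v1; apply: le_trans (ler_normD _ _) _; rewrite lerD ?HC ?HD.
Qed.

Lemma admissibleM f g : admissible f -> admissible g -> admissible (fun v => f v * g v).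
Proof.
move=> [mf [C HC]] [mg [D HD]]; split; first exact: measurable_funM.
by exists (C * D) => v v1; rewrite normrM ler_pM ?HC ?HD.
Qed.

Lemma admissibleX f k : admissible f -> admissible (fun v => f v ^+ k).
Proof.
move=> af; elim: k => [|k IH]; first exact: admissible_cst.
rewrite (_ : (fun v => _) = (fun v => f v * f v ^+ k)); first exact: admissibleM.
by apply/funext => v; rewrite exprS.
Qed.

Lemma admissible_norm f : admissible f -> admissible (fun v => `|f v|).
Proof.
move=> [mf [C HC]]; split; first exact: (measurableT_comp (@normr_measurable R setT) mf).
by exists C => v v1; rewrite normr_id HC.
Qed.

Lemma admissible_sum I (s : seq I) (f : I -> borel V -> R) :
  (forall i, admissible (f i)) -> admissible (fun v => \sum_(i <- s) f i v).
Proof.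
move=> af; elim: s => [|i s IH].
  by under eq_fun do rewrite big_nil; exact: admissible_cst.
by under eq_fun do rewrite big_cons; exact: admissibleD.
Qed.

Lemma admissible_mulmx f (A : 'M[R]_n.+1) : A *m A^T = 1%:M -> admissible f ->
  admissible (fun v => f ((v : V) *m A : V)).
Proof.
move=> AA [mf [C HC]]; split; last by exists C => v v1; rewrite HC// dotp_mulmx.
apply: (measurableT_comp mf); apply: measurable_fun_rV => i.
under eq_fun do rewrite mxE; apply: measurable_sum => j.
by apply: measurable_funM; [exact: coord_measurable|exact: measurable_cst].
Qed.

End admissible.

Section chord_integral.
Context {R : realType} {n : nat}.
Local Notation V := 'rV[R]_n.+1.
Local Notation LS := (@line_space R n).
Variables (mu : {measure set LS -> \bar R}) (Hmu : is_line_measure mu).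
Implicit Types f g : borel V -> R.

Definition chord_integral f : R := \int[mu]_E (fine (chord E) * f (udir E)).
Local Notation J := chord_integral.

Lemma chord_fin (E : LS) : (chord E : \bar R) \is a fin_num.
Proof.
rewrite ge0_fin_numE ?chord_ge0//; apply: le_lt_trans (chord_le E) _.
by rewrite -EFinM ltry.
Qed.

Lemma fine_chord_ge0 (E : LS) : 0 <= fine (chord E) :> R.
Proof. by apply: fine_ge0; exact: chord_ge0. Qed.

Lemma chord_integrable f : admissible f ->
  mu.-integrable setT (EFin \o (fun E => fine (chord E) * f (udir E))).
Proof.
move=> [mf [C HC]].
have mc : measurable_fun [set: LS] (fun E : LS => fine (chord E) : R).
  have mfine : measurable_fun [set: \bar R] (@fine R) by exact: fine_measurable.
  exact: (measurableT_comp mfine (@chord_measurable R n)).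
have mF : measurable_fun [set: LS] (fun E : LS => fine (chord E) * f (udir E)).
  by apply: measurable_funM => //; exact: (measurableT_comp mf udir_measurable).
apply/integrableP; split; first exact/measurable_EFinP.
apply: (@le_lt_trans _ _ (\int[mu]_E (C%:E * chord E))%E).
  apply: ge0_le_integral => //.
  - by apply/measurable_EFinP; apply: (measurableT_comp (@normr_measurable R setT)).
  - by apply: emeasurable_funM => //; exact: chord_measurable.
  - move=> E _; rewrite /= normrM ger0_norm ?fine_chord_ge0// EFinM fineK ?chord_fin// muleC.
    by apply: lee_wpmul2r; [exact: chord_ge0|rewrite lee_fin HC// udir_unit].
have C0 : 0 <= C by apply: le_trans (HC _ (udir_unit (point : LS))).
rewrite ge0_integralZl//; [|exact: chord_measurable|by move=> E _; exact: chord_ge0].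
by rewrite lte_mul_pinfty// integral_chord_lty.
Qed.

Lemma chord_integralD f g : admissible f -> admissible g -> J (fun v => f v + g v) = J f + J g.
Proof.
move=> af ag; rewrite /J -RintegralD//; [|exact: chord_integrable..].
by apply: eq_Rintegral => E _; rewrite mulrDr.
Qed.

Lemma chord_integralZ c f : admissible f -> J (fun v => c * f v) = c * J f.
Proof.
move=> af; rewrite /J -RintegralZl//; last exact: chord_integrable.
by apply: eq_Rintegral => E _; rewrite mulrCA.
Qed.

Lemma chord_integral_sum I (s : seq I) (f : I -> borel V -> R) :
  (forall i, admissible (f i)) -> J (fun v => \sum_(i <- s) f i v) = \sum_(i <- s) J (f i).
Proof.
move=> af; elim: s => [|i s IH].
  under eq_fun do rewrite big_nil; rewrite big_nil.
  by have := chord_integralZ 0 (admissible_cst 0); under eq_fun do rewrite mul0r; rewrite mul0r.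
under eq_fun do rewrite big_cons; rewrite big_cons chord_integralD ?IH//.
exact: admissible_sum.
Qed.

Lemma eq_chord_integral f g : (forall v, dotp (v : V) v = 1 -> f v = g v) -> J f = J g.
Proof. by move=> fg; apply: eq_Rintegral => E _; rewrite fg// udir_unit. Qed.

Lemma chord_integral_le f g : admissible f -> admissible g ->
  (forall v, dotp (v : V) v = 1 -> f v <= g v) -> J f <= J g.
Proof.
move=> af ag fg; apply: le_Rintegral => //; [exact: chord_integrable..|].
by move=> E _; rewrite ler_wpM2l ?fine_chord_ge0// fg// udir_unit.
Qed.

Lemma chord_integral_norm f C : admissible f ->
  (forall v, dotp (v : V) v = 1 -> `|f v| <= C) -> `|J f| <= C * J (fun=> 1).
Proof.
move=> af fC; rewrite -chord_integralZ; last exact: admissible_cst.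
rewrite ler_norml; apply/andP; split; last first.
  apply: chord_integral_le => //; first exact: admissible_cst.
  by move=> v v1; rewrite mulr1; apply: le_trans (ler_norm _) (fC _ v1).
rewrite -mulN1r -chord_integralZ; last exact: admissible_cst.
apply: chord_integral_le => //; first exact: admissible_cst.
by move=> v /fC; rewrite mulN1r mulr1 ler_norml => /andP[].
Qed.

(** Evenness is required because the chosen direction of a rotated line is the rotated direction
    only up to sign. The chord does not change, as the rotation fixes the centre of the ball. *)
Lemma chord_integral_rot f (A : 'M[R]_n.+1) : A *m A^T = 1%:M -> \det A = 1 ->
  admissible f -> (forall v, f (- (v : V) : V) = f v) -> J (fun v => f ((v : V) *m A : V)) = J f.
Proof.
move=> AA detA af fN.
pose F E : \bar R := (fine (chord E) * f (udir E))%:E.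
have mF : measurable_fun [set: LS] (F : LS -> \bar R).
  by have /integrableP[] := chord_integrable af.
have FA E : F (motion 0 AA E) = (fine (chord E) * f (udir E *m A))%:E.
  rewrite /F chord_motion; congr (_ * _)%:E.
  have e := motion_rep 0 AA (line_set_udir E).
  have v1 : dotp (udir E *m A) (udir E *m A) = 1 by rewrite dotp_mulmx// udir_unit.
  by have [->|->] := udir_cases v1 e.
rewrite /J /Rintegral; congr fine.
transitivity (\int[mu]_E F (motion 0 AA E))%E; first by apply: eq_integral => E _; rewrite FA.
rewrite [LHS]integralE [RHS]integralE; congr (_ - _)%E.
  transitivity (\int[mu]_E F^\+ (motion 0 AA E))%E.
    by apply: eq_integral => E _; rewrite !funeposE.
  exact: (ge0_integral_motion Hmu 0 AA detA (measurable_funepos mF) (funepos_ge0 F)).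
transitivity (\int[mu]_E F^\- (motion 0 AA E))%E.
  by apply: eq_integral => E _; rewrite !funenegE.
exact: (ge0_integral_motion Hmu 0 AA detA (measurable_funeneg mF) (funeneg_ge0 F)).
Qed.

Lemma cosineE (phi : borel V -> R) w : admissible phi -> (forall v, 0 <= phi v) ->
  cosine mu phi w = (J (fun v => `|dotp (v : V) w| * phi v))%:E.
Proof.
move=> aphi phi0.
have af : admissible (fun v : borel V => `|dotp (v : V) w| * phi v).
  by apply: admissibleM => //; apply: admissible_norm; exact: admissible_dotp.
rewrite /J /Rintegral fineK; last by apply: integrable_fin_num => //; exact: (chord_integrable af).
apply: eq_integral => E _; rewrite [RHS]EFinM fineK ?chord_fin//.
by rewrite [dotp w _]dotpC.
Qed.

End chord_integral.

(** * First-order expansions along a rotation *)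

Section jets.
Context {R : realType}.


(** An expansion f0 + s f1 with remainder O(s^2), uniform for p in the unit square. The bounds on f0
    and f1 are included so that products have expansions too. *)
Definition jet f (f0 f1 : R * R -> R) : Prop :=
  exists K, forall s p, 0 <= s <= 1 -> `|p.1| <= 1 -> `|p.2| <= 1 ->
    [/\ `|f s p - f0 p - s * f1 p| <= K * s ^+ 2, `|f0 p| <= K & `|f1 p| <= K].

Lemma jetM (f g : R -> R * R -> R) f0 f1 g0 g1 : jet f f0 f1 -> jet g g0 g1 ->
  jet (fun s p => f s p * g s p) (fun p => f0 p * g0 p)
      (fun p => f0 p * g1 p + f1 p * g0 p).
Proof.
(* The remainder of the product splits into three parts, bounded by 3, 2 and 1 times K L s^2. *)
move=> [K HK] [L HL]; exists (6 * (K * L)) => s p s01 p1 p2.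
have [a1 a2 a3] := HK s p s01 p1 p2; have [b1 b2 b3] := HL s p s01 p1 p2.
move: a1 a2 a3 b1 b2 b3; move: (f s p) (f0 p) (f1 p) (g s p) (g0 p) (g1 p).
move=> x x0 x1 y y0 y1 a1 a2 a3 b1 b2 b3.
have K0 : 0 <= K by apply: le_trans a2.
have L0 : 0 <= L by apply: le_trans b2.
have KL : 0 <= K * L by rewrite mulr_ge0.
move: s01 => /andP[s0 s1]; have s2 : 0 <= s ^+ 2 by exact: sqr_ge0.
have s21 : s ^+ 2 <= 1 by rewrite expr_le1.
have y3 : `|y| <= 3 * L.
  rewrite (_ : y = (y - y0 - s * y1) + y0 + s * y1); last by ring.
  apply: le_trans (ler_normD _ _) _; have := ler_normD (y - y0 - s * y1) y0.
  have : `|s * y1| <= L by rewrite normrM ger0_norm// -[L]mul1r ler_pM.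
  have : L * s ^+ 2 <= L by rewrite ler_piMr.
  lra.
split.
- rewrite (_ : x * y - x0 * y0 - s * (x0 * y1 + x1 * y0) =
    (x - x0 - s * x1) * y + (x0 + s * x1) * (y - y0 - s * y1) + s ^+ 2 * (x1 * y1)); last by ring.
  apply: le_trans (ler_normD _ _) _; apply: le_trans (lerD (ler_normD _ _) (lexx _)) _.
  have h1 : `|(x - x0 - s * x1) * y| <= K * s ^+ 2 * (3 * L) by rewrite normrM ler_pM.
  have h2 : `|(x0 + s * x1) * (y - y0 - s * y1)| <= (2 * K) * (L * s ^+ 2).
    rewrite normrM ler_pM//; apply: le_trans (ler_normD _ _) _.
    have : `|s * x1| <= K by rewrite normrM ger0_norm// -[K]mul1r ler_pM.
    lra.
  have h3 : `|s ^+ 2 * (x1 * y1)| <= s ^+ 2 * (K * L).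
    by rewrite normrM ger0_norm// ler_wpM2l// normrM ler_pM.
  lra.
- rewrite normrM; apply: le_trans (_ : K * L <= _); [exact: ler_pM|lra].
- apply: le_trans (ler_normD _ _) _; rewrite !normrM.
  have h1 : `|x0| * `|y1| <= K * L by exact: ler_pM.
  have h2 : `|x1| * `|y0| <= K * L by exact: ler_pM.
  lra.
Qed.

Lemma eq_jet (f g : R -> R * R -> R) f0 f1 g0 g1 : f =2 g -> f0 =1 g0 -> f1 =1 g1 -> jet f f0 f1 -> jet g g0 g1.
Proof. by move=> e e0 e1 [K HK]; exists K => s p *; rewrite -e -e0 -e1; exact: HK. Qed.

Lemma jetX k (f : R -> R * R -> R) f0 f1 : jet f f0 f1 ->
  jet (fun s p => f s p ^+ k) (fun p => f0 p ^+ k) (fun p => k%:R * f0 p ^+ k.-1 * f1 p).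
Proof.
move=> jf; elim: k => [|k IH].
  by exists 1 => s p _ _ _; rewrite !mul0r mulr0 subr0 subrr normr0 normr1 mul1r sqr_ge0 ler01.
apply: (eq_jet _ _ _ (jetM jf IH)) => [s p|p|p]; rewrite ?exprS//=.
by case: k {IH} => [|k]; rewrite /= ?expr0; [ring|rewrite exprS -(natr1 k.+1); ring].
Qed.

(* [t |-> t|t|] is C^1 with Lipschitz derivative [2|t|]. *)
Lemma normM_diff (a h : R) : `| `|a + h| * (a + h) - `|a| * a - 2 * `|a| * h| <= h ^+ 2.
Proof.
have [a0|a0] := leP 0 a; have [b0|b0] := leP 0 (a + h).
- by rewrite (ger0_norm a0) (ger0_norm b0) ler_norml; nra.
- by rewrite (ger0_norm a0) (ltr0_norm b0) ler_norml; nra.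
- by rewrite (ltr0_norm a0) (ger0_norm b0) ler_norml; nra.
- by rewrite (ltr0_norm a0) (ltr0_norm b0) ler_norml; nra.
Qed.

Lemma jet_normM (f : R -> R * R -> R) f0 f1 : jet f f0 f1 ->
  jet (fun s p => `|f s p| * f s p) (fun p => `|f0 p| * f0 p) (fun p => 2 * `|f0 p| * f1 p).
Proof.
(* 6 = 4 + 2: the quadratic error of [normM_diff], and the remainder of f multiplied by 2 |f0|. *)
move=> [K HK]; exists (6 * K ^+ 2) => s p s01 p1 p2.
have [a1 a2 a3] := HK s p s01 p1 p2.
move: a1 a2 a3; move: (f s p) (f0 p) (f1 p) => x x0 x1 a1 a2 a3.
have K0 : 0 <= K by apply: le_trans a2.
move: s01 => /andP[s0 s1]; have s2 : 0 <= s ^+ 2 by exact: sqr_ge0.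
have s21 : s ^+ 2 <= s by rewrite expr2 ler_piMr.
have h1 : `|x - x0| <= 2 * K * s.
  rewrite (_ : x - x0 = (x - x0 - s * x1) + s * x1); last by ring.
  apply: le_trans (ler_normD _ _) _.
  have : `|s * x1| <= s * K by rewrite normrM ger0_norm// ler_wpM2l.
  have : K * s ^+ 2 <= K * s by rewrite ler_wpM2l.
  lra.
have h2 : (x - x0) ^+ 2 <= 4 * K ^+ 2 * s ^+ 2.
  rewrite -real_normK ?num_real// (_ : 4 * _ * _ = (2 * K * s) ^+ 2); last by ring.
  by rewrite ler_sqr ?nnegrE// !mulr_ge0.
have K2 : 0 <= K ^+ 2 by exact: sqr_ge0.
split.
- have h3 := normM_diff x0 (x - x0); rewrite (_ : x0 + (x - x0) = x) in h3; last by ring.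
  rewrite (_ : _ - _ = (`|x| * x - `|x0| * x0 - 2 * `|x0| * (x - x0)) +
    2 * (`|x0| * (x - x0 - s * x1))); last by ring.
  apply: le_trans (ler_normD _ _) _.
  have h4 : `|2 * (`|x0| * (x - x0 - s * x1))| <= 2 * (K * (K * s ^+ 2)).
    by rewrite normrM (ger0_norm (ler0n R 2)) ler_pM2l// normrM normr_id ler_pM.
  have := mulr_ge0 K2 s2; lra.
- rewrite normrM normr_id; have : `|x0| * `|x0| <= K * K by exact: ler_pM.
  by lra.
- rewrite !normrM (ger0_norm (ler0n R 2)) normr_id.
  have : `|x0| * `|x1| <= K * K by exact: ler_pM.
  lra.
Qed.

(** With s and c(s) the sine and cosine of an angle, 2 s c(s) and 1 - 2 s^2 are those of the double
    angle, as needed for the square of [plane_rot]. *)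
Let c (s : R) := Num.sqrt (1 - s ^+ 2).

Lemma jet_rot1 : jet (fun s p => (1 - 2 * s ^+ 2) * p.1 - (2 * s * c s) * p.2)
  (fun p => p.1) (fun p => - 2 * p.2).
Proof.
exists 4 => s [x y] /andP[s0 s1] /= x1 y1.
have s21 : s ^+ 2 <= 1 by rewrite expr_le1.
have c0 : 0 <= c s by exact: sqrtr_ge0.
have c2 : c s ^+ 2 = 1 - s ^+ 2 by rewrite sqr_sqrtr// subr_ge0.
have c1 : `|1 - c s| <= s ^+ 2 by rewrite ler_norml; nra.
split; [|lra|]; last by rewrite normrM normrN (ger0_norm (ler0n R 2)); lra.
rewrite (_ : _ - _ = s ^+ 2 * (- 2 * x) + 2 * (s * ((1 - c s) * y))); last by ring.
apply: le_trans (ler_normD _ _) _.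
have s2 : 0 <= s ^+ 2 by exact: sqr_ge0.
have h1 : `|s ^+ 2 * (-2 * x)| <= s ^+ 2 * 2.
  rewrite normrM ger0_norm// ler_wpM2l// normrM normrN (ger0_norm (ler0n R 2)); lra.
have h2 : `|2 * (s * ((1 - c s) * y))| <= 2 * (1 * (s ^+ 2 * 1)).
  rewrite normrM (ger0_norm (ler0n R 2)) ler_pM2l// normrM (ger0_norm s0) ler_pM//.
  by rewrite normrM ler_pM.
lra.
Qed.

Lemma jet_rot2 : jet (fun s p => (2 * s * c s) * p.1 + (1 - 2 * s ^+ 2) * p.2)
  (fun p => p.2) (fun p => 2 * p.1).
Proof.
have [K HK] := jet_rot1; exists K => s [x y] s01 /= x1 y1.
have [] := HK s (y, - x) s01 y1; rewrite ?normrN//= => h1 h2 h3; split => //.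
  by rewrite (_ : _ - _ = (1 - 2 * s ^+ 2) * y - 2 * s * c s * - x - y - s * (-2 * - x)) //; ring.
by move: h3; rewrite mulrN mulNr opprK.
Qed.

(** The coefficient of s is the derivative of |x| x^(a + 1) y^q along the field x' = - 2 y, y' = 2
    x. Grouping |x| x removes the kink of |x|. *)
Lemma jet_monomial a q :
  jet (fun s p => let x := (1 - 2 * s ^+ 2) * p.1 - (2 * s * c s) * p.2 in
                  let y := (2 * s * c s) * p.1 + (1 - 2 * s ^+ 2) * p.2 in
                  `|x| * x ^+ a.+1 * y ^+ q)
      (fun p => `|p.1| * p.1 ^+ a.+1 * p.2 ^+ q)
      (fun p => 2 * (q%:R * (`|p.1| * p.1 ^+ a.+2 * p.2 ^+ q.-1) +
                     - a.+2%:R * (`|p.1| * p.1 ^+ a * p.2 ^+ q.+1))).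
Proof.
have j1 := jetM (jetM (jet_normM jet_rot1) (jetX a jet_rot1)) (jetX q jet_rot2).
apply: (eq_jet _ _ _ j1) => [s p|p|p] /=; rewrite ?exprS ?mulrA//.
rewrite -(natr1 a.+1) -(natr1 a).
by case: a {j1} => [|a] /=; rewrite ?exprS; ring.
Qed.

End jets.

Lemma gram_entry (R : realType) n (A : 'M[R]_n) i j :
  (A *m A^T) i j = dotp (row i A) (row j A).
Proof. by rewrite mxE; apply: eq_bigr => k _; rewrite !mxE. Qed.

Lemma orth_of_dotp (R : realType) n (B : 'M[R]_n) :
  (forall v w, dotp (v *m B) (w *m B) = dotp v w) -> B *m B^T = 1%:M.
Proof.
move=> dB; apply/matrixP => i j; rewrite gram_entry !rowE dB.
by rewrite -[delta_mx _ i]mulmx1 -[delta_mx _ j]mulmx1 -!rowE -gram_entry trmx1 mulmx1.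
Qed.

Section rotation.
Context {R : realType} {n : nat}.
Local Notation V := 'rV[R]_n.+1.
Variables (u e : V).
Hypotheses (u1 : dotp u u = 1) (e1 : dotp e e = 1) (ue : dotp u e = 0).

(** For orthonormal u, e and c^2 + s^2 = 1 this fixes the complement of their plane. As the identity
    plus a term of rank at most two it needs no completion of u, e to a basis. *)
Definition plane_rot (c s : R) : 'M[R]_n.+1 :=
  1%:M + u^T *m ((c - 1) *: u + s *: e) + e^T *m (- s *: u + (c - 1) *: e).

Lemma mulmx_tr_dotp (v w r : V) : v *m (w^T *m r) = dotp v w *: r.
Proof.
rewrite mulmxA (_ : v *m w^T = (dotp v w)%:M) ?mul_scalar_mx//.
apply/matrixP => i j; rewrite !ord1 !mxE eqxx mulr1n; apply: eq_bigr => k _.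
by rewrite !mxE.
Qed.

Lemma plane_rotE c s v : v *m plane_rot c s =
  v + dotp v u *: ((c - 1) *: u + s *: e) + dotp v e *: (- s *: u + (c - 1) *: e).
Proof. by rewrite /plane_rot (mulmxDr v (1%:M + _)) (mulmxDr v 1%:M) mulmx1 !mulmx_tr_dotp. Qed.

Let eu : dotp e u = 0. Proof. by rewrite dotpC. Qed.

Lemma plane_rot_u c s v : dotp (v *m plane_rot c s) u = c * dotp v u - s * dotp v e.
Proof. by rewrite plane_rotE !(dotpDl, dotpZl) u1 eu; ring. Qed.

Lemma plane_rot_e c s v : dotp (v *m plane_rot c s) e = s * dotp v u + c * dotp v e.
Proof. by rewrite plane_rotE !(dotpDl, dotpZl) e1 ue; ring. Qed.

Lemma plane_rot_orth c s : c ^+ 2 + s ^+ 2 = 1 -> plane_rot c s *m (plane_rot c s)^T = 1%:M.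
Proof.
move=> cs; set B := plane_rot c s.
have dB v w : dotp (v *m B) (w *m B) = dotp v w.
  rewrite [w *m B]plane_rotE !(dotpDr, dotpZr) plane_rot_u plane_rot_e.
  rewrite {1}plane_rotE !(dotpDl, dotpZl) (dotpC u w) (dotpC e w).
  move: (dotp v u) (dotp v e) (dotp w u) (dotp w e) (dotp v w) => a b a' b' t.
  transitivity (t + (c ^+ 2 + s ^+ 2 - 1) * (a * a' + b * b')); first by ring.
  by rewrite cs subrr mul0r addr0.
exact: orth_of_dotp.
Qed.

End rotation.

Lemma dotp_unit_le (R : realType) n (v w : 'rV[R]_n) :
  dotp v v = 1 -> dotp w w = 1 -> `|dotp v w| <= 1.
Proof.
move=> v1 w1; apply: le_trans (dotp_le _ _) _.
by rewrite ((enorm1 v).2 v1) ((enorm1 w).2 w1) mulr1.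
Qed.

Section moments.
Context {R : realType} {n : nat}.
Local Notation V := 'rV[R]_n.+1.
Local Notation LS := (@line_space R n).
Variables (mu : {measure set LS -> \bar R}) (Hmu : is_line_measure mu).
Local Notation J := (chord_integral mu).

Definition moment (u w : V) (a q : nat) : R :=
  J (fun v => `|dotp (v : V) u| * dotp (v : V) u ^+ a * dotp (v : V) w ^+ q).

Lemma admissible_moment (u w : V) a q :
  admissible (fun v : borel V => `|dotp (v : V) u| * dotp (v : V) u ^+ a * dotp (v : V) w ^+ q).
Proof.
have h := @admissible_dotp R n.
by apply: admissibleM; [apply: admissibleM; [exact: admissible_norm|exact: admissibleX]|exact: admissibleX].
Qed.

Section plane.
Variables (u e : V).
Hypotheses (u1 : dotp u u = 1) (e1 : dotp e e = 1) (ue : dotp u e = 0).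

(* [plane_rot] is used through its square, which has determinant 1. *)
Lemma chord_integral_plane (c s : R) f : c ^+ 2 + s ^+ 2 = 1 ->
  admissible f -> (forall v, f (- (v : V) : V) = f v) ->
  J (fun v => f ((v : V) *m (plane_rot u e c s *m plane_rot u e c s) : V)) = J f.
Proof.
move=> cs af fN; have BB := plane_rot_orth u1 e1 ue cs.
apply: chord_integral_rot => //.
  by rewrite trmx_mul mulmxA -(mulmxA (plane_rot u e c s)) BB mulmx1.
by rewrite det_mulmx -{2}det_tr -det_mulmx BB det1.
Qed.

(** The integral of F is constant along the rotation, so the integral of its derivative G at s = 0
    vanishes. The parity condition makes F even, as [chord_integral_rot] requires. *)
Lemma moment_rec_unit a q : ~~ odd (a + q.+1) ->
  a.+2%:R * moment u e a q.+1 = q%:R * moment u e a.+2 q.-1.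
Proof.
move=> par.
pose F (p : R * R) := `|p.1| * p.1 ^+ a.+1 * p.2 ^+ q.
pose G (p : R * R) := 2 * (q%:R * (`|p.1| * p.1 ^+ a.+2 * p.2 ^+ q.-1) +
                     - a.+2%:R * (`|p.1| * p.1 ^+ a * p.2 ^+ q.+1)).
pose xy (v : V) := (dotp v u, dotp v e).
have aF : admissible (fun v : borel V => F (xy v)) by exact: admissible_moment.
have FN v : F (xy (- v)) = F (xy v).
  rewrite /F /xy /= !dotpNl normrN (exprNn (dotp v u)) (exprNn (dotp v e)).
  have sg : (-1) ^+ a.+1 * (-1) ^+ q = 1 :> R.
    by rewrite -exprD -signr_odd addSnnS (negPf par).
  transitivity ((-1) ^+ a.+1 * (-1) ^+ q * (`|dotp v u| * dotp v u ^+ a.+1 * dotp v e ^+ q)).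
    by ring.
  by rewrite sg mul1r.
have a1 := admissible_moment u e a.+2 q.-1; have a2 := admissible_moment u e a q.+1.
have aG' := admissibleD (admissibleM (admissible_cst q%:R) a1)
  (admissibleM (admissible_cst (- a.+2%:R)) a2).
have aG : admissible (fun v : borel V => G (xy v)) by exact: admissibleM (admissible_cst 2) aG'.
have JG : J (fun v => G (xy v)) = 2 * (q%:R * moment u e a.+2 q.-1 - a.+2%:R * moment u e a q.+1).
  rewrite (chord_integralZ Hmu 2 aG') (chord_integralD Hmu); first last.
  - exact: admissibleM (admissible_cst _) a2.
  - exact: admissibleM (admissible_cst _) a1.
  by rewrite (chord_integralZ Hmu _ a1) (chord_integralZ Hmu _ a2) mulNr.
suff : J (fun v => G (xy v)) = 0.
  rewrite JG => /eqP; rewrite mulf_eq0 pnatr_eq0 /= subr_eq0 => /eqP; exact: esym.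
have [K HK] := @jet_monomial R a q.
have J1 : 0 <= J (fun=> 1).
  by apply: Rintegral_ge0 => E _; rewrite mulr1 fine_chord_ge0.
(* On unit vectors, rotated F minus F minus s G is at most K s^2 in absolute value. The first two
   terms have equal integrals, so only s times the integral of G remains. *)
have key s : 0 < s <= 1 -> `|J (fun v => G (xy v))| <= s * (K * J (fun=> 1)).
  move=> /andP[s0 s1].
  have s2 : 0 <= 1 - s ^+ 2 by rewrite subr_ge0 expr_le1// ltW.
  have cs : Num.sqrt (1 - s ^+ 2) ^+ 2 + s ^+ 2 = 1 by rewrite sqr_sqrtr// subrK.
  pose P := plane_rot u e (Num.sqrt (1 - s ^+ 2)) s.
  have JB : J (fun v => F (xy (v *m (P *m P)))) = J (fun v => F (xy v)).
    exact: (chord_integral_plane cs aF FN).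
  have aFB : admissible (fun v : borel V => F (xy ((v : V) *m (P *m P)))).
    apply: (admissible_mulmx (f := fun v : borel V => F (xy v))) => //.
    have BB := plane_rot_orth u1 e1 ue cs.
    by rewrite trmx_mul mulmxA -(mulmxA P) BB mulmx1.
  have xyB v : xy (v *m (P *m P)) =
     ((1 - 2 * s ^+ 2) * dotp v u - (2 * s * Num.sqrt (1 - s ^+ 2)) * dotp v e,
      (2 * s * Num.sqrt (1 - s ^+ 2)) * dotp v u + (1 - 2 * s ^+ 2) * dotp v e).
    rewrite /xy mulmxA !(plane_rot_u u1 ue) !(plane_rot_e e1 ue) !(plane_rot_u u1 ue).
    have -> : 1 - 2 * s ^+ 2 = Num.sqrt (1 - s ^+ 2) ^+ 2 - s ^+ 2 by rewrite sqr_sqrtr//; ring.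
    by congr (_, _); ring.
  have aD := admissibleD (admissibleD aFB (admissibleM (admissible_cst (-1)) aF))
    (admissibleM (admissible_cst (- s)) aG).
  have := chord_integral_norm Hmu (C := K * s ^+ 2) aD.
  rewrite (chord_integralD Hmu (admissibleD aFB (admissibleM (admissible_cst (-1)) aF))
    (admissibleM (admissible_cst (- s)) aG)).
  rewrite (chord_integralD Hmu aFB (admissibleM (admissible_cst (-1)) aF)).
  rewrite (chord_integralZ Hmu _ aF) (chord_integralZ Hmu _ aG) JB mulN1r subrr add0r.
  rewrite normrM normrN (gtr0_norm s0) => H.
  rewrite -(ler_pM2l s0) (_ : s * (s * _) = K * s ^+ 2 * J (fun=> 1)); last by ring.
  apply: H => v v1; rewrite xyB.
  have s01 : 0 <= s <= 1 by rewrite (ltW s0).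
  have [h _ _] := HK s (xy v) s01 (dotp_unit_le v1 u1) (dotp_unit_le v1 e1).
  by apply: le_trans h; rewrite le_eqVlt; apply/orP; left; apply/eqP; congr (`| _ |); rewrite /F /G /=; ring.
set A := J _ in key *; apply/eqP; apply: contraT => A0.
have A0' : 0 < `|A| by rewrite normr_gt0.
have h1 := key 1; rewrite ltr01 lexx mul1r in h1; have {}h1 := h1 isT.
have B0 := lt_le_trans A0' h1.
move: h1 B0 key; set B := K * _ => h1 B0 key.
(* At this value of s the bound [key] reads |A| <= |A| / 2. *)
have q01 : 0 < `|A| / (2 * B) <= 1.
  have B2 : 0 < 2 * B by rewrite mulr_gt0.
  apply/andP; split; first exact: divr_gt0.
  by rewrite ler_pdivrMr// mul1r; lra.
have := key _ q01; rewrite (_ : `|A| / (2 * B) * B = `|A| / 2); first lra.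
by field; rewrite gt_eqF.
Qed.

End plane.
End moments.

Section moments.
Context {R : realType} {n : nat}.
Local Notation V := 'rV[R]_n.+1.
Local Notation LS := (@line_space R n).
Variables (mu : {measure set LS -> \bar R}) (Hmu : is_line_measure mu).
Local Notation J := (chord_integral mu).
Local Notation M := (moment mu).

Lemma momentZ (u w : V) (c : R) a q : M u (c *: w) a q = c ^+ q * M u w a q.
Proof.
rewrite /moment -(chord_integralZ Hmu _ (admissible_moment u w a q)).
by apply: eq_chord_integral => v _; rewrite dotpZr exprMn; ring.
Qed.

Lemma moment_w0 (u w w' : V) a : M u w a 0 = M u w' a 0.
Proof. by apply: eq_chord_integral => v _; rewrite !expr0. Qed.

Section fixed_normal.
Variable u : V.
Hypothesis u1 : dotp u u = 1.

Lemma moment_rec (w : V) a q : dotp u w = 0 -> ~~ odd (a + q.+1) ->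
  a.+2%:R * M u w a q.+1 = q%:R * dotp w w * M u w a.+2 q.-1.
Proof.
move=> uw par; have [->|w0] := eqVneq w 0.
  rewrite dotp0l mulr0 mul0r (_ : M _ _ _ _ = 0) ?mulr0//.
  by have := momentZ u 0 0 a q.+1; rewrite scale0r exprS !mul0r.
have wn0 : enorm w != 0 by rewrite enorm_eq0.
pose e := (enorm w)^-1 *: w.
have we : w = enorm w *: e by rewrite scalerA divff// scale1r.
have e1 : dotp e e = 1.
  by rewrite dotpZl dotpZr -sqr_enorm; field.
have ue : dotp u e = 0 by rewrite dotpZr uw mulr0.
have := moment_rec_unit Hmu u1 e1 ue par.
clearbody e; move=> H; rewrite [in LHS]we [X in M u X a.+2 _]we !momentZ -sqr_enorm mulrCA H.
by clear H; case: q par => [|q] _ /=; rewrite ?mul0r ?mulr0// !exprS expr0; ring.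
Qed.

Lemma moment_odd_step (w : V) a : dotp u w = 0 -> odd a -> M u w a 1 = 0.
Proof.
move=> uw oa; have := @moment_rec w a 0 uw; rewrite addn1 /= oa => /(_ isT) /eqP.
by rewrite !mul0r mulf_eq0 pnatr_eq0 /= => /eqP.
Qed.

(** Each step of [moment_rec] lowers the exponent of <v, w> by two, down to [moment_odd_step], where
    the factor q = 0 appears. *)
Lemma moment_odd (w : V) i a : dotp u w = 0 -> odd a -> M u w a (2 * i).+1 = 0.
Proof.
move=> uw; elim: i a => [|i IH] a oa; first by rewrite muln0 moment_odd_step.
have := @moment_rec w a (2 * i.+1) uw.
have -> : (2 * i.+1).-1 = (2 * i).+1 by rewrite mulnS.
rewrite IH /= ?oa// mulr0 => H.
have /H/eqP : ~~ odd (a + (2 * i.+1).+1) by rewrite addnS /= oddD oa oddM.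
by rewrite mulf_eq0 pnatr_eq0 /= => /eqP.
Qed.

(** (2i - 1)!! / ((2p + 2)(2p + 4) ... (2p + 2i)): the factors that [moment_rec] produces when pairs
    <v, w>^2 are traded for pairs <v, u>^2. *)
Fixpoint moment_ratio (p i : nat) : R :=
  if i is j.+1 then (2 * j).+1%:R / (2 * p).+2%:R * moment_ratio p.+1 j else 1.

Lemma moment_even (w : V) p i : dotp u w = 0 ->
  M u w (2 * p) (2 * i) = moment_ratio p i * dotp w w ^+ i * M u 0 (2 * (p + i)) 0.
Proof.
move=> uw; elim: i p => [|i IH] p; first by rewrite muln0 addn0 expr0 !mul1r (moment_w0 u w 0).
have := @moment_rec w (2 * p) (2 * i).+1 uw; rewrite /= addnS /= addnS /= -mulnDr oddM /= => /(_ isT).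
have -> : (2 * i).+2 = (2 * i.+1)%N by rewrite mulnS.
have e : (2 * p).+2 = (2 * p.+1)%N by rewrite mulnS.
rewrite [in M u w (2 * p).+2]e IH addSnnS => H.
have p0 : (2 * p).+2%:R != 0 :> R by rewrite pnatr_eq0.
apply: (mulfI p0); rewrite H exprS.
by field.
Qed.

(** Inserts |v|^2 = 1 and splits every coordinate of v into its part along u and the rest, v_i = u_i
    <v, u> + <v, w_i>. The mixed terms vanish by parity, [moment_rec] reduces the squares of <v,
    w_i>, and the factors add up since the u_i^2 sum to 1. *)
Lemma moment_level (a : nat) : ~~ odd a ->
  a.+2%:R * M u 0 a 0 = (a + n.+2)%:R * M u 0 a.+2 0.
Proof.
move=> ea.
pose w (i : 'I_n.+1) : V := delta_mx ord0 i - u ord0 i *: u.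
have uw i : dotp u (w i) = 0 by rewrite dotpBr dotpZr dotp_delta u1; ring.
have vi (v : V) i : v ord0 i = u ord0 i * dotp v u + dotp v (w i).
  by rewrite dotpBr dotpZr dotp_delta; ring.
have ww i : dotp (w i) (w i) = 1 - u ord0 i ^+ 2.
  have := vi (w i) i; rewrite (dotpC (w i) u) uw mulr0 add0r => <-.
  by rewrite /w !mxE !eqxx /=; ring.
have u2 : \sum_i u ord0 i ^+ 2 = 1 by rewrite -u1; apply: eq_bigr => i _; rewrite expr2.
have aM (z : V) b q := admissible_moment u z b q.
have H : M u 0 a 0 = \sum_i (u ord0 i ^+ 2 * M u 0 a.+2 0 + 2 * u ord0 i * M u (w i) a.+1 1 + M u (w i) a 2).
  pose F i (v : V) := u ord0 i ^+ 2 * (`|dotp v u| * dotp v u ^+ a.+2 * dotp v 0 ^+ 0) +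
    2 * u ord0 i * (`|dotp v u| * dotp v u ^+ a.+1 * dotp v (w i) ^+ 1) +
    (`|dotp v u| * dotp v u ^+ a * dotp v (w i) ^+ 2).
  have aF1 i := admissibleM (admissible_cst (u ord0 i ^+ 2)) (aM 0 a.+2 0%N).
  have aF2 i := admissibleM (admissible_cst (2 * u ord0 i)) (aM (w i) a.+1 1%N).
  transitivity (J (fun v => \sum_i F i v)).
    apply: eq_chord_integral => v v1.
    transitivity (`|dotp v u| * dotp v u ^+ a * dotp v v); first by rewrite v1 expr0.
    rewrite /dotp mulr_sumr; apply: eq_bigr => i _.
    by rewrite -/(dotp v u) (vi v i) /F !exprS !expr0; ring.
  rewrite (chord_integral_sum Hmu); last first.
    by move=> i; exact: admissibleD (admissibleD (aF1 i) (aF2 i)) (aM _ _ _).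
  apply: eq_bigr => i _.
  rewrite (chord_integralD Hmu (admissibleD (aF1 i) (aF2 i)) (aM _ _ _)).
  rewrite (chord_integralD Hmu (aF1 i) (aF2 i)).
  by rewrite (chord_integralZ Hmu _ (aM _ _ _)) (chord_integralZ Hmu _ (aM _ _ _)).
rewrite H mulr_sumr.
transitivity (\sum_i (((a.+2%:R - 1) * u ord0 i ^+ 2 + 1) * M u 0 a.+2 0)).
  apply: eq_bigr => i _; rewrite (moment_odd_step (uw i)) /= ?ea//.
  have := @moment_rec (w i) a 1 (uw i); rewrite addn2 /= ea negbK => /(_ isT).
  by rewrite (moment_w0 u (w i) 0) ww mul1r 2!mulrDr => ->; ring.
rewrite -mulr_suml big_split /= -mulr_sumr u2 sumr_const card_ord; congr (_ * _).
by rewrite natrD -(natr1 n.+1) -(natr1 n) -(natr1 a.+1) -(natr1 a); ring.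
Qed.

End fixed_normal.
End moments.

(** * Evaluation of the moments *)

Section binomial_sums.
Context {R : realType}.

(* [4^p / C(2p, p)] *)
Fixpoint wallis (p : nat) : R :=
  if p is q.+1 then wallis q * ((2 * q).+2%:R / (2 * q).+1%:R) else 1.

Lemma wallis_neq0 p : wallis p != 0.
Proof. by elim: p => [|p IH] /=; rewrite ?oner_neq0// !mulf_neq0 ?invr_neq0 ?pnatr_eq0. Qed.

(** Trades the binomials of 2m for binomials of m at the price of Wallis factors. The sum over even
    exponents then becomes a linear form applied to an m-th power. *)
Lemma bin_moment_ratio p i : 'C(2 * (p + i), 2 * i)%:R * moment_ratio p i =
  'C(p + i, i)%:R * wallis p / wallis (p + i) :> R.
Proof.
elim: i p => [|i IH] p.
  by rewrite muln0 !bin0 addn0 /=; field; exact: wallis_neq0.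
have := IH p.+1; rewrite addSnnS.
have e2 : (2 * i.+1 = (2 * i).+2)%N by rewrite mulnS.
have b1 N k : (k.+1%:R * 'C(N, k.+1)%:R = (N - k)%N%:R * 'C(N, k)%:R :> R).
  by rewrite -!natrM; congr (_%:R); rewrite mul_bin_left.
have h1 := b1 (2 * (p + i.+1))%N (2 * i)%N; have h2 := b1 (2 * (p + i.+1))%N (2 * i).+1.
have h3 := b1 (p + i.+1)%N i.
rewrite (_ : 2 * (p + i.+1) - 2 * i = (2 * p).+2)%N in h1; last first.
  by rewrite -mulnBr -addSnnS addnK mulnS.
rewrite (_ : 2 * (p + i.+1) - (2 * i).+1 = (2 * p).+1)%N in h2; last first.
  by rewrite subnS -mulnBr -addSnnS addnK mulnS.
rewrite (_ : p + i.+1 - i = p.+1)%N in h3; last by rewrite -addSnnS addnK.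
rewrite /= e2; move: (wallis_neq0 (p + i.+1)) h1 h2 h3.
set W := wallis (p + i.+1); set A := 'C(_, (2 * i).+2)%:R; set B := 'C(_, (2 * i).+1)%:R.
set C := 'C(_, (2 * i))%:R; set D := 'C(_, i.+1)%:R; set E := 'C(_, i)%:R.
set m := moment_ratio p.+1 i; set w := wallis p => W0 h1 h2 h3 H.
have n1 : (2 * i).+2%:R != 0 :> R by rewrite pnatr_eq0.
have n2 : (2 * i).+1%:R != 0 :> R by rewrite pnatr_eq0.
have n3 : i.+1%:R != 0 :> R by rewrite pnatr_eq0.
have n4 : (2 * p).+1%:R != 0 :> R by rewrite pnatr_eq0.
have n5 : (2 * p).+2%:R != 0 :> R by rewrite pnatr_eq0.
have hB : B = (2 * p).+2%:R * C / (2 * i).+1%:R by rewrite -h1; field.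
have hA : A = (2 * p).+1%:R * B / (2 * i).+2%:R by rewrite -h2; field.
have hD : D = p.+1%:R * E / i.+1%:R by rewrite -h3; field.
have e3 : (2 * p).+2%:R = 2 * p.+1%:R :> R by rewrite -natrM mulnS.
have e4 : (2 * i).+2%:R = 2 * i.+1%:R :> R by rewrite -natrM mulnS.
rewrite hA hB hD.
transitivity ((2 * p).+1%:R / (2 * i).+2%:R * (C * m)); last first.
  rewrite H e3 e4; clearbody W E w; move: n3 n4 W0; clear.
  move: i.+1%:R (2 * p).+1%:R p.+1%:R => x y z x0 y0 W0.
  by field; rewrite ?x0 ?y0 ?W0.
clearbody C m; move: n1 n2 n5; clear.
move: (2 * i).+2%:R (2 * i).+1%:R (2 * p).+2%:R (2 * p).+1%:R => x y z t x0 y0 z0.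
by field; rewrite ?x0 ?y0 ?z0.
Qed.

(** The linear form X^i -> [wallis i] on polynomials of degree below N; it derives identities
    between Wallis sums from identities between polynomials. *)
Definition wallis_form (N : nat) (P : {poly R}) : R := \sum_(i < N) P`_i * wallis i.

Lemma wallis_formD N P Q : wallis_form N (P + Q) = wallis_form N P + wallis_form N Q.
Proof. by rewrite -big_split; apply: eq_bigr => i _; rewrite coefD mulrDl. Qed.

Lemma wallis_formZ N c P : wallis_form N (c *: P) = c * wallis_form N P.
Proof. by rewrite mulr_sumr; apply: eq_bigr => i _; rewrite coefZ mulrA. Qed.

Lemma wallis_form_sum N I (s : seq I) (P : I -> {poly R}) :
  wallis_form N (\sum_(i <- s) P i) = \sum_(i <- s) wallis_form N (P i).
Proof.
elim: s => [|i s IH]; last by rewrite !big_cons wallis_formD IH.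
by rewrite !big_nil /wallis_form big1// => i _; rewrite coef0 mul0r.
Qed.

Lemma wallis_formX N i : (i < N)%N -> wallis_form N 'X^i = wallis i.
Proof.
move=> iN; rewrite /wallis_form (bigD1 (Ordinal iN))//= coefXn eqxx mul1r big1 ?addr0//.
by move=> j /negPf ji; rewrite coefXn -(inj_eq val_inj) /= in ji *; rewrite ji mul0r.
Qed.

(** The ratio of the k-th difference at i to [wallis i]. Knowing it for all i is what allows the
    induction in [wallis_form_diff]. *)
Definition wallis_diff (k i : nat) : R :=
  \prod_(l < k) (((2 * l)%:R - 1) / (2 * (i + l)).+1%:R).

Lemma wallis_diffS k i : wallis_diff k.+1 i =
  wallis_diff k i * (((2 * k)%:R - 1) / (2 * (i + k)).+1%:R).
Proof. by rewrite /wallis_diff big_ord_recr. Qed.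

Lemma wallis_diff_shift k i : wallis_diff k i.+1 =
  wallis_diff k i * (2 * i).+1%:R / (2 * (i + k)).+1%:R.
Proof.
elim: k => [|k IH]; first by rewrite /wallis_diff !big_ord0 addn0 mul1r divff ?pnatr_eq0.
rewrite !wallis_diffS IH addSn addnS; set a := _.+1%:R; set b := (2 * (i + k)).+1%:R.
have a0 : a != 0 by rewrite pnatr_eq0.
have b0 : b != 0 by rewrite pnatr_eq0.
have c0 : (2 * (i + k).+1).+1%:R != 0 :> R by rewrite pnatr_eq0.
clearbody a b; move: b0 c0; move: (_.+1.+1%:R : R) => c b0 c0.
by field; rewrite ?b0 ?c0.
Qed.

(* [1 / (1 - 2k)] in the Crofton coefficients is the k-th finite difference of [wallis] at 0. *)
Lemma wallis_form_diff N k i : (k + i < N)%N ->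
  wallis_form N ((1 - 'X) ^+ k * 'X^i) = wallis i * wallis_diff k i.
Proof.
elim: k i => [|k IH] i kiN.
  by rewrite expr0 mul1r wallis_formX// /wallis_diff big_ord0 mulr1.
rewrite exprSr (_ : _ * _ = (1 - 'X) ^+ k * 'X^i + (-1) *: ((1 - 'X) ^+ k * 'X^(i.+1))); last first.
  by rewrite scaleN1r exprS; ring.
rewrite wallis_formD wallis_formZ !IH ?addnS//; last by rewrite ltnW.
rewrite wallis_diff_shift wallis_diffS /=.
have e1 : (2 * i).+1%:R = 2 * i%:R + 1 :> R by rewrite -natr1 natrM.
have e2 : (2 * i).+2%:R = 2 * i%:R + 2 :> R by rewrite -natr1 e1; ring.
have e3 : (2 * (i + k)).+1%:R = 2 * i%:R + 2 * k%:R + 1 :> R by rewrite -natr1 natrM natrD; ring.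
have p2 : (2 * i).+1%:R != 0 :> R by rewrite pnatr_eq0.
have p3 : (2 * (i + k)).+1%:R != 0 :> R by rewrite pnatr_eq0.
rewrite e1 in p2; rewrite e3 in p3; rewrite e1 e2 e3 natrM.
by field; rewrite p2 p3.
Qed.

Lemma one_sub_double_neq0 k : 1 - (2 * k)%:R != 0 :> R.
Proof. by rewrite subr_eq0 -[1]/(1%:R) eqr_nat; case: k => // k; rewrite mulnS. Qed.

(** The product of the (2l - 1)/(2l + 1) telescopes to - 1/(2k - 1). *)
Lemma wallis_diff0 k : wallis_diff k 0 = (1 - (2 * k)%:R)^-1.
Proof.
elim: k => [|k IH]; first by rewrite /wallis_diff big_ord0 muln0 subr0 invr1.
rewrite wallis_diffS IH add0n; have p1 := one_sub_double_neq0 k.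
have p2 : (2 * k).+1%:R != 0 :> R by rewrite pnatr_eq0.
have p3 := one_sub_double_neq0 k.+1; move: p1 p2 p3.
rewrite (_ : (2 * k.+1)%:R = (2 * k)%:R + 2 :> R); last by rewrite mulnS natrD addrC.
rewrite -(natr1 (2 * k)); set a := (2 * k)%:R => p1 p2 p3.
clearbody a; by field; rewrite ?p1 ?p2 ?p3.
Qed.

(** Two binomial expansions of one polynomial, T X + (Z - T) = Z - T (1 - X), evaluated by
    [wallis_form]. *)
Lemma wallis_binomial m (T Z : R) :
  \sum_(i < m.+1) 'C(m, i)%:R * wallis (m - i) * T ^+ (m - i) * (Z - T) ^+ i =
  \sum_(k < m.+1) (-1) ^+ k * 'C(m, k)%:R / (1 - (2 * k)%:R) * Z ^+ (m - k) * T ^+ k.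
Proof.
have e : (T *: 'X + (Z - T)%:P) ^+ m = (Z%:P + (- T) *: (1 - 'X)) ^+ m :> {poly R}.
  by congr (_ ^+ _); rewrite polyCB scalerBr scaleNr scaleNr opprK alg_polyC; ring.
have : wallis_form m.+1 ((T *: 'X + (Z - T)%:P) ^+ m) = wallis_form m.+1 ((Z%:P + (- T) *: (1 - 'X)) ^+ m).
  by rewrite e.
rewrite !exprDn !wallis_form_sum => H.
transitivity (\sum_(i < m.+1) wallis_form m.+1 ((T *: 'X) ^+ (m - i) * (Z - T)%:P ^+ i *+ 'C(m, i))).
  apply: eq_bigr => i _; rewrite -[X in wallis_form _ X]scaler_nat wallis_formZ exprZn -polyC_exp [_ * _%:P]mulrC mul_polyC.
  by rewrite !wallis_formZ wallis_formX ?ltnS ?leq_subr//; ring.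
rewrite H; apply: eq_bigr => k _; rewrite -[X in wallis_form _ X]scaler_nat wallis_formZ exprZn -polyC_exp mul_polyC.
rewrite !wallis_formZ -[(1 - 'X) ^+ k]mulr1 -(expr0 'X) wallis_form_diff ?addn0//.
rewrite wallis_diff0 (exprNn T) [wallis 0]/=; move: ((1 - _)^-1) => a.
by ring.
Qed.

End binomial_sums.

Section cosine_moments.
Context {R : realType} {n : nat}.
Local Notation V := 'rV[R]_n.+1.
Local Notation LS := (@line_space R n).
Variables (mu : {measure set LS -> \bar R}) (Hmu : is_line_measure mu).
Local Notation J := (chord_integral mu).
Local Notation M := (moment mu).

(** The quotients (2j + 2)/(2j + n + 2) of [moment_level] are split into this product and
    [wallis m], because the latter cancels the denominator in [bin_moment_ratio]. *)
Definition level_ratio (m : nat) : R := \prod_(j < m) ((2 * j).+1%:R / (2 * j + n.+2)%:R).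

Lemma moment_levels (u : V) m : dotp u u = 1 ->
  M u 0 (2 * m) 0 = M u 0 0 0 * level_ratio m * wallis m.
Proof.
move=> u1; elim: m => [|m IH]; first by rewrite muln0 /level_ratio big_ord0 !mulr1.
have := moment_level Hmu u1 (a := 2 * m); rewrite oddM /= => /(_ isT).
rewrite IH /level_ratio big_ord_recr /= mulnS.
have p1 : (2 * m).+1%:R != 0 :> R by rewrite pnatr_eq0.
have p2 : (2 * m + n.+2)%:R != 0 :> R by rewrite addnS pnatr_eq0.
have p3 : (2 * m).+2%:R != 0 :> R by rewrite pnatr_eq0.
move: p1 p2 p3; move: (2 * m).+1%:R (2 * m + n.+2)%:R (2 * m).+2%:R => x y z x0 y0 z0 H.
apply: (mulfI y0); rewrite -H; move: (\prod_(_ < _) _) => P.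
by field; rewrite ?x0 ?y0.
Qed.

Lemma sum_even_terms m (F : nat -> R) : (forall i, (i < m)%N -> F (2 * i).+1 = 0) ->
  \sum_(j < (2 * m).+1) F j = \sum_(i < m.+1) F (2 * i)%N.
Proof.
elim: m => [|m IH] F0; first by rewrite muln0 !big_ord_recr !big_ord0.
rewrite (_ : (2 * m.+1).+1 = (2 * m).+3); last by rewrite mulnS.
rewrite big_ord_recr big_ord_recr /= IH; last by move=> i im; apply: F0; rewrite ltnW.
by rewrite [RHS]big_ord_recr /= F0// addr0 mulnS.
Qed.

Definition crofton_kernel (m : nat) (Z T : R) : R :=
  \sum_(k < m.+1) (-1) ^+ k * 'C(m, k)%:R / (1 - (2 * k)%:R) * Z ^+ (m - k) * T ^+ k.

(** Expands <v, z> along z = b u + w with w orthogonal to u. Odd powers of <v, w> integrate to 0;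
    the even ones give the first sum of [wallis_binomial] with T = b^2 and Z - T = |w|^2. *)
Lemma chord_integral_cosine (u z : V) m : dotp u u = 1 ->
  J (fun v => `|dotp (v : V) u| * dotp (v : V) z ^+ (2 * m)) =
  M u 0 0 0 * level_ratio m * crofton_kernel m (dotp z z) (dotp u z ^+ 2).
Proof.
move=> u1; pose b := dotp u z; pose w : V := z - b *: u.
have uw : dotp u w = 0 by rewrite dotpBr dotpZr u1 mulr1 subrr.
have ww : dotp w w = dotp z z - b ^+ 2.
  by rewrite {1}/w dotpBl dotpZl uw mulr0 subr0 dotpBr dotpZr (dotpC z u) -/b expr2.
have vz (v : V) : dotp v z = b * dotp v u + dotp v w by rewrite dotpBr dotpZr; ring.
have aM j := admissibleM (admissible_cst ('C(2 * m, j)%:R * b ^+ (2 * m - j)))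
  (admissible_moment u w (2 * m - j) j).
pose F (j : nat) := 'C(2 * m, j)%:R * b ^+ (2 * m - j) * M u w (2 * m - j) j.
transitivity (\sum_(j < (2 * m).+1) F j).
  transitivity (J (fun v => \sum_(j < (2 * m).+1) 'C(2 * m, j)%:R * b ^+ (2 * m - j) *
    (`|dotp (v : V) u| * dotp (v : V) u ^+ (2 * m - j) * dotp (v : V) w ^+ j))).
    apply: eq_chord_integral => v _; rewrite vz exprDn mulr_sumr; apply: eq_bigr => j _.
    by rewrite -mulr_natl exprMn; ring.
  rewrite (chord_integral_sum Hmu) => [|j]; last exact: aM.
  apply: eq_bigr => j _.
  by rewrite (chord_integralZ Hmu _ (admissible_moment u w _ _)).
rewrite sum_even_terms; last first.
  move=> i im; rewrite /F (moment_odd Hmu u1)// ?mulr0//.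
  by rewrite oddB ?ltn_mul2l//= !oddM.
rewrite /crofton_kernel -wallis_binomial mulr_sumr; apply: eq_bigr => i _.
have im : (i <= m)%N by rewrite -ltnS.
rewrite /F -mulnBr (moment_even Hmu u1)// subnK// (moment_levels _ u1).
have := @bin_moment_ratio R (m - i) i; rewrite subnK// ww exprM -/b => H.
have -> : 'C(2 * m, 2 * i)%:R * (b ^+ 2) ^+ (m - i) * (moment_ratio (m - i) i * (dotp z z - b ^+ 2) ^+ i *
  (M u 0 0 0 * level_ratio m * wallis m)) = ('C(2 * m, 2 * i)%:R * moment_ratio (m - i) i) *
  ((b ^+ 2) ^+ (m - i) * ((dotp z z - b ^+ 2) ^+ i * (M u 0 0 0 * level_ratio m * wallis m))) by ring.
rewrite H; have w0 := @wallis_neq0 R m; move: (wallis m) w0 => W W0.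
by field.
Qed.

(* A half-angle rotation is available unless [u' = - u]. *)
Lemma moment0_const (u u' : V) : dotp u u = 1 -> dotp u' u' = 1 -> M u 0 0 0 = M u' 0 0 0.
Proof.
move=> u1 u'1; pose a := dotp u u'; pose w : V := u' - a *: u.
have u'E : u' = a *: u + w by rewrite /w addrC subrK.
have uw : dotp u w = 0 by rewrite dotpBr dotpZr u1 mulr1 subrr.
have ww : dotp w w = 1 - a ^+ 2.
  by rewrite {1}/w dotpBl dotpZl uw mulr0 subr0 dotpBr dotpZr (dotpC u' u) -/a u'1 expr2.
have [w0|w0] := eqVneq w 0.
  have a2 : a ^+ 2 = 1 by apply/eqP; rewrite eq_sym -subr_eq0 -ww w0 dotp0l.
  have na : `|a| = 1 by apply/eqP; rewrite -(@eqrXn2 _ 2)// real_normK ?num_real// a2 expr1n.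
  apply: eq_chord_integral => v _; rewrite !expr0 u'E w0 addr0 dotpZr normrM na; ring.
have wn0 : enorm w != 0 by rewrite enorm_eq0.
pose e := (enorm w)^-1 *: w.
have we : w = enorm w *: e by rewrite scalerA divff// scale1r.
have e1 : dotp e e = 1 by rewrite dotpZl dotpZr -sqr_enorm; field.
have ue : dotp u e = 0 by rewrite dotpZr uw mulr0.
have s2 : enorm w ^+ 2 = 1 - a ^+ 2 by rewrite sqr_enorm.
have a1 : -1 < a.
  have : 0 < enorm w ^+ 2 by rewrite exprn_gt0// lt_def wn0 enorm_ge0.
  by rewrite s2; nra.
pose c := Num.sqrt ((1 + a) / 2).
have c2 : c ^+ 2 = (1 + a) / 2 by rewrite sqr_sqrtr//; lra.
have c0 : c != 0 by rewrite gt_eqF// sqrtr_gt0; lra.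
(* Chosen so that 2 c s = - |w|; the sign is negative because the rotation acts on v and not on
   u. *)
pose s := - enorm w / (2 * c).
have s2' : s ^+ 2 = (1 - a) / 2.
  have -> : s ^+ 2 = enorm w ^+ 2 / (4 * c ^+ 2) by rewrite /s; field.
  rewrite s2 c2; field; lra.
have cs : c ^+ 2 + s ^+ 2 = 1 by rewrite c2 s2'; lra.
have aF := admissible_moment u (0 : V) 0 0.
have FN (v : V) : `|dotp (- v) u| * dotp (- v) u ^+ 0 * dotp (- v) 0 ^+ 0 =
  `|dotp v u| * dotp v u ^+ 0 * dotp v 0 ^+ 0 by rewrite !expr0 dotpNl normrN.
rewrite /moment -(chord_integral_plane Hmu u1 e1 ue cs aF FN).
apply: eq_chord_integral => v _; rewrite !expr0 !mulr1; congr (`| _ |).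
clearbody e; rewrite (mulmxA v) (plane_rot_u u1 ue) (plane_rot_u u1 ue) (plane_rot_e e1 ue).
rewrite u'E we dotpDr !dotpZr.
transitivity ((c ^+ 2 - s ^+ 2) * dotp v u - 2 * c * s * dotp v e); first by ring.
rewrite c2 s2' (_ : 2 * c * s = - enorm w); last by rewrite /s; field.
by field.
Qed.

End cosine_moments.

(** * Values of support measures *)

Lemma coef_unique (R : realType) N (p q : nat -> R) :
  (forall eps : R, 0 < eps -> \sum_(j < N) p j * eps ^+ j = \sum_(j < N) q j * eps ^+ j) ->
  forall j, (j < N)%N -> p j = q j.
Proof.
move=> H j jN; pose P : {poly R} := \poly_(i < N) (p i - q i).
suff P0 : P = 0.
  by have := congr1 (fun Q : {poly R} => Q`_j) P0; rewrite coef_poly jN coef0 => /eqP; rewrite subr_eq0 => /eqP.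
(* The equality is known for positive eps only, so 1, ..., N serve as the N distinct roots. *)
pose rs : seq R := [seq i.+1%:R | i <- iota 0 N].
apply: (@roots_geq_poly_eq0 _ P rs).
- apply/allP => _ /mapP[i _ ->]; rewrite /root horner_poly.
  have := H i.+1%:R (ltr0Sn R i); move/eqP; rewrite -subr_eq0 -sumrB => /eqP e.
  by apply/eqP; rewrite -[RHS]e; apply: eq_bigr => k _; rewrite mulrBl.
- by rewrite map_inj_uniq ?iota_uniq// => a b /eqP; rewrite eqr_nat => /eqP [].
- by rewrite size_map size_iota size_poly.
Qed.

Section steiner_values.
Context {R : realType} {n : nat}.
Local Notation V := 'rV[R]_n.+1.
Local Notation d := n.+1.
Variables (Lambda : nat -> set V -> {measure set (@support_space R n.+1) -> \bar R}).
Hypothesis HLambda : is_support_measures Lambda.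

Lemma borel_pair_measurable (C : set (V * V)) :
  closed C -> measurable (C : set (@support_space R d)).
Proof.
move=> cC; rewrite -(setCK C); apply: measurableC; apply: sub_sigma_algebra.
by rewrite openC.
Qed.

Lemma leb_bounded_lty (A : set (borel V)) B :
  measurable A -> (forall x, A x -> enorm (x : V) <= B) -> (leb d A < +oo)%E.
Proof.
move=> mA AB; have r0 : 0 < `|B| + 1 by rewrite ltr_wpDl.
apply: (@le_lt_trans _ _ (leb d [set x | enorm x <= `|B| + 1])); last by rewrite leb_ball// ltry.
apply: le_measure; rewrite ?inE//.
  apply: (@borel_closed V); rewrite (_ : [set x | _] = (fun x : V => enorm x) @^-1` [set r | r <= `|B| + 1])//.
  by apply: preimage_closed; [move=> x _; exact: enorm_continuous|exact: closed_le].
by move=> x /AB /le_trans; apply; apply: le_trans (ler_norm B) _; rewrite lerDl.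
Qed.

Section body.
Variable K : set V.
Hypotheses (cK : convex_body K) (K0 : K !=set0).

Lemma steiner_shell (A : set (@support_space R d)) eps : measurable A -> 0 < eps ->
  lebesgue_rV (shell K eps `&` [set x | A (metric_proj K x, outer_unit K x)]) =
  (\sum_(k < d) (@steiner_coef R n eps k)%:E * Lambda k K A)%E.
Proof.
by move=> mA e0; have := HLambda.1 K cK K0 eps e0 A mA; rewrite shellE.
Qed.

Lemma steiner_coef_pos eps k : 0 < eps -> 0 < @steiner_coef R n eps k :> R.
Proof. by move=> e0; rewrite mulr_gt0 ?exprn_gt0 ?kappa_gt0. Qed.

(** The normals of points off K are unit vectors, so the left side of the Steiner formula is the
    measure of the empty set; the terms on the right are nonnegative with positive coefficients. *)
Lemma support_sphere k : (k < d)%N -> Lambda k K [set xu | enorm xu.2 != 1] = 0%E.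
Proof.
move=> kd; have mA : measurable ([set xu | enorm xu.2 != 1] : set (@support_space R d)).
  rewrite (_ : mkset _ = ~` ((fun xu : V * V => enorm xu.2) @^-1` [set 1])).
    apply: measurableC; apply: borel_pair_measurable; apply: preimage_closed; last exact: closed_eq.
    move=> [x v] _; apply: (continuous_comp (f := snd)); first exact: cvg_snd.
    exact: enorm_continuous.
  by apply/seteqP; split => xu /=; [move/eqP|move/eqP].
have := steiner_shell mA ltr01.
rewrite (_ : _ `&` _ = set0); last first.
  apply/seteqP; split => // x [/andP[x0 _]] /=; rewrite (_ : enorm _ = 1) ?eqxx//.
  exact/enorm1/outer_unit_unit.
rewrite -(lebE measurable0) measure0 (bigD1 (Ordinal kd))//= => e0.
have : ((@steiner_coef R n 1 k)%:E * Lambda k K [set xu | enorm xu.2 != 1%R] <= 0)%E.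
  rewrite e0 leeDl// sume_ge0// => i _.
  by rewrite mule_ge0// lee_fin ltW// steiner_coef_pos.
rewrite pmule_rle0 ?lte_fin ?steiner_coef_pos// => h.
by apply/le_anti; rewrite h measure_ge0.
Qed.

(** At eps = 1 each term of the Steiner formula is at most the volume of a bounded shell. *)
Lemma support_fin k (A : set (@support_space R d)) : (k < d)%N -> measurable A ->
  Lambda k K A \is a fin_num.
Proof.
move=> kd mA; rewrite ge0_fin_numE//.
apply: (@le_lt_trans _ _ (Lambda k K setT)); first by apply: le_measure; rewrite ?inE.
have [B HB] := compact_enorm_bound cK.1.
have ms := shell_measurable cK K0 1.
have : (leb d (shell K 1) < +oo)%E.
  apply: (leb_bounded_lty (B := 1 + B)) => // x /andP[_ x1].
  rewrite -[x](subrK (metric_proj K x)); apply: le_trans (enormD _ _) _.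
  by apply: lerD => //; apply: HB; exact: (metric_proj_in cK K0).
have := steiner_shell measurableT ltr01; rewrite (_ : _ `&` _ = shell K 1); last first.
  by apply/seteqP; split => // x [].
rewrite -lebE// => ->; rewrite (bigD1 (Ordinal kd))//= => h2.
have {h2} : ((@steiner_coef R n 1 k)%:E * Lambda k K setT < +oo)%E.
  apply: le_lt_trans h2; rewrite leeDl// sume_ge0// => i _.
  by rewrite mule_ge0// lee_fin ltW// steiner_coef_pos.
rewrite !ltey; apply: contra => /eqP ->.
by rewrite gt0_muley// lte_fin steiner_coef_pos.
Qed.

(** Reads off support measures from a volume known as a polynomial in eps. Finiteness of the
    measures permits comparing real coefficients. *)
Lemma steiner_polynomial (A : set (@support_space R d)) (P : nat -> R) : measurable A ->
  (forall eps, 0 < eps ->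
     lebesgue_rV (shell K eps `&` [set x | A (metric_proj K x, outer_unit K x)]) =
     (\sum_(k < d) eps ^+ (d - k) * P k)%:E) ->
  forall k, (k < d)%N -> Lambda k K A = (P k / kappa (d - k))%:E.
Proof.
move=> mA H k kd.
(* Dividing by eps and reversing the order of summation turns the exponent d - k into j = n - k. *)
have H2 (eps : R) : 0 < eps -> \sum_(j < d) kappa (j.+1) * fine (Lambda (n - j) K A) * eps ^+ j =
    \sum_(j < d) P (n - j)%N * eps ^+ j.
  move=> e0; have := H eps e0; rewrite steiner_shell//.
  under eq_bigr => i _ do rewrite -[Lambda i K A]fineK ?support_fin// -EFinM.
  rewrite sumEFin => -[e]; apply: (mulfI (lt0r_neq0 e0)).
  rewrite !mulr_sumr (reindex_inj rev_ord_inj) [RHS](reindex_inj rev_ord_inj) /=.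
  have := e; under eq_bigr => i _ do rewrite /steiner_coef mulrAC.
  move=> {}e; transitivity (\sum_(i < d) eps ^+ (d - i) * fine (Lambda i K A) * kappa (d - i)).
    apply: eq_bigr => i _; rewrite subSS subKn ?subSn -1?ltnS//; last first.
    by rewrite exprS; ring.
  rewrite e; apply: eq_bigr => i _; rewrite subSS subKn -1?ltnS// subSn -1?ltnS//.
  by rewrite exprS; ring.
have := @coef_unique R d (fun j => kappa j.+1 * fine (Lambda (n - j) K A)) (fun j => P (n - j)%N) H2 (n - k)%N; rewrite ltnS leq_subr => /(_ isT).
rewrite subKn -1?ltnS// -subSn -1?ltnS// => <-.
have kp := @kappa_gt0 R (d - k).
by rewrite mulrAC divff ?gt_eqF// mul1r fineK// support_fin.
Qed.

End body.

Lemma unit_ball_convex_body : convex_body (@unit_ball R d).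
Proof.
split; first exact: unit_ball_compact.
move=> x y l /set_mem x1 /set_mem y1; apply/mem_set; rewrite /unit_ball /=.
rewrite /conv /= /unstable.onem.
have l0 : 0 <= l%:num by [].
have l1 : l%:num <= 1 by [].
apply: le_trans (enormD _ _) _; rewrite !enormZ (ger0_norm l0) ger0_norm ?subr_ge0//.
move: x1 y1; rewrite /unit_ball /= => x1 y1.
have h1 : l%:num * enorm (x : V) <= l%:num by rewrite ler_piMr.
have h2 : (1 - l%:num) * enorm (y : V) <= 1 - l%:num by rewrite ler_piMr// subr_ge0.
lra.
Qed.

Lemma unit_ball_neq0 : @unit_ball R d !=set0.
Proof. by exists 0; rewrite /unit_ball /= enorm0. Qed.

Lemma parallel_unit_ball eps : 0 < eps ->
  parallel_body (@unit_ball R d) eps = [set x | enorm x <= 1 + eps].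
Proof.
move=> e0; apply/seteqP; split => x /=.
  move=> [y y1 [b b1 ->]]; apply: le_trans (enormD _ _) _; apply: lerD => //.
  by rewrite enormZ gtr0_norm// ler_piMr// ltW.
move=> x1; pose y := (1 + eps)^-1 *: x; have e1 : 0 < 1 + eps by rewrite addr_gt0.
have y1 : unit_ball d y.
  by rewrite /unit_ball /= enormZ gtr0_norm ?invr_gt0// mulrC ler_pdivrMr// mul1r.
exists y => //; exists y => //.
by rewrite -[y in y + _]scale1r -scalerDl scalerA divff ?scale1r// gt_eqF.
Qed.

Lemma support_ball_total : Lambda n (unit_ball d) setT = (d%:R * kappa d / 2)%:E.
Proof.
have cB := unit_ball_convex_body; have B0 := unit_ball_neq0.
have mball r : measurable ([set x | enorm x <= r] : set (borel V)).
  apply: (@borel_closed V); rewrite (_ : [set x | _] = (fun x : V => enorm x) @^-1` [set t | t <= r])//.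
  by apply: preimage_closed; [move=> x _; exact: enorm_continuous|exact: closed_le].
(* The shell of the ball has volume kappa_d ((1 + eps)^d - 1), and the coefficient of eps^(d - k) in
   the bracket is the binomial of d over k. *)
rewrite (steiner_polynomial cB B0 (P := fun k => kappa d * 'C(d, k)%:R) measurableT)//; last first.
  move=> eps e0; rewrite (_ : _ `&` _ = shell (unit_ball d) eps); last first.
    by apply/seteqP; split => // x [].
  rewrite -shellE// parallel_unit_ball// -lebE; last by apply: measurableD; exact: mball.
  have e1 : 0 < 1 + eps by rewrite addr_gt0.
  have lB (r : R) : 0 < r -> leb d [set x | enorm x <= r] = (r ^+ d * kappa d)%:E by exact: leb_ball.
  rewrite measureD; [|exact: mball|exact: (mball 1)|by rewrite [X in (X < _)%E]lB// ltry].
  rewrite setIidr; last by move=> x; rewrite /unit_ball /= => /le_trans; apply; rewrite lerDl ltW.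
  rewrite [X in (X - _)%E]lB// [X in (_ - X)%E](lB 1 ltr01) -EFinB; congr EFin.
  rewrite expr1n mul1r [1 + eps]addrC exprDn big_ord_recr /= subnn expr0 expr1n mul1r binn mulr1n.
  rewrite mulrDl mul1r addrK mulr_suml; apply: eq_bigr => k _.
  by rewrite expr1n mulr1 -mulr_natr; ring.
by rewrite subSnn kappa1 binSn [kappa _ * _]mulrC.
Qed.

End steiner_values.

(** * Volumes of half balls *)

Section half_ball.
Context {R : realType} {n : nat}.
Local Notation V := 'rV[R]_n.+1.
Local Notation RM := (measurableTypeR R).
Local Notation d := n.+1.
Variable v : V.
Hypothesis v1 : dotp v v = 1.

Lemma dotp_measurable (w : V) : measurable_fun setT (fun x : borel V => dotp (x : V) w).
Proof. by apply: measurable_dotp; [exact: measurable_id|exact: measurable_cst]. Qed.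

Lemma enorm_measurable : measurable_fun setT (fun x : borel V => enorm (x : V)).
Proof. by apply: (@continuous_borelR R V); exact: enorm_continuous. Qed.

Lemma ball_measurable r : measurable ([set x | enorm x <= r] : set (borel V)).
Proof.
rewrite (_ : [set x | _] = (fun x : borel V => enorm (x : V)) @^-1` `]-oo, r]).
  by rewrite -[X in measurable X]setTI; apply: enorm_measurable.
by apply/seteqP; split => x /=; rewrite in_itv.
Qed.

Lemma half_space_measurable : measurable ([set x | 0 < dotp x v] : set (borel V)).
Proof.
rewrite (_ : [set x | _] = (fun x : borel V => dotp (x : V) v) @^-1` `]0, +oo[).
  by rewrite -[X in measurable X]setTI; apply: dotp_measurable.
by apply/seteqP; split => x /=; rewrite in_itv /= andbT.
Qed.

Lemma hyperplane_measurable : measurable ([set x | dotp x v = 0] : set (borel V)).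
Proof.
rewrite (_ : [set x | _] = (fun x : borel V => dotp (x : V) v) @^-1` [set 0])//.
by rewrite -[X in measurable X]setTI; apply: dotp_measurable.
Qed.

(* Translates of the hyperplane along its normal meet each normal line in one point. *)
Lemma hyperplane_null : leb d [set x | dotp x v = 0] = 0%E.
Proof.
set H := [set x | _]; have mH : measurable (H : set (borel V)) := hyperplane_measurable.
pose F (p : borel V * RM) : \bar R :=
  (\1_(H : set (borel V)) ((p.1 : V) + p.2 *: v) * \1_(`[0, 1]%classic : set RM) p.2)%:E.
have mI := measurable_indic (R := R) mH.
have mF : measurable_fun setT F.
  apply/measurable_EFinP; apply: measurable_funM.
    apply: (measurableT_comp (mI setT)); apply: measurable_rVD; first exact: measurable_fst.
    by apply: measurable_rVZ; [exact: measurable_snd|exact: measurable_cst].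
  have mJ := measurable_indic (R := R) (measurable_itv (`[0, 1] : interval R)).
  exact: (measurableT_comp (mJ setT) measurable_snd).
have F0 p : (0 <= F p)%E by rewrite lee_fin mulr_ge0.
have := @fubini_tonelli _ _ _ _ _ (leb d) (@lebesgue_measure R) F mF F0.
rewrite [LHS]integral0_eq; last first.
  move=> y _; rewrite (_ : (fun t => F (y, t)) = fun t => (\1_(`[0, 1]%classic `&` [set - dotp (y : V) v]) t)%:E).
    rewrite integral_indicT; last by apply: measurableI.
    apply/eqP; rewrite eq_le measure_ge0 andbT.
    apply: (@le_trans _ _ (lebesgue_measure [set - dotp (y : V) v])).
      by apply: le_measure; rewrite ?inE//; apply: measurableI.
    by rewrite lebesgue_measure_set1.
  apply/funext => t; rewrite /F /= indicI /= mulrC; congr (_ * _)%:E.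
  rewrite !indicE; congr (_%:R); congr nat_of_bool; apply/idP/idP; rewrite !inE /H /= dotpDl dotpZl v1 mulr1.
    by move/eqP; rewrite addrC addr_eq0 => /eqP.
  by move=> ->; rewrite subrr.
move=> /esym <-.
transitivity (\int[lebesgue_measure]_t (leb d H * (\1_(`[0, 1]%classic : set RM) t)%:E))%E.
  rewrite ge0_integralZl//; last exact: (@measurable_EFin_indic _ _ RM _ (measurable_itv _)).
  rewrite integral_indicT; last exact: measurable_itv.
  rewrite [X in (_ * X)%E]lebesgue_measure_itv /= lte_fin ltr01 oppr0 adde0 mule1//.
apply: eq_integral => t _; rewrite /F.
pose f (x : borel V) : \bar R := ((\1_H x)%:E * (\1_(`[0, 1]%classic : set RM) t)%:E)%E.
have mf : measurable_fun setT f.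
  by apply: emeasurable_funM; [exact: measurable_EFin_indic|exact: measurable_cst].
have f0 x : (0 <= f x)%E by rewrite mule_ge0// lee_fin.
transitivity (\int[leb d]_x f x)%E; last first.
  by rewrite -(ge0_integral_leb_shift (t *: v) mf f0); apply: eq_integral => y _; rewrite /f -EFinM.
rewrite ge0_integralZr//; last exact: measurable_EFin_indic.
by rewrite integral_indicT.
Qed.

(** The reflection x -> - x exchanges the two open halves, and the hyperplane between them is
    null. *)
Lemma half_ball r : 0 < r ->
  leb d ([set x | enorm x <= r] `&` [set x | 0 < dotp x v]) = (r ^+ d * kappa d / 2)%:E.
Proof.
move=> r0; set B := [set x | enorm x <= r].
set A := B `&` _; pose C := [set x : borel V | A (- (x : V))].
have mB : measurable (B : set (borel V)) by exact: ball_measurable.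
have mA : measurable (A : set (borel V)) by apply: measurableI => //; exact: half_space_measurable.
have mC : measurable C.
  rewrite -[X in measurable X]setTI; apply: (measurable_rVN (f := @id (borel V))) => //; exact: measurable_id.
have mH : measurable (B `&` [set x | dotp x v = 0] : set (borel V)).
  by apply: measurableI => //; exact: hyperplane_measurable.
have : leb d B = (leb d A + leb d C)%E.
  rewrite (_ : B = A `|` C `|` (B `&` [set x | dotp x v = 0])); last first.
    apply/seteqP; split => x.
      move=> Bx; have [h|h|h] := ltgtP 0 (dotp x v); last by right.
        by left; left.
      by left; right; split; rewrite /B /= ?enormN// dotpNl oppr_gt0.
    by move=> [[[]//|[]]|[]//]; rewrite /B /= enormN.
  rewrite measureU//; [|exact: measurableU|]; last first.
    apply/seteqP; split => // x [[[_ /= h]|[_ /= h]] [_ /= e]].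
      by rewrite e ltxx in h.
    by rewrite dotpNl e oppr0 ltxx in h.
  rewrite measureU//; last first.
    apply/seteqP; split => // x [[_ /= h] [_ /=]]; rewrite dotpNl oppr_gt0 => h'.
    by have := lt_trans h h'; rewrite ltxx.
  have H0 : leb d (B `&` [set x | dotp x v = 0]) = 0%E.
    apply/eqP; rewrite eq_le measure_ge0 andbT.
    rewrite -hyperplane_null; apply: le_measure; rewrite ?inE//; exact: hyperplane_measurable.
  exact: etrans (congr1 (fun z => (leb d A + leb d C + z)%E) H0) (adde0 _).
rewrite (leb_opp mA) leb_ball//.
have fA : leb d A \is a fin_num.
  rewrite ge0_fin_numE//; apply: (leb_bounded_lty mA (B := r)) => x [].
  by [].
rewrite -(fineK fA) -EFinD => h; have h' := EFin_inj h; congr EFin; lra.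
Qed.

End half_ball.

(** * The relative tensor of a section by a line *)

Section relative.
Context {R : realType} {n : nat}.
Local Notation V := 'rV[R]_n.+1.
Local Notation LS := (@line_space R n).
Local Notation d := n.+1.
Variables (Lambda : nat -> set V -> {measure set (@support_space R n.+1) -> \bar R}).
Hypothesis HLambda : is_support_measures Lambda.
Local Notation SS := (@support_space R n.+1).

Section line_geometry.
Variables (E : LS) (v : V).
Hypotheses (v1 : dotp v v = 1).

(** The normalized projection onto the direction of a line, made explicit. It takes the value 0 for
    u orthogonal to v, which the restriction in [relative_measure] excludes. *)
Definition line_normal (xu : SS) : SS := (xu.1, Num.sg (dotp xu.2 v) *: v).

Variables (x0 : V) (Ev : line_set E = line_through x0 v).

Lemma fst_borel_measurable : measurable_fun [set: SS] (fst : SS -> borel V).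
Proof.
apply: measurable_fun_borel => U oU; apply: sub_sigma_algebra.
by apply: open_comp => // -[x w] _; exact: cvg_fst.
Qed.

Lemma line_set_measurable : measurable (line_set E : set (borel V)).
Proof.
pose g (y : borel V) : borel V := ((y : V) - x0) + - (dotp (y : V) v *: v) + (dotp x0 v) *: v.
have mg : measurable_fun setT (fun y => enorm (g y : V)).
  apply: (measurableT_comp (@enorm_measurable R n)); apply: measurable_rVD; last exact: measurable_cst.
  apply: measurable_rVD.
    by apply: measurable_rVD; [exact: measurable_id|exact: measurable_cst].
  apply: measurable_rVN; apply: measurable_rVZ; [exact: dotp_measurable|exact: measurable_cst].
rewrite (_ : line_set E = (fun y => enorm (g y : V)) @^-1` [set 0]).
  by rewrite -[X in measurable X]setTI; apply: mg.
rewrite Ev; apply/seteqP; split => y /=.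
  move=> [t ->]; apply/eqP; rewrite enorm_eq0 /g dotpDl dotpZl v1; apply/eqP/rowP => i.
  by rewrite !mxE; ring.
move=> /eqP; rewrite enorm_eq0 /g => /eqP e; exists (dotp y v - dotp x0 v).
rewrite -[LHS]subr0 -{1}e; apply/rowP => i; rewrite !mxE; ring.
Qed.

Lemma direction_line u : direction (line_set E) u <-> exists t : R, u = t *: v.
Proof.
rewrite Ev; split => [[_ [_ [[s ->] [t ->] ->]]]|[t ->]].
  by exists (s - t); apply/rowP => i; rewrite !mxE; ring.
exists (x0 + t *: v), x0; split; [by exists t|by exists 0; rewrite scale0r addr0|].
by rewrite addrC addKr.
Qed.

Lemma orth_compl_line u : orth_compl (direction (line_set E)) u <-> dotp u v = 0.
Proof.
split => [H|uv w /direction_line[t ->]]; last by rewrite dotpZr uv mulr0.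
by apply: H; apply/direction_line; exists 1; rewrite scale1r.
Qed.

Lemma orth_proj_line u : orth_proj (direction (line_set E)) u = dotp u v *: v.
Proof.
rewrite /orth_proj; set P := [set w | _].
have Pw w : P w -> w = dotp u v *: v.
  move=> [/direction_line[t ->] /orth_compl_line].
  by rewrite dotpBl dotpZl v1 mulr1 => /subr0_eq ->.
apply: Pw; apply: (@getPex _ P); exists (dotp u v *: v); split; first by apply/direction_line; exists (dotp u v).
by apply/orth_compl_line; rewrite dotpBl dotpZl v1 mulr1 subrr.
Qed.

Lemma normalize_line (a : R) : normalize (a *: v) = Num.sg a *: v.
Proof.
rewrite /normalize enormZ (_ : enorm v = 1) ?mulr1; last exact/enorm1.
rewrite scalerA; congr (_ *: _); have [->|a0] := eqVneq a 0; first by rewrite mulr0 sgr0.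
by rewrite [in X in _ * X](numEsg a) mulrCA mulVf ?mulr1// normr_eq0.
Qed.

Lemma sphere_direction u : (unit_sphere d `&` direction (line_set E)) u <-> u = v \/ u = - v.
Proof.
split.
  move=> [u1 /direction_line[t ut]]; move: u1; rewrite /unit_sphere /= ut enormZ (_ : enorm v = 1); last exact/enorm1.
  rewrite mulr1; have [t0|t0] := leP 0 t; first by rewrite ger0_norm// => ->; left; rewrite scale1r.
  by rewrite ltr0_norm// => /eqP; rewrite eqr_oppLR => /eqP ->; right; rewrite scaleN1r.
have e1 : enorm v = 1 by exact/enorm1.
case=> ->; split; rewrite /unit_sphere /= ?enormN//; apply/direction_line.
  by exists 1; rewrite scale1r.
by exists (-1); rewrite scaleN1r.
Qed.

(** The sign takes three values. Where it equals a, the map is (x, u) -> (x, a v), so the preimage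
    of an open set is cut out by an open condition on x and a sign condition on u. *)
Lemma line_normal_measurable : measurable_fun [set: SS] (line_normal : SS -> SS).
Proof.
apply: (@measurability _ _ SS SS setT line_normal (@open (V * V)%type)) => // _ [U oU <-].
rewrite setTI.
pose c (a : R) : set SS := fst @^-1` [set x : V | U (x, a *: v)].
have mc a : measurable (c a).
  apply: sub_sigma_algebra; apply: open_comp => [[x w] _|]; first exact: cvg_fst.
  apply: (@open_comp _ _ (fun x : V => (x, a *: v)) U) => // x _.
  by apply: (@pair_continuous R n V id (fun=> a *: v) x); [exact: cvg_id|exact: cst_continuous].
have msnd (A : set (borel V)) : measurable A -> measurable (snd @^-1` A : set SS).
  by move=> mA; rewrite -[X in measurable X]setTI; apply: snd_borel_measurable.
rewrite (_ : _ @^-1` _ = (c 1 `&` snd @^-1` [set u | 0 < dotp u v]) `|`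
  ((c 0 `&` snd @^-1` [set u | dotp u v = 0]) `|` (c (-1) `&` snd @^-1` [set u | 0 < dotp u (- v)]))).
  apply: measurableU; first by apply: measurableI => //; apply: msnd; exact: half_space_measurable.
  apply: measurableU; apply: measurableI => //; apply: msnd; first exact: hyperplane_measurable.
  exact: half_space_measurable.
apply/seteqP; split => -[x u]; rewrite /line_normal /c /=.
  have [h|h|h] := ltgtP 0 (dotp u v).
  - by rewrite gtr0_sg//; left.
  - by rewrite ltr0_sg//; right; right; split; rewrite // dotpNr oppr_gt0.
  - by rewrite -h sgr0; right; left.
case=> [[h u0]|[[h u0]|[h u0]]].
- by rewrite gtr0_sg.
- by rewrite u0 sgr0.
- by move: u0; rewrite dotpNr oppr_gt0 => u0; rewrite ltr0_sg.
Qed.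

End line_geometry.

Section on_a_line.
Variables (E : LS) (L : set V) (v : V).
Hypotheses (cL : convex_body L) (L0 : L !=set0) (LE : L `<=` line_set E)
  (v1 : dotp v v = 1) (x0 : V) (Ev : line_set E = line_through x0 v).

(* Beyond the endpoint [b] of the segment, the shell is a half ball. *)
Lemma shell_half_ball : exists b : V, forall eps, 0 < eps ->
  shell L eps `&` [set y | 0 < dotp (outer_unit L y) v] =
  [set y | ([set x | enorm x <= eps] `&` [set x | 0 < dotp x v]) (y - b)].
Proof.
have cd : {within L, continuous (fun y : V => dotp y v)}.
  by apply: continuous_subspaceT => y; exact: dotpl_continuous.
have [b /set_mem Lb bmax] := EVT_max_rV L0 cL.1 cd; exists b => eps e0.
have onL q : L q -> exists2 t, 0 <= t & q = b - t *: v.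
  move=> Lq; have := LE Lq; have := LE Lb; rewrite Ev => -[s bE] [t qE].
  exists (s - t); last by rewrite qE bE; apply/rowP => i; rewrite !mxE; ring.
  have := bmax q (mem_set Lq); rewrite qE bE !dotpDl !dotpZl v1; lra.
have low y q : L q -> 0 < dotp (y - b) v -> dotp (y - b) (q - b) <= 0.
  move=> /onL[t t0 ->] yb; rewrite addrAC subrr add0r dotpNr dotpZr oppr_le0.
  by rewrite mulr_ge0// ltW.
apply/seteqP; split => y /=.
  move=> [/andP[d0 de] uv]; have pv : 0 < dotp (y - metric_proj L y) v.
    by move: uv; rewrite outer_unitE dotpZl pmulr_rgt0// invr_gt0.
  suff pb : metric_proj L y = b by move: de pv; rewrite /pdist pb => de pv; split.
  have [t t0 pE] := onL _ (metric_proj_in cL L0 y).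
  have := metric_proj_var cL L0 y Lb; rewrite {2}pE opprB addrCA subrr addr0 dotpZr.
  rewrite pmulr_lle0// => t0'; have t00 : t = 0 by apply/le_anti; rewrite t0' t0.
  by rewrite pE t00 scale0r subr0.
move=> [ye yv]; have pb : metric_proj L y = b.
  by apply: metric_proj_uniq => // q Lq; exact: low.
have yb : 0 < pdist L y.
  rewrite lt_def pdist_ge0 andbT /pdist pb enorm_eq0; apply/eqP => e.
  by rewrite e dotp0l ltxx in yv.
split; first by rewrite /shell /= yb /pdist pb.
by rewrite /= outer_unitE dotpZl pb mulr_gt0// invr_gt0.
Qed.

Definition upper_normals : set SS :=
  [set xu | line_set E xu.1 /\ enorm xu.2 = 1 /\ 0 < dotp xu.2 v].

Lemma upper_normals_measurable : measurable upper_normals.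
Proof.
have mfst (A : set (borel V)) : measurable A -> measurable (fst @^-1` A : set SS).
  by move=> mA; rewrite -[X in measurable X]setTI; apply: fst_borel_measurable.
have msnd (A : set (borel V)) : measurable A -> measurable (snd @^-1` A : set SS).
  by move=> mA; rewrite -[X in measurable X]setTI; apply: snd_borel_measurable.
apply: measurableI; first exact: (mfst _ (line_set_measurable v1 Ev)).
apply: measurableI; last exact: (msnd _ (half_space_measurable v)).
apply: (msnd [set u | enorm u = 1]).
rewrite (_ : [set u | _] = (fun u : borel V => enorm (u : V)) @^-1` [set 1])//.
by rewrite -[X in measurable X]setTI; apply: enorm_measurable.
Qed.

(** By [shell_half_ball] the relevant volume is kappa_d eps^d / 2, a pure power of degree d, so that
    only the index 0 receives mass. *)
Lemma support_half : Lambda 0%N L upper_normals = (2^-1)%:E.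
Proof.
have [b Hb] := shell_half_ball.
have kp := @kappa_gt0 R d.
rewrite (steiner_polynomial HLambda cL L0 (P := fun k => if k == 0%N then kappa d / 2 else 0)
  upper_normals_measurable) //; first by rewrite /= subn0; congr EFin; field; rewrite gt_eqF.
move=> eps e0; rewrite (_ : _ `&` _ = shell L eps `&` [set y | 0 < dotp (outer_unit L y) v]); last first.
  apply/seteqP; split => y [sy]; first by move=> [_ [_ ?]]; split.
  move=> uv; split => //; split; first by apply: LE; exact: metric_proj_in.
  by split => //; apply/enorm1/outer_unit_unit; move: sy => /andP[].
rewrite (Hb _ e0) -lebE; last first.
  have mA : measurable ([set x | enorm x <= eps] `&` [set x | 0 < dotp x v] : set (borel V)).
    by apply: measurableI; [exact: ball_measurable|exact: half_space_measurable].
  rewrite -[X in measurable X]setTI.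
  by apply: (measurable_rVD (f := @id (borel V)) (g := fun=> - b)) => //.
rewrite (leb_shift (- b)); last first.
  by apply: measurableI; [exact: ball_measurable|exact: half_space_measurable].
rewrite half_ball// big_ord_recl /= subn0 big1 ?addr0 ?mulrA// => i _.
by rewrite mulr0.
Qed.


End on_a_line.

Definition transverse_normals (v : V) : set SS := [set xu | enorm xu.2 = 1 /\ dotp xu.2 v <> 0].

Lemma transverse_normals_measurable v : measurable (transverse_normals v).
Proof.
have msnd (A : set (borel V)) : measurable A -> measurable (snd @^-1` A : set SS).
  by move=> mA; rewrite -[X in measurable X]setTI; apply: snd_borel_measurable.
apply: measurableI.
  apply: (msnd [set u | enorm u = 1]).
  rewrite (_ : [set u | _] = (fun u : borel V => enorm (u : V)) @^-1` [set 1])//.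
  by rewrite -[X in measurable X]setTI; apply: enorm_measurable.
by apply: (msnd (~` [set u | dotp u v = 0])); apply: measurableC; exact: hyperplane_measurable.
Qed.

(** [relative_measure] is a bare set function; identifying it with a measure makes the rules for
    integrals available. *)
Lemma relative_measureE (E : LS) (L : set V) : exists rho : {measure set SS -> \bar R},
  relative_measure Lambda (line_set E) L = rho /\
  forall A, rho A = Lambda 0 L (line_normal (udir E) @^-1` A `&` transverse_normals (udir E)).
Proof.
have v1 := udir_unit E; have Ev := line_set_udir E.
pose m0 : {measure set SS -> \bar R} := mrestr (Lambda 0 L) (transverse_normals_measurable (udir E)).
have [rho rhoE] := pushforward_measureE m0 (line_normal_measurable (udir E)).
exists rho; split => //; apply/funext => A; rewrite rhoE /relative_measure /pushforward /m0 /= /mrestr.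
congr (Lambda 0%N L _); congr (_ `&` _).
  apply/seteqP; split => -[x u] /=; by rewrite /line_normal /= (orth_proj_line v1 Ev) (normalize_line v1).
apply/seteqP; split => -[x u]; first by move=> [_ [/= u1 uv]]; split => // /(orth_compl_line Ev).
by move=> /= [u1 uv]; split => //; split => // /(orth_compl_line Ev).
Qed.

(** The unit sphere of the direction consists of two points, and the relative measure gives mass 1/2
    to each. *)
Lemma relative_tensorE (E : LS) (L : set V) (s : nat) (z : 'I_s -> V) :
  convex_body L -> L !=set0 -> L `<=` line_set E ->
  relative_tensor Lambda (line_set E) s L z =
  tensor_coef s * ((vpow (udir E) s z + vpow (- udir E) s z) / 2).
Proof.
move=> cL L0 LE; rewrite /relative_tensor; congr (_ * _).
set v := udir E; have v1 : dotp v v = 1 := udir_unit E; have Ev := line_set_udir E; rewrite -/v in Ev.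
have [rho [relE rhoE]] := relative_measureE E L; rewrite -/v in rhoE.
rewrite relE.
pose D w : set SS := [set xu | line_set E xu.1 /\ xu.2 = w].
have mD w : measurable (D w).
  have me : measurable_fun setT (fun u : borel V => enorm ((u : V) - w)).
    apply: (measurableT_comp (@enorm_measurable R n)).
    by apply: (measurable_rVD (f := @id (borel V)) (g := fun=> - w)).
  rewrite (_ : D w = fst @^-1` line_set E `&` snd @^-1` ((fun u => enorm (u - w)) @^-1` [set 0])).
    apply: measurableI.
      rewrite -[X in measurable X]setTI; apply: fst_borel_measurable => //.
      exact: (line_set_measurable v1 Ev).
    rewrite -[X in measurable X]setTI; apply: snd_borel_measurable => //.
    by rewrite -[X in measurable X]setTI; apply: me.
  apply/seteqP; split => -[x u] [/= Ex h]; split => //; rewrite /= ?h ?subrr ?enorm0//.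
  by move/eqP: h; rewrite enorm_eq0 subr_eq0 => /eqP.
have -> : line_set E `*` (unit_sphere d `&` direction (line_set E)) = D v `|` D (- v).
  apply/seteqP; split => -[x u] /=.
    by move=> [Ex /(sphere_direction v1 Ev)[->|->]]; [left|right].
  by move=> [[/= Ex ->]|[/= Ex ->]]; split => //; apply/(sphere_direction v1 Ev); [left|right].
have vNv : v <> - v.
  move=> e; have : dotp v v = - dotp v v by rewrite {2}e dotpNr.
  by rewrite v1; lra.
have v0 : v != 0 by exact: udir_neq0.
(* c v is again a unit direction of E, so [support_half] treats both sides at once. *)
have half (c : R) : c = 1 \/ c = -1 -> rho (D (c *: v)) = (2^-1)%:E.
  move=> c1; have cc : c * c = 1 by case: c1 => ->; ring.
  have c0 : c != 0 by apply/eqP => e; move: cc; rewrite e mul0r => /eqP; rewrite eq_sym oner_eq0.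
  have w1 : dotp (c *: v) (c *: v) = 1 by rewrite dotpZl dotpZr v1 mulr1.
  have Ew : line_set E = line_through (foot E) (c *: v).
    have e0 : foot E = foot E + 0 *: v by rewrite scale0r addr0.
    by rewrite Ev [in RHS]e0 line_through_reparam.
  rewrite rhoE -(support_half cL L0 LE w1 Ew); congr (Lambda 0%N L _).
  apply/seteqP; split => -[x u] /=.
    move=> [[Ex e] [u1 uv]]; split => //; split => //; rewrite dotpZr.
    have sc : Num.sg (dotp u v) = c.
      by move: e => /eqP; rewrite -subr_eq0 -scalerBl scaler_eq0 (negPf v0) orbF subr_eq0 => /eqP.
    case: c1 sc => -> /eqP; rewrite sgr_cp0; first by rewrite mul1r.
    by rewrite mulN1r oppr_gt0.
  rewrite /upper_normals /= dotpZr => -[Ex [u1 uv]]; split.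
    split => //; congr (_ *: _); case: c1 uv => ->; first by rewrite mul1r => h; rewrite gtr0_sg.
    by rewrite mulN1r oppr_gt0 => h; rewrite ltr0_sg.
  by split => // e; rewrite e mulr0 ltxx in uv.
have mpow : measurable_fun [set: SS] (fun xu : SS => (vpow xu.2 s z)%:E).
  apply/measurable_EFinP; rewrite /vpow; apply: measurable_prod => i _.
  exact: (measurableT_comp (dotp_measurable (z i)) (@snd_borel_measurable R n)).
rewrite integral_setU//; [|exact: measurable_funS mpow|]; last first.
  rewrite disj_set2E; apply/eqP/seteqP; split => // xu [[_ e1] [_ e2]]; apply: vNv.
  exact: etrans (esym e1) e2.
have int w : (\int[rho]_(xu in D w) (vpow xu.2 s z)%:E = (vpow w s z)%:E * rho (D w))%E.
  by rewrite -integral_cst//; apply: eq_integral => xu /set_mem[_ ->].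
rewrite !int -(scale1r v) half ?scale1r; last by left.
rewrite -(scaleN1r v) half; last by right.
by rewrite scaleN1r -!EFinM -EFinD /=; field.
Qed.

Lemma relative_tensor0 (E : LS) (s : nat) (z : 'I_s -> V) :
  relative_tensor Lambda (line_set E) s set0 z = 0.
Proof.
rewrite /relative_tensor; have [rho [-> rhoE]] := relative_measureE E set0.
rewrite (eq_measure_integral mzero) ?integral_measure_zero ?mulr0// => A mA _.
rewrite [LHS]rhoE HLambda.2//; apply: measurableI; last exact: transverse_normals_measurable.
by rewrite -[X in measurable X]setTI; exact: line_normal_measurable.
Qed.

End relative.

(** * Polarization *)

Section ryser.
Context {R : realType} {s : nat}.

Lemma prod_natr_bool (I : finType) (b : I -> bool) :
  \prod_i (b i)%:R = [forall i, b i]%:R :> R.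
Proof.
case: (boolP [forall i, b i]) => [/forallP h|]; first by rewrite big1// => i _; rewrite h.
by rewrite negb_forall => /existsP[i /negPf h]; rewrite (bigD1 i)//= h mul0r.
Qed.

Lemma sum_injective_perm (G : {ffun 'I_s -> 'I_s} -> R) :
  \sum_(f : {ffun 'I_s -> 'I_s} | injectiveb f) G f = \sum_(sg : 'S_s) G (pval sg).
Proof.
rewrite (reindex (@pval _)) /=; last first.
  by exists (insubd (1%g : 'S_s)) => /= f Uf; first apply: val_inj; apply: insubdK.
by apply: eq_bigl => sg; exact: (valP sg).
Qed.

Lemma onto_injectiveb (f : {ffun 'I_s -> 'I_s}) : [forall j, j \in codom f] = injectiveb f.
Proof.
apply/forallP/injectiveP => [h|finj j]; last exact: injF_onto.
suff /image_injP : #|image_mem f (mem (predT : pred 'I_s))| == #|(predT : pred 'I_s)| by move=> H i j /H; apply.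
by apply/eqP/eq_card => j; rewrite h.
Qed.

(** Ryser's formula for the permanent, by inclusion-exclusion. Expanding the product over maps f
    leaves an alternating sum over the subsets e that contain the image of f; it vanishes unless f
    is onto, hence a permutation. *)
Lemma ryser (a : 'I_s -> 'I_s -> R) :
  \sum_(e : {ffun 'I_s -> bool}) (\prod_j (-1) ^+ e j) * \prod_i \sum_j (e j)%:R * a i j =
  (-1) ^+ s * \sum_(sg : 'S_s) \prod_i a i (sg i).
Proof.
under eq_bigr => e _ do rewrite bigA_distr_bigA mulr_sumr.
rewrite exchange_big /=.
have inner (f : {ffun 'I_s -> 'I_s}) :
  \sum_(e : {ffun 'I_s -> bool}) (\prod_j (-1) ^+ e j) * \prod_i ((e (f i))%:R * a i (f i)) =
  (if injectiveb f then (-1) ^+ s * \prod_i a i (f i) else 0).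
  pose g (j : 'I_s) (b : bool) : R := (-1) ^+ b * ((j \in codom f) ==> b)%:R.
  transitivity ((\sum_(e : {ffun 'I_s -> bool}) \prod_j g j (e j)) * \prod_i a i (f i)).
    rewrite mulr_suml; apply: eq_bigr => e _; rewrite !big_split /= mulrA; congr (_ * _ * _).
    rewrite !prod_natr_bool; congr (_%:R); congr nat_of_bool; apply/forallP/forallP => h i.
      by apply/implyP => /codomP[k ->].
    by apply: (implyP (h (f i))); exact: codom_f.
  rewrite -(bigA_distr_bigA g).
  have gE j : \sum_b g j b = - (j \in codom f)%:R.
    rewrite big_bool /g expr1 expr0; case: (j \in codom f) => /=; ring.
  under eq_bigr => j _ do rewrite gE.
  rewrite prodrN prod_natr_bool card_ord.
  by rewrite onto_injectiveb; case: ifP => _; rewrite ?mulr1// mulr0 mul0r.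
under eq_bigr => f _ do rewrite inner.
rewrite -big_mkcond /= sum_injective_perm mulr_sumr; apply: eq_bigr => sg _.
by congr (_ * _); apply: eq_bigr => i _; rewrite pvalE.
Qed.

End ryser.

Section polarization.
Context {R : realType} {n : nat}.
Local Notation V := 'rV[R]_n.
Local Notation tensor := (@tensor R n).

(** The span of the products of linear forms, that is, the multilinear tensors. A [tensor] is an
    arbitrary function, so multilinearity has to be recorded; in this form [polarization] is checked
    on products. *)
Inductive decomposable {s : nat} : tensor s -> Prop :=
| decomposable_prod (w : 'I_s -> V) : decomposable (fun z => \prod_i dotp (w i) (z i))
| decomposableD (a b : tensor s) : decomposable a -> decomposable b ->
    decomposable (fun z => a z + b z)
| decomposableZ c (a : tensor s) : decomposable a -> decomposable (fun z => c * a z).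

Definition symmetric_tensor {s} (a : tensor s) : Prop :=
  forall (z : 'I_s -> V) (sg : 'S_s), a (fun i => z (sg i)) = a z.

Lemma dotp_suml (I : Type) (r : seq I) (z : I -> V) (w : V) :
  dotp w (\sum_(j <- r) z j) = \sum_(j <- r) dotp w (z j).
Proof.
by elim: r => [|j r IH]; rewrite ?big_nil ?dotp0r// !big_cons dotpDr IH.
Qed.

Lemma polarization s (a : tensor s) (z : 'I_s -> V) : decomposable a ->
  \sum_(e : {ffun 'I_s -> bool}) (\prod_j (-1) ^+ e j) * a (fun=> \sum_j (e j)%:R *: z j) =
  (-1) ^+ s * \sum_(sg : 'S_s) a (fun i => z (sg i)).
Proof.
elim=> [w|b c _ IHb _ IHc|k b _ IHb].
- rewrite -(ryser (fun i j => dotp (w i) (z j))); apply: eq_bigr => e _; congr (_ * _).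
  by apply: eq_bigr => i _; rewrite dotp_suml; apply: eq_bigr => j _; rewrite dotpZr.
- by under eq_bigr do rewrite mulrDr; rewrite !big_split /= IHb IHc mulrDr.
- by under eq_bigr do rewrite mulrCA; rewrite -!mulr_sumr IHb mulrCA.
Qed.

(** For a symmetric tensor the sum over permutations in [polarization] is s! times its value, and
    the other side involves diagonal values only. *)
Lemma eq_tensor_diagonal s (a b : tensor s) :
  decomposable a -> decomposable b -> symmetric_tensor a -> symmetric_tensor b ->
  (forall y, a (fun=> y) = b (fun=> y)) -> forall z, a z = b z.
Proof.
move=> da db sa sb ab z; have s0 : (-1) ^+ s != 0 :> R by rewrite signr_eq0.
have := polarization z da; have := polarization z db.
under eq_bigr do rewrite -ab; move=> -> /(mulfI s0).
under eq_bigr do rewrite sb; under [RHS]eq_bigr do rewrite sa.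
rewrite !sumr_const => /eqP; rewrite eqrMn2r => /orP[/eqP/card0_eq/(_ 1%g)|/eqP//].
by rewrite inE.
Qed.

Lemma decomposable_const (c : R) : decomposable (fun _ : 'I_0 -> V => c).
Proof.
rewrite (_ : (fun=> c) = fun z : 'I_0 -> V => c * \prod_i dotp 0 (z i)).
  by apply: decomposableZ; exact: (decomposable_prod (fun=> 0)).
by apply/funext => z; rewrite big_ord0 mulr1.
Qed.

Lemma decomposable_sum (I : Type) (r : seq I) s (a : I -> tensor s) (w : 'I_s -> V) :
  (forall i, decomposable (a i)) -> decomposable (fun z => \sum_(i <- r) a i z).
Proof.
move=> da; elim: r => [|i r IH].
  rewrite (_ : (fun z => _) = (fun z : 'I_s -> V => 0 * \prod_i dotp (w i) (z i))).
    by apply: decomposableZ; exact: decomposable_prod.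
  by apply/funext => z; rewrite big_nil mul0r.
rewrite (_ : (fun z => _) = (fun z => a i z + \sum_(j <- r) a j z)); first exact: decomposableD.
by apply/funext => z; rewrite big_cons.
Qed.

Lemma decomposable_perm s (a : tensor s) (sg : 'S_s) :
  decomposable a -> decomposable (fun z => a (fun i => z (sg i))).
Proof.
elim=> [w|b c _ IHb _ IHc|k b _ IHb]; [|exact: decomposableD|exact: decomposableZ].
rewrite (_ : (fun z => _) = (fun z : 'I_s -> V => \prod_i dotp (w ((sg^-1)%g i)) (z i))).
  exact: (decomposable_prod (fun i => w ((sg^-1)%g i))).
apply/funext => z; rewrite [RHS](reindex_inj (@perm_inj _ sg)).
by apply: eq_bigr => i _; rewrite permK.
Qed.

Lemma decomposableM p q (a : tensor p) (b : tensor q) : decomposable a -> decomposable b ->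
  decomposable (fun z : 'I_(p + q) -> V => a (fun i => z (lshift q i)) * b (fun j => z (rshift p j))).
Proof.
move=> da db; elim: da => [w|a1 a2 _ IH1 _ IH2|k a1 _ IH1].
- elim: db => [w'|b1 b2 _ IH1 _ IH2|k b1 _ IH1].
  + pose W (i : 'I_(p + q)) := match fintype.split i with inl i => w i | inr j => w' j end.
    rewrite (_ : (fun z => _) = (fun z => \prod_i dotp (W i) (z i))); first exact: decomposable_prod.
    apply/funext => z; rewrite big_split_ord /=; congr (_ * _); apply: eq_bigr => i _.
      by rewrite /W (unsplitK (inl i)).
    by rewrite /W (unsplitK (inr i)).
  + rewrite (_ : (fun z => _) = (fun z : 'I_(p + q) -> V => (\prod_i dotp (w i) (z (lshift q i))) * b1 (fun j => z (rshift p j)) +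
      (\prod_i dotp (w i) (z (lshift q i))) * b2 (fun j => z (rshift p j)))); first exact: decomposableD.
    by apply/funext => z; rewrite mulrDr.
  + rewrite (_ : (fun z => _) = (fun z : 'I_(p + q) -> V => k * ((\prod_i dotp (w i) (z (lshift q i))) * b1 (fun j => z (rshift p j))))).
      exact: decomposableZ.
    by apply/funext => z; rewrite mulrCA.
- rewrite (_ : (fun z => _) = (fun z : 'I_(p + q) -> V => a1 (fun i => z (lshift q i)) * b (fun j => z (rshift p j)) +
    a2 (fun i => z (lshift q i)) * b (fun j => z (rshift p j)))); first exact: decomposableD.
  by apply/funext => z; rewrite mulrDl.
- rewrite (_ : (fun z => _) = (fun z : 'I_(p + q) -> V => k * (a1 (fun i => z (lshift q i)) * b (fun j => z (rshift p j))))).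
    exact: decomposableZ.
  by apply/funext => z; rewrite mulrA.
Qed.

Lemma decomposable_symprod p q (a : tensor p) (b : tensor q) :
  decomposable a -> decomposable b -> decomposable (symprod a b).
Proof.
move=> da db; rewrite /symprod; apply: decomposableZ.
apply: (@decomposable_sum _ (index_enum _)) => [i|sg]; first exact: 0.
exact: (decomposable_perm sg (decomposableM da db)).
Qed.

Lemma symmetric_symprod p q (a : tensor p) (b : tensor q) : symmetric_tensor (symprod a b).
Proof.
move=> z sg; rewrite /symprod; congr (_ * _).
rewrite [RHS](reindex_inj (mulIg sg)) /=; apply: eq_bigr => t _; congr (a _ * b _);
  by apply/funext => i; rewrite permM.
Qed.

Lemma symprod_diagonal p q (a : tensor p) (b : tensor q) y :
  symprod a b (fun=> y) = a (fun=> y) * b (fun=> y).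
Proof.
have N0 : (p + q)`!%:R != 0 :> R by rewrite pnatr_eq0 -lt0n fact_gt0.
by rewrite /symprod sumr_const card_Sn -(mulr_natl (a _ * b _)) mulKf.
Qed.

Lemma sympow_diagonal p (a : tensor p) j y : sympow a j (fun=> y) = a (fun=> y) ^+ j.
Proof. by elim: j => [|j IH]//=; rewrite symprod_diagonal IH exprS. Qed.

Lemma decomposable_sympow p (a : tensor p) j : decomposable a -> decomposable (sympow a j).
Proof.
move=> da; elim: j => [|j IH] /=; first exact: (decomposable_const 1).
exact: decomposable_symprod.
Qed.

Lemma decomposable_metric : decomposable (@metric_tensor R n).
Proof.
rewrite (_ : metric_tensor _ = fun z : 'I_2 -> V => \sum_(k < n) \prod_i dotp (delta_mx ord0 k) (z i)).
  apply: (@decomposable_sum _ (index_enum _)) => [i|k]; first exact: 0.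
  exact: (decomposable_prod (fun=> delta_mx ord0 k)).
apply/funext => z; rewrite /metric_tensor {1}/dotp; apply: eq_bigr => k _.
rewrite big_ord_recl big_ord1 !(dotpC (delta_mx ord0 k)) !dotp_delta; congr (_ * z _ _ _); exact: val_inj.
Qed.

Lemma decomposable_cast p q (e : p = q) (a : tensor p) : decomposable a -> decomposable (cast_tensor e a).
Proof.
case: q / e => da; rewrite (_ : cast_tensor _ _ = a)//; apply/funext => z; congr (a _).
by apply/funext => i; rewrite cast_ord_id.
Qed.

Lemma symmetric_cast p q (e : p = q) (a : tensor p) : symmetric_tensor a -> symmetric_tensor (cast_tensor e a).
Proof.
case: q / e => da; rewrite (_ : cast_tensor _ _ = a)//; apply/funext => z; congr (a _).
by apply/funext => i; rewrite cast_ord_id.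
Qed.

Lemma vpow_sym s (u : V) : symmetric_tensor (@vpow R n u s).
Proof. by move=> z sg; rewrite /vpow [RHS](reindex_inj (@perm_inj _ sg)). Qed.

Lemma vpow_diagonal s (u y : V) : vpow u s (fun=> y) = dotp u y ^+ s.
Proof. by rewrite /vpow prodr_const card_ord. Qed.

End polarization.

(** * The tensor identity *)

Section direction_tensor.
Context {R : realType} {n : nat}.
Local Notation V := 'rV[R]_n.+1.
Context {dX} {X : measurableType dX} (nu : {measure set X -> \bar R}).
Variables (D : set X) (dir : X -> borel V).
Hypotheses (mD : measurable D) (nuD : (nu D < +oo)%E) (mdir : measurable_fun setT dir)
  (dir1 : forall x, D x -> dotp (dir x : V) (dir x) = 1).

Lemma direction_integrable g : admissible g -> nu.-integrable D (EFin \o (fun x => g (dir x))).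
Proof.
move=> [mg [C HC]].
have mF : measurable_fun D (fun x => g (dir x)).
  exact: measurable_funS (measurableT_comp mg mdir).
apply/integrableP; split; first exact/measurable_EFinP.
apply: (@le_lt_trans _ _ (\int[nu]_(x in D) `|C|%:E)%E).
  apply: ge0_le_integral => //.
  - by apply/measurable_EFinP; apply: (measurableT_comp (@normr_measurable R setT)).
  - by move=> x Dx; rewrite /= lee_fin (le_trans (HC _ (dir1 Dx)))// ler_norm.
by rewrite integral_cst// lte_mul_pinfty.
Qed.

Lemma direction_integralZ c g : admissible g ->
  \int[nu]_(x in D) (c * g (dir x)) = c * \int[nu]_(x in D) g (dir x).
Proof. by move=> ag; rewrite RintegralZl//; exact: direction_integrable. Qed.

Lemma direction_integral_sum I (s : seq I) (g : I -> borel V -> R) :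
  (forall i, admissible (g i)) ->
  \int[nu]_(x in D) (\sum_(i <- s) g i (dir x)) = \sum_(i <- s) \int[nu]_(x in D) g i (dir x).
Proof.
move=> ag; elim: s => [|i s IH].
  rewrite big_nil; have := direction_integralZ 0 (admissible_cst 0).
  by rewrite [RHS]mul0r => e; rewrite -[RHS]e; apply: eq_Rintegral => x _; rewrite big_nil mul0r.
under eq_Rintegral do rewrite big_cons.
rewrite big_cons RintegralD ?IH//; first exact: direction_integrable.
by apply: (direction_integrable (g := fun v => \sum_(i <- s) g i v)); exact: admissible_sum.
Qed.

(** The common form of the two sides: [mu] on the lines that hit K with [udir], and the top support
    measure on the unit normals with [snd]. *)
Definition direction_tensor (s : nat) : tensor n.+1 s :=
  fun z => \int[nu]_(x in D) vpow (dir x : V) s z.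

Lemma admissible_prod (I : finType) (g : I -> borel V -> R) :
  (forall i, admissible (g i)) -> admissible (fun v => \prod_i g i v).
Proof.
move=> ag; elim: (index_enum I) => [|i r IH].
  by under eq_fun do rewrite big_nil; exact: admissible_cst.
by under eq_fun do rewrite big_cons; exact: admissibleM.
Qed.

Lemma admissible_coord k : admissible (fun v : borel V => (v : V) ord0 k).
Proof.
rewrite (_ : (fun v => _) = fun v : borel V => dotp (v : V) (delta_mx ord0 k)).
  exact: admissible_dotp.
by apply/funext => v; rewrite dotp_delta.
Qed.

(** Expanding the inner products in coordinates gives a finite sum of products of coordinate forms,
    with the moments of the coordinates as coefficients. *)
Lemma decomposable_direction s : decomposable (@direction_tensor s).
Proof.
pose c (f : {ffun 'I_s -> 'I_n.+1}) : R := \int[nu]_(x in D) \prod_i (dir x : V) ord0 (f i).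
rewrite (_ : @direction_tensor s = fun z => \sum_(f : {ffun 'I_s -> 'I_n.+1}) c f * \prod_i dotp (delta_mx ord0 (f i)) (z i)).
  apply: (@decomposable_sum _ _ _ (index_enum _)) => [i|f]; first exact: 0.
  by apply: decomposableZ; exact: (decomposable_prod (fun i => delta_mx ord0 (f i))).
apply/funext => z; rewrite /direction_tensor.
pose g (f : {ffun 'I_s -> 'I_n.+1}) (v : borel V) : R :=
  (\prod_i dotp (delta_mx ord0 (f i)) (z i)) * \prod_i (v : V) ord0 (f i).
have ap (f : {ffun 'I_s -> 'I_n.+1}) : admissible (fun v : borel V => \prod_i (v : V) ord0 (f i)).
  by apply: admissible_prod => i; exact: admissible_coord.
transitivity (\int[nu]_(x in D) (\sum_(f : {ffun 'I_s -> 'I_n.+1}) g f (dir x))).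
  apply: eq_Rintegral => x _; rewrite /vpow /dotp bigA_distr_bigA; apply: eq_bigr => f _.
  by rewrite /g -big_split; apply: eq_bigr => i _ /=; rewrite dotpC dotp_delta mulrC.
rewrite direction_integral_sum; last first.
  by move=> f; apply: admissibleM => //; exact: admissible_cst.
by apply: eq_bigr => f _; rewrite /g (direction_integralZ _ (ap f)) mulrC.
Qed.

Lemma symmetric_direction s : symmetric_tensor (@direction_tensor s).
Proof. by move=> z sg; apply: eq_Rintegral => x _; exact: vpow_sym. Qed.

Lemma direction_diagonal s y :
  @direction_tensor s (fun=> y) = \int[nu]_(x in D) dotp (dir x : V) y ^+ s.
Proof. by apply: eq_Rintegral => x _; exact: vpow_diagonal. Qed.

End direction_tensor.

(** * The Crofton formula on the diagonal *)

Section diagonal.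
Context {R : realType} {n : nat}.
Local Notation V := 'rV[R]_n.+1.
Local Notation LS := (@line_space R n).
Local Notation SS := (@support_space R n.+1).
Local Notation d := n.+1.
Variables (Lambda : nat -> set V -> {measure set SS -> \bar R}).
Hypothesis HLambda : is_support_measures Lambda.
Variables (mu : {measure set LS -> \bar R}) (Hmu : is_line_measure mu).

Definition normal_sphere : set SS := [set: V] `*` unit_sphere d.

Lemma normal_sphere_measurable : measurable normal_sphere.
Proof.
rewrite (_ : normal_sphere = snd @^-1` ((fun u : borel V => enorm (u : V)) @^-1` [set 1])).
  rewrite -[X in measurable X]setTI; apply: snd_borel_measurable => //.
  by rewrite -[X in measurable X]setTI; apply: enorm_measurable.
by apply/seteqP; split => -[x u]; [move=> []|].
Qed.

Lemma normal_sphere_unit xu : normal_sphere xu -> dotp (xu.2 : V) xu.2 = 1.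
Proof. by move=> [_ /= h]; exact/enorm1. Qed.

Lemma integral_normal_sphere (K : set V) (f : SS -> \bar R) :
  convex_body K -> K !=set0 -> measurable_fun setT f -> (forall x, 0 <= f x)%E ->
  (\int[Lambda n K]_xu f xu = \int[Lambda n K]_(xu in normal_sphere) f xu)%E.
Proof.
move=> cK K0 mf f0; have mS := normal_sphere_measurable.
rewrite -(setUv normal_sphere) ge0_integral_setU//=; first last.
- by rewrite disj_set2E setICr.
- exact: measurable_funS mf.
- exact: measurableC.
rewrite [X in (_ + X)%E](_ : _ = 0%E) ?adde0//.
rewrite (eq_measure_integral mzero) ?integral_measure_zero// => A mA AS.
suff h : (Lambda n K A <= 0)%E by apply/le_anti/andP; split; [exact: h|exact: measure_ge0].
rewrite -(support_sphere HLambda cK K0 (ltnSn n)).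
apply: le_measure; rewrite ?inE//.
  rewrite (_ : mkset _ = ~` normal_sphere); first exact: measurableC.
  apply/seteqP; split => -[x u] /=; first by move/eqP => h [].
  by move=> h; apply/eqP => e; apply: h.
by move=> xu /AS h; apply/eqP => e; apply: h.
Qed.

(** The unit vector e is arbitrary: [moment0_const] moves the moment from the normal [xu.2] to e,
    and it leaves the integral as a constant. *)
Lemma crofton_diagonal_moment (K : set V) (e y : V) m : convex_body K -> K !=set0 -> dotp e e = 1 ->
  kappa d * \int[mu]_(E in hits K) dotp (udir E) y ^+ (2 * m) =
  moment mu e 0 0 0 * @level_ratio R n m *
  \int[Lambda n K]_(xu in normal_sphere) crofton_kernel m (dotp y y) (dotp xu.2 y ^+ 2).
Proof.
move=> cK K0 e1; pose phi (v : borel V) : R := dotp (v : V) y ^+ (2 * m).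
have aphi : admissible phi by apply: admissibleX; exact: admissible_dotp.
have phi0 v : 0 <= phi v by rewrite /phi exprM exprn_ge0// sqr_ge0.
have phiN (v : V) : phi (- v) = phi v by rewrite /phi dotpNl !exprM sqrrN.
have [mphi [C HC]] := aphi.
have phiC (v : V) : dotp v v = 1 -> phi v <= C.
  by move=> /HC; apply: le_trans; exact: ler_norm.
have := crofton_cosine HLambda Hmu mphi phi0 phiN phiC cK K0.
have mh : measurable (hits K) := hits_measurable cK.1.
have hE : hit_integral mu phi K = (\int[mu]_(E in hits K) phi (udir E))%:E.
  rewrite /Rintegral fineK; last first.
    apply: integrable_fin_num => //.
    apply: (direction_integrable (nu := mu) (dir := udir)) => //.
    - exact: (hits_lty Hmu cK.1).
    - exact: udir_measurable.
    - by move=> E _; exact: udir_unit.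
  rewrite [RHS]integral_mkcond; apply: eq_integral => E _; rewrite patchE indicE.
  by case: ifP => _; rewrite ?mule1 ?mule0.
rewrite hE -EFinM integral_normal_sphere//; last first.
- by move=> xu; exact: cosine_ge0.
- exact: (measurableT_comp (cosine_measurable Hmu mphi phi0) (@snd_borel_measurable R n)).
pose g (v : borel V) : R := crofton_kernel m (dotp y y) (dotp (v : V) y ^+ 2).
have ag : admissible g.
  apply: admissible_sum => k; apply: admissibleM; first exact: admissible_cst.
  by apply: admissibleX; apply: admissibleX; exact: admissible_dotp.
have nuS : (Lambda n K normal_sphere < +oo)%E.
  have := support_fin HLambda cK K0 (ltnSn n) normal_sphere_measurable.
  by rewrite ge0_fin_numE.
pose c := moment mu e 0 0 0 * @level_ratio R n m.
have int : (\int[Lambda n K]_(xu in normal_sphere) cosine mu phi xu.2 =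
    (c * \int[Lambda n K]_(xu in normal_sphere) g xu.2)%:E)%E.
  rewrite -(direction_integralZ normal_sphere_measurable nuS (@snd_borel_measurable R n) normal_sphere_unit)//.
  rewrite /Rintegral fineK; last first.
    apply: integrable_fin_num; first exact: normal_sphere_measurable.
    apply: (direction_integrable normal_sphere_measurable nuS (@snd_borel_measurable R n) normal_sphere_unit (g := fun v => c * g v)).
    by apply: admissibleM => //; exact: admissible_cst.
  apply: eq_integral => xu /set_mem Sxu; have u1 := normal_sphere_unit Sxu.
  by rewrite cosineE// (chord_integral_cosine Hmu y m u1) (moment0_const Hmu u1 e1).
by rewrite int => h; have h' := EFin_inj h.
Qed.

(** For m = 0 and the unit ball the formula reads kappa_d kappa_n = M d kappa_d / 2, by the
    normalization of [mu] and [support_ball_total]. *)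
Lemma moment_value (e : V) : dotp e e = 1 -> moment mu e 0 0 0 = 2 * kappa n / d%:R.
Proof.
move=> e1; have := crofton_diagonal_moment (0 : V) 0 unit_ball_convex_body unit_ball_neq0 e1.
rewrite muln0 /level_ratio big_ord0 mulr1.
under eq_Rintegral do rewrite expr0.
have mB := hits_measurable (@unit_ball_compact R n).
rewrite Rintegral_cst// mul1r.
have -> : mu (hits (unit_ball d)) = (kappa n)%:E := Hmu.2.
rewrite /=.
have -> : \int[Lambda n (unit_ball d)]_(xu in normal_sphere) crofton_kernel 0 (dotp (0 : V) 0) (dotp xu.2 0 ^+ 2) =
  d%:R * kappa d / 2.
  have := integral_normal_sphere unit_ball_convex_body unit_ball_neq0 (f := fun=> 1%E) (measurable_cst _).
  rewrite !integral_cst//; last exact: normal_sphere_measurable.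
  rewrite !mul1e (support_ball_total HLambda) => h.
  under eq_Rintegral do rewrite /crofton_kernel big_ord1 !expr0 bin0 muln0 subr0 divr1 !mulr1.
  rewrite Rintegral_cst ?mul1r; last exact: normal_sphere_measurable.
  by rewrite -h.
have kp := @kappa_gt0 R d.
have d0 : d%:R != 0 :> R by rewrite pnatr_eq0.
move=> h; apply: (mulIf d0); apply: (mulIf (lt0r_neq0 kp)).
rewrite divfK//.
by move: h; set M := moment _ _ _ _ _; set k := kappa d; set l := kappa n; set D := d%:R; lra.
Qed.

Lemma crofton_diagonal (K : set V) (y : V) m : convex_body K -> K !=set0 ->
  \int[mu]_(E in hits K) dotp (udir E) y ^+ (2 * m) =
  2 * kappa n / omega d * @level_ratio R n m *
  \sum_(k < m.+1) (-1) ^+ k * 'C(m, k)%:R / (1 - (2 * k)%:R) * dotp y y ^+ (m - k) *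
    \int[Lambda n K]_(xu in normal_sphere) dotp xu.2 y ^+ (2 * k).
Proof.
move=> cK K0; pose e : V := udir (point : LS); have e1 : dotp e e = 1 by exact: udir_unit.
have := crofton_diagonal_moment y m cK K0 e1; rewrite moment_value//.
have nuS : (Lambda n K normal_sphere < +oo)%E.
  have := support_fin HLambda cK K0 (ltnSn n) normal_sphere_measurable.
  by rewrite ge0_fin_numE.
have -> : \int[Lambda n K]_(xu in normal_sphere) crofton_kernel m (dotp y y) (dotp xu.2 y ^+ 2) =
  \sum_(k < m.+1) (-1) ^+ k * 'C(m, k)%:R / (1 - (2 * k)%:R) * dotp y y ^+ (m - k) *
    \int[Lambda n K]_(xu in normal_sphere) dotp xu.2 y ^+ (2 * k).
  pose g (k : 'I_m.+1) (v : borel V) : R :=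
    (-1) ^+ k * 'C(m, k)%:R / (1 - (2 * k)%:R) * dotp y y ^+ (m - k) * dotp (v : V) y ^+ (2 * k).
  have aX k : admissible (fun v : borel V => dotp (v : V) y ^+ (2 * k)).
    by apply: admissibleX; exact: admissible_dotp.
  transitivity (\int[Lambda n K]_(xu in normal_sphere) (\sum_(k < m.+1) g k xu.2)).
    by apply: eq_Rintegral => xu _; apply: eq_bigr => k _; rewrite /g exprM.
  rewrite (direction_integral_sum normal_sphere_measurable nuS (@snd_borel_measurable R n) normal_sphere_unit).
    apply: eq_bigr => k _.
    by rewrite /g (direction_integralZ normal_sphere_measurable nuS (@snd_borel_measurable R n) normal_sphere_unit _ (aX k)).
  by move=> k; apply: admissibleM => //; exact: admissible_cst.
rewrite omega_kappa; have kp := @kappa_gt0 R d; have d0 : d%:R != 0 :> R by rewrite pnatr_eq0.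
move=> h; apply: (mulfI (lt0r_neq0 kp)); rewrite h.
by move: kp d0; move: (kappa d) (d%:R) => k D k0 D0; field; rewrite D0 gt_eqF.
Qed.

End diagonal.

(** Turns the constant of the diagonal formula into that of the theorem. The induction starts from
    [kappa_omega] with omega_1 = 2, and each step is a quotient of two instances of [omegaSS]. *)
Lemma kappa_level (R : realType) n m :
  kappa n * @level_ratio R n m = omega (n.+1 + 2 * m + 1) / (pi * omega (2 * m).+1) :> R.
Proof.
have pi0 : pi != 0 :> R by rewrite gt_eqF// pi_gt0.
elim: m => [|m IH].
  rewrite muln0 addn0 addn1 kappa_omega /level_ratio big_ord0 omega1.
  by move: pi0; move: (pi : R) (kappa n) => p k p0; field; rewrite ?p0.
have -> : @level_ratio R n m.+1 = @level_ratio R n m * ((2 * m).+1%:R / (2 * m + n.+2)%:R).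
  by rewrite /level_ratio big_ord_recr.
rewrite mulrA IH.
rewrite (_ : (2 * m.+1).+1 = (2 * m).+3); last by rewrite mulnS.
rewrite (_ : n.+1 + 2 * m.+1 + 1 = (n + 2 * m).+4)%N; last first.
  by rewrite mulnS addn1 !addnS !addSn.
rewrite (_ : n.+1 + 2 * m + 1 = (n + 2 * m).+2)%N; last by rewrite addn1 addSn.
rewrite (_ : 2 * m + n.+2 = (n + 2 * m).+2)%N; last by rewrite !addnS addnC.
rewrite (omegaSS (n + 2 * m).+1) (omegaSS (2 * m)).
have w0 := lt0r_neq0 (@omega_gt0 R (2 * m)).
have p1 : (2 * m).+1%:R != 0 :> R by rewrite pnatr_eq0.
have p2 : (n + 2 * m).+2%:R != 0 :> R by rewrite pnatr_eq0.
move: w0 p1 p2; move: (omega (2 * m).+1) (omega (n + 2 * m).+2) ((2 * m).+1%:R) ((n + 2 * m).+2%:R).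
move=> a b x y a0 x0 y0.
move: pi0; move: (pi : R) => p p0.
by field; rewrite ?a0 ?p0 ?x0 ?y0.
Qed.

Lemma residual_continuous (R : realType) n (T : topologicalType) (x v : 'rV[R]_n.+1)
    (f : T -> 'rV[R]_n.+1) (t : T) :
  {for t, continuous (fun s => f s - x)} -> {for t, continuous (fun s => residual (f s) (x, v))}.
Proof.
move=> c1; have cv : {for t, continuous (fun _ : T => v)} by exact: cst_continuous.
have c12 := dotp_continuous c1 cv.
apply: cvgB; last exact: (cvgM c12 c12).
by apply: cvgM; [exact: (dotp_continuous c1 c1)|exact: (dotp_continuous cv cv)].
Qed.

Section crofton_tensors.
Context {R : realType} {n : nat}.
Local Notation V := 'rV[R]_n.+1.
Local Notation LS := (@line_space R n).
Local Notation SS := (@support_space R n.+1).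
Local Notation d := n.+1.
Variables (Lambda : nat -> set V -> {measure set SS -> \bar R}).
Hypothesis HLambda : is_support_measures Lambda.
Variables (mu : {measure set LS -> \bar R}) (Hmu : is_line_measure mu).

Lemma line_through_closed (x v : V) : v != 0 -> closed (line_through x v).
Proof.
move=> v0; pose rho (y : V) := residual y (x, v).
have crho : continuous rho.
  by move=> y; apply: (@residual_continuous R n V x v id y); apply: continuousB => //; exact: cst_continuous.
rewrite (_ : line_through x v = rho @^-1` [set 0]).
  by apply: preimage_closed; [move=> y _; exact: crho|exact: closed_eq].
apply/seteqP; split => y /=; first by move/(residual_eq0 _ (p := (x, v)) v0).
by move=> h; apply/(residual_eq0 _ (p := (x, v)) v0).
Qed.

Lemma line_section_convex_body (K : set V) (E : LS) : convex_body K -> convex_body (K `&` line_set E).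
Proof.
move=> cK; rewrite line_set_udir; split.
  apply: (subclosed_compact _ cK.1); last by move=> x [].
  apply: closedI; last exact/line_through_closed/udir_neq0.
  by apply: compact_closed; [exact: norm_hausdorff|exact: cK.1].
move=> a b l /set_mem[Ka [s ae]] /set_mem[Kb [t be]]; apply/mem_set; split.
  by apply: set_mem; apply: cK.2; apply: mem_set.
exists (l%:num * s + (1 - l%:num) * t); rewrite ae be /conv /= /unstable.onem.
by apply/rowP => i; rewrite !mxE; ring.
Qed.

(** The contributions of u and - u cancel for odd s and agree for even s, so the sign chosen in
    [udir] does not matter. *)
Lemma integral_relative_tensor (K : set V) s (z : 'I_s -> V) : convex_body K ->
  (\int[mu]_E (relative_tensor Lambda (line_set E) s (K `&` line_set E) z)%:E =
   (if odd s then 0 else tensor_coef s * direction_tensor mu (hits K) udir z)%:E)%E.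
Proof.
move=> cK; have mh : measurable (hits K) := hits_measurable cK.1.
have relE (E : LS) : relative_tensor Lambda (line_set E) s (K `&` line_set E) z =
    if E \in hits K then (if odd s then 0 else tensor_coef s * vpow (udir E) s z) else 0.
  case: ifPn => [/set_mem[x [Ex Kx]]|nE].
    rewrite (relative_tensorE HLambda).
    - have -> : vpow (- udir E) s z = (-1) ^+ s * vpow (udir E) s z.
        rewrite /vpow -[X in _ ^+ X]card_ord -prodrN; apply: eq_bigr => i _.
        by rewrite dotpNl.
      rewrite -signr_odd; case: (odd s); first by rewrite expr1 mulN1r subrr mul0r mulr0.
      by rewrite expr0 mul1r; field.
    - exact: line_section_convex_body.
    - by exists x.
    - by move=> y [].
  rewrite (_ : K `&` line_set E = set0) ?relative_tensor0//.
  apply/seteqP; split => // x [Kx Ex]; move/negP: nE; apply; apply/mem_set; by exists x.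
under eq_integral => E _ do rewrite relE.
have [os|es] := boolP (odd s).
  by rewrite integral0_eq// => E _; case: ifP.
have hitl : (mu (hits K) < +oo)%E := hits_lty Hmu cK.1.
have u1 E : hits K E -> dotp (udir E : V) (udir E) = 1 by move=> _; exact: udir_unit.
have av : admissible (fun v : borel V => vpow (v : V) s z).
  by apply: admissible_prod => i; exact: admissible_dotp.
rewrite /direction_tensor -(direction_integralZ mh hitl udir_measurable u1 _ av).
rewrite /Rintegral fineK; last first.
  apply: integrable_fin_num => //.
  apply: (direction_integrable mh hitl udir_measurable u1 (g := fun v : borel V => tensor_coef s * vpow (v : V) s z)).
  by apply: admissibleM => //; exact: admissible_cst.
rewrite [RHS]integral_mkcond; apply: eq_integral => E _.
by rewrite patchE; case: ifP.
Qed.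

Lemma surface_tensorE (K : set V) s (z : 'I_s -> V) :
  surface_tensor Lambda s K z = tensor_coef s * direction_tensor (Lambda n K) (@normal_sphere R n) snd z.
Proof. by []. Qed.

(** Both sides are symmetric and decomposable, so equality on the diagonal suffices, where symmetric
    products become products of numbers. The rank equations are parameters, so that any proofs of
    them fit. *)
Lemma crofton_surface (K : set V) m (z : 'I_(2 * m) -> V) (es : forall k : 'I_m.+1, ((m - k) * 2 + 2 * k = 2 * m)%N) :
  convex_body K -> K !=set0 ->
  tensor_coef (2 * m) * direction_tensor mu (hits K) udir z =
  2 * omega (d + 2 * m + 1) / (pi * (2 * m)`!%:R * omega (2 * m).+1 ^+ 2 * omega d) *
  \sum_(k < m.+1) crofton_coef m k * cast_tensor (es k)
     (symprod (sympow (metric_tensor d) (m - k)) (@surface_tensor R n Lambda (2 * k) K)) z.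
Proof.
move=> cK K0.
have mh : measurable (hits K) := hits_measurable cK.1.
have hitl : (mu (hits K) < +oo)%E := hits_lty Hmu cK.1.
have u1 E : hits K E -> dotp (udir E : V) (udir E) = 1 by move=> _; exact: udir_unit.
have mS := @normal_sphere_measurable R n.
have nuS : (Lambda n K (@normal_sphere R n) < +oo)%E.
  by have := support_fin HLambda cK K0 (ltnSn n) mS; rewrite ge0_fin_numE.
pose surf k : tensor d (2 * k) := @surface_tensor R n Lambda (2 * k) K.
have dsurf k : decomposable (surf k).
  apply: decomposableZ.
  exact: (decomposable_direction mS nuS (@snd_borel_measurable R n) (@normal_sphere_unit R n)).
pose T k := cast_tensor (es k) (symprod (sympow (metric_tensor d) (m - k)) (surf k)).
have dT k : decomposable (T k).
  apply: decomposable_cast; apply: decomposable_symprod => //.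
  by apply: decomposable_sympow; exact: decomposable_metric.
have sT k : symmetric_tensor (T k) by apply: symmetric_cast; exact: symmetric_symprod.
apply: (@eq_tensor_diagonal R d (2 * m) (fun z => tensor_coef (2 * m) * direction_tensor mu (hits K) udir z)
  (fun z => 2 * omega (d + 2 * m + 1) / (pi * (2 * m)`!%:R * omega (2 * m).+1 ^+ 2 * omega d) *
  \sum_(k < m.+1) crofton_coef m k * T k z)).
- apply: decomposableZ; exact: (decomposable_direction mh hitl udir_measurable u1).
- apply: decomposableZ; apply: (@decomposable_sum _ _ _ (index_enum _)) => [i|k]; first exact: 0.
  exact: decomposableZ.
- by move=> t sg; rewrite symmetric_direction.
- by move=> t sg; congr (_ * _); apply: eq_bigr => k _; rewrite sT.
move=> y; rewrite direction_diagonal (crofton_diagonal HLambda Hmu y m cK K0).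
pose I k := \int[Lambda n K]_(xu in (@normal_sphere R n)) dotp xu.2 y ^+ (2 * k).
have TE (k : 'I_m.+1) : T k (fun=> y) = dotp y y ^+ (m - k) * (tensor_coef (2 * k) * I k).
  rewrite /T /cast_tensor symprod_diagonal sympow_diagonal; congr (_ * _).
  by rewrite /surf surface_tensorE direction_diagonal.
under [in RHS]eq_bigr do rewrite TE.
have w0 k : omega k.+1 != 0 :> R by exact/lt0r_neq0/omega_gt0.
have f0 k : k`!%:R != 0 :> R by rewrite pnatr_eq0 -lt0n fact_gt0.
pose S := \sum_(k < m.+1) (-1) ^+ k * 'C(m, k)%:R / (1 - (2 * k)%:R) * dotp y y ^+ (m - k) * I k.
transitivity (tensor_coef (2 * m) * (2 * kappa n / omega d * @level_ratio R n m * S)); first by [].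
(* The factor (2k)! omega_(2k+1) of the Crofton coefficient cancels the denominator of
   [tensor_coef (2 * k)]. *)
have -> : \sum_(k < m.+1) crofton_coef m k * (dotp y y ^+ (m - k) * (tensor_coef (2 * k) * I k)) = omega 1 * S.
  rewrite mulr_sumr; apply: eq_bigr => k _; rewrite /crofton_coef /tensor_coef.
  have w1 := w0 (2 * k)%N; have f1 := f0 (2 * k)%N; have q0 := @one_sub_double_neq0 R k.
  move: w1 f1 q0; move: (omega (2 * k).+1) ((2 * k)`!%:R) (1 - (2 * k)%:R) => a b c a0 b0 c0.
  by field; rewrite a0 b0 c0.
have := kappa_level R n m; rewrite /tensor_coef.
have pi0 : pi != 0 :> R by rewrite gt_eqF// pi_gt0.
have := w0 (2 * m)%N; have := f0 (2 * m)%N; have := w0 n; move: pi0.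
move: (pi : R) (omega d) ((2 * m)`!%:R) (omega (2 * m).+1) (omega (d + 2 * m + 1)) (kappa n) (omega 1) (@level_ratio R n m) S.
move=> p a b c e k o l S p0 a0 b0 c0 kl.
transitivity (o / (b * c) * (2 / a * (k * l) * S)); first by field; rewrite b0 c0 a0.
by rewrite kl; field; rewrite p0 a0 b0 c0.
Qed.

Lemma surface_tensor0 s (z : 'I_s -> V) : surface_tensor Lambda s set0 z = 0.
Proof.
rewrite /surface_tensor /Rintegral (eq_measure_integral mzero) ?integral_measure_zero ?mulr0// => A mA _.
by rewrite [LHS]HLambda.2.
Qed.

End crofton_tensors.

Unset Implicit Arguments.

Theorem theorem3p1 (R : realType) (n : nat)
    (Lambda : nat -> set 'rV[R]_n.+1 ->
              {measure set (support_space n.+1) -> \bar R})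
    (HLambda : is_support_measures Lambda)
    (mu : {measure set (line_space n) -> \bar R})
    (Hmu : is_line_measure mu)
    (K : set 'rV[R]_n.+1) (HK : convex_body K) (s : nat) :
  (forall (evs : ~~ odd s) (z : 'I_s -> 'rV[R]_n.+1),
     (\int[mu]_E (relative_tensor Lambda (line_set E) s (K `&` line_set E)
                    z)%:E)%E =
     (2 * omega (n.+1 + s + 1) /
        (pi * s`!%:R * omega s.+1 ^+ 2 * omega n.+1) *
      \sum_(k < (s./2).+1)
        crofton_coef s./2 k *
        cast_tensor (even_rank s k evs)
          (symprod (sympow (metric_tensor n.+1) (s./2 - k))
                   (surface_tensor Lambda (2 * k) K)) z)%:E) /\
  (odd s -> forall z : 'I_s -> 'rV[R]_n.+1,
     (\int[mu]_E (relative_tensor Lambda (line_set E) s (K `&` line_set E)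
                    z)%:E)%E = 0%E).
Proof.
split=> [evs z|os z]; last by rewrite (integral_relative_tensor HLambda Hmu z HK) os.
rewrite (integral_relative_tensor HLambda Hmu z HK) (negPf evs); congr EFin.
(* The Steiner formula concerns nonempty bodies; for the empty one both sides vanish. *)
have [K0|/set0P K0] := eqVneq K set0.
  rewrite K0 big1 => [|k _].
    rewrite mulr0 /direction_tensor (_ : hits set0 = set0) ?Rintegral_set0 ?mulr0//.
    by apply/seteqP; split => // E [x []].
  rewrite /cast_tensor /symprod big1 ?mulr0// => sg _.
  by rewrite surface_tensor0 ?mulr0.
have [m sE] : exists m, s = (2 * m)%N by exists s./2; rewrite mul2n even_halfK.
have m2 : s./2 = m by rewrite sE mul2n doubleK.
(* The type of the rank equation mentions s, so it is generalized before s is replaced by 2m. *)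
move: (@even_rank s) evs z; rewrite m2 sE => er evs z.
exact: (crofton_surface HLambda Hmu z (fun k => er k evs) HK K0).
Qed.
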